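(* Let $\alpha\in(\frac13,\frac12]$, $m\in[2,\infty)$, $\gamma\in\mathbb{R}$ and $A\in C_2^\alpha L_m\mathcal{H}_\gamma$. Assume there exist positive constants $K_1,K_2,z_1,z_2$ and a process $\Lambda:\Delta_3\times\Omega\to\mathcal{H}_\gamma$ such that $\frac12<z_1\le1<z_2$ and, for every $(s,r,t)\in\Delta_3$, $$\hat\delta A_{s,r,t}=S_{r,t}\Lambda_{s,r,t},$$ $$\|\Lambda_{s,r,t}\|_{m,\gamma+z_2-z_1}\le K_1|t-s|^{\frac12}|t-r|^{z_1-\frac12},\qquad\|\mathbb{E}_s\Lambda_{s,r,t}\|_{m,\gamma}\le K_2|t-s||t-r|^{z_2-1}.$$ Then there exists a unique $\mathcal{A}\in\hat C^\alpha L_m\mathcal{H}_\gamma$ with $\mathcal{A}_0=0$ such that $$\lim_{\pi\in\mathcal{P}[s,t],\,|\pi|\to0}\Big\|\hat\delta\mathcal{A}_{s,t}-\sum_{[r,v]\in\pi}S_{v,t}A_{r,v}\Big\|_{m,\gamma}=0,\quad\forall(s,t)\in\Delta_2.$$ Moreover, for every $\eta\in[0,z_2)$, $$\|\hat\delta\mathcal{A}_{s,t}-A_{s,t}\|_{m,\gamma+\eta}\lesssim K_1|t-s|^{z_1-(\eta+z_1-z_2)^+}+K_2|t-s|^{z_2-\eta},\quad\forall(s,t)\in\Delta_2.$$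
   Context: **Setting.** Fix $T>0$; $\Delta_2=\{(s,t):0\le s\le t\le T\}$, $\Delta_3=\{(s,r,t):0\le s\le r\le t\le T\}$; $\mathcal{P}[s,t]$ is the set of partitions of $[s,t]$ and $|\pi|$ the mesh of $\pi$. $(\Omega,\mathcal{F},(\mathcal{F}_t),\mathbb{P})$ is a filtered probability space satisfying the usual conditions; $\mathbb{E}_s=\mathbb{E}[\cdot|\mathcal{F}_s]$. $a\lesssim b$ means $a\le Cb$ with $C$ depending only on the fixed parameters ($\alpha,m,\gamma,z_1,z_2,\eta$), on $T\vee1$ and on the fixed spaces and propagator (in particular not on $K_1,K_2,A,\Lambda,s,t$). $x^+=\max(x,0)$. **Monotone family and propagator.** $(\mathcal{H}_\gamma,|\cdot|_\gamma)_{\gamma\in\mathbb{R}}$ is a monotone family of interpolation Hilbert spaces: each $\mathcal{H}_\gamma$ is a separable Hilbert space; for $\gamma_1\le\gamma_2$, $\mathcal{H}_{\gamma_2}$ is a continuously embedded dense subspace of $\mathcal{H}_{\gamma_1}$; and $|u|_{\gamma_2}^{\gamma_3-\gamma_1}\lesssim|u|_{\gamma_1}^{\gamma_3-\gamma_2}|u|_{\gamma_3}^{\gamma_2-\gamma_1}$ for $\gamma_1\le\gamma_2\le\gamma_3$, $u\in\mathcal{H}_{\gamma_3}$. $(L_t)_{t\in[0,T]}$ is a family of unbounded operators such that for all $t$, $\gamma$, $L_t$ is closed and densely defined on $\mathcal{H}_\gamma$ with domain containing $\mathcal{H}_{\gamma+1}$, and $(L_t)$ generates a propagator $S:\Delta_2\to\cap_\gamma\mathcal{L}(\mathcal{H}_\gamma)$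 (for $u\in\mathcal{H}_{\gamma+1}$: $\partial_tS_{s,t}u=L_tS_{s,t}u$, $\partial_sS_{s,t}u=-S_{s,t}L_su$ in $\mathcal{H}_\gamma$): $S$ is strongly continuous on each $\mathcal{H}_\gamma$, $S_{r,t}S_{s,r}=S_{s,t}$ on $\Delta_3$, $S_{t,t}=\mathrm{id}$, and for $\gamma_1\le\gamma_2\le\gamma_1+1$, $0\le s<t\le T$: $|S_{s,t}u|_{\gamma_2}\lesssim|t-s|^{\gamma_1-\gamma_2}|u|_{\gamma_1}$ and $|S_{s,t}u-u|_{\gamma_1}\lesssim|t-s|^{\gamma_2-\gamma_1}|u|_{\gamma_2}$. **Notation.** $\|\xi\|_{m,\gamma}=\||\xi|_\gamma\|_{L^m(\Omega)}$. For $Y:[0,T]\times\Omega\to\mathcal{H}_\gamma$: $\hat\delta Y_{s,t}=Y_t-S_{s,t}Y_s$. For $A:\Delta_2\times\Omega\to\mathcal{H}_\gamma$: $\hat\delta A_{s,r,t}=A_{s,t}-S_{r,t}A_{s,r}-A_{r,t}$. $\|A\|_{\beta,m,\gamma}=\sup_{0\le s<t\le T}\|A_{s,t}\|_{m,\gamma}/|t-s|^\beta$. $C_2^\beta L_m\mathcal{H}_\gamma$: measurable adapted ($A_{s,t}$ is $\mathcal{F}_t$-measurable) processes $A$ that are bounded continuous as maps $\Delta_2\to L^m(\Omega,\mathcal{H}_\gamma)$ with $\|A\|_{\beta,m,\gamma}<\infty$. $\hat C^\beta L_m\mathcal{H}_\gamma$: measurable adapted processes $Y\in C([0,T],L^m(\Omega,\mathcal{H}_\gamma))$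 with $\|\hat\delta Y\|_{\beta,m,\gamma}<\infty$. *)

(* Defs.v *)
From HB Require Import structures.
From mathcomp Require Import all_boot all_order all_algebra.
From mathcomp Require Import all_classical all_reals all_analysis.

Set Implicit Arguments.
Unset Strict Implicit.
Unset Printing Implicit Defensive.

Import Order.TTheory GRing.Theory Num.Theory.
Import numFieldNormedType.Exports.

Local Open Scope classical_set_scope.
Local Open Scope ring_scope.

(* The spaces are real Hilbert spaces; a complex Hilbert space is one, with
   the real part of its inner product.  The inclusion of H_b into H_a, for
   a <= b, is the map emb a b, on which nothing is assumed when b < a. *)
Record monotone_family (R : realType) := MonotoneFamily {
  space :> R -> completeNormedModType R;
  inner : forall g, space g -> space g -> R;
  innerC : forall g (u v : space g), inner u v = inner v u;
  innerPl : forall g (a : R) (u v w : space g),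
    inner (a *: u + v) w = a * inner u w + inner v w;
  inner_norm : forall g (u : space g), inner u u = `|u| ^+ 2;
  separable : forall g, exists2 D : set (space g), countable D & dense D;
  emb : forall a b, {linear space b -> space a};
  emb_id : forall a (u : space a), emb a a u = u;
  emb_comp : forall a b c (u : space c), a <= b -> b <= c ->
    emb a b (emb b c u) = emb a c u;
  emb_inj : forall a b, a <= b -> injective (emb a b);
  emb_continuous : forall a b, a <= b -> continuous (emb a b);
  emb_dense : forall a b, a <= b -> dense (range (emb a b));
  interpolation : forall a b c, a <= b -> b <= c ->
    exists C : R, forall u : space c,
      `|emb b c u| `^ (c - a) <=
      C * (`|emb a c u| `^ (c - b) * `|u| `^ (b - a))
}.

Arguments emb {R} m a b.

Section norms.
Context {R : realType} (H : monotone_family R).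

(* |u|_g' for u in H_g and g <= g', equal to +oo unless u lies in H_g'. *)
Definition hnorm (g' : R) {g : R} (u : H g) : \bar R :=
  ereal_inf [set `|v|%:E | v in [set v : H g' | emb H g g' v = u]].

Definition Lmnorm {d} {Omega : measurableType d} (P : probability Omega R)
    (m g' : R) {g : R} (X : Omega -> H g) : \bar R :=
  Lnorm P m%:E (fun w => hnorm g' (X w)).

End norms.

Section simplices.
Context {R : realType}.

Definition Delta2 (T : R) : set (R * R) :=
  [set z | [/\ 0 <= z.1, z.1 <= z.2 & z.2 <= T]].

Definition Delta3 (T : R) : set (R * R * R) :=
  [set z | [/\ 0 <= z.1.1, z.1.1 <= z.1.2, z.1.2 <= z.2 & z.2 <= T]].

End simplices.

(* The realizations on the spaces H_g of a family of closed, densely defined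
   operators. *)
Record operator_family (R : realType) (H : monotone_family R) (T : R) :=
  OperatorFamily {
  dom : forall g : R, R -> set (H g);
  op : forall g : R, R -> H g -> H g;
  dom0 : forall g t, 0 <= t <= T -> dom t (0 : H g);
  domP : forall g t (a : R) (u v : H g), 0 <= t <= T ->
    dom t u -> dom t v -> dom t (a *: u + v);
  opP : forall g t (a : R) (u v : H g), 0 <= t <= T ->
    dom t u -> dom t v -> op t (a *: u + v) = a *: op t u + op t v;
  op_closed : forall g t, 0 <= t <= T ->
    closed [set z : H g * H g | dom t z.1 /\ z.2 = op t z.1];
  dom_dense : forall g t, 0 <= t <= T -> dense (dom t : set (H g));
  dom_emb : forall g t, 0 <= t <= T -> range (emb H g (g + 1)) `<=` dom t;
  op_emb : forall a b t (u : H b), a <= b -> 0 <= t <= T ->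
    dom t u -> dom t (emb H a b u) -> op t (emb H a b u) = emb H a b (op t u)
}.

(* prop g s t is S_{s,t} acting on H_g; it is relevant only for (s, t) in
   Delta2.  The derivatives are one-sided at the end points. *)
Record propagator (R : realType) (H : monotone_family R) (T : R)
    (L : operator_family H T) := Propagator {
  prop :> forall g : R, R -> R -> {linear H g -> H g};
  prop_bounded : forall g s t, Delta2 T (s, t) -> continuous (prop g s t);
  prop_emb : forall a b s t (u : H b), a <= b -> Delta2 T (s, t) ->
    prop a s t (emb H a b u) = emb H a b (prop b s t u);
  prop_derive_t : forall g s t (u : H (g + 1)), Delta2 T (s, t) ->
    (t' - t)^-1 *:
      (prop g s t' (emb H g (g + 1) u) - prop g s t (emb H g (g + 1) u))
      @[t' --> within `[s, T] t^']
    --> op L t (prop g s t (emb H g (g + 1) u));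
  prop_derive_s : forall g s t (u : H (g + 1)), Delta2 T (s, t) ->
    (s' - s)^-1 *:
      (prop g s' t (emb H g (g + 1) u) - prop g s t (emb H g (g + 1) u))
      @[s' --> within `[0, t] s^']
    --> - prop g s t (op L s (emb H g (g + 1) u));
  prop_continuous : forall g (u : H g),
    {within Delta2 T, continuous (fun z => prop g z.1 z.2 u)};
  prop_comp : forall g s r t (u : H g), Delta3 T (s, r, t) ->
    prop g r t (prop g s r u) = prop g s t u;
  prop_id : forall g t (u : H g), 0 <= t <= T -> prop g t t u = u;
  prop_smoothing : forall g1 g2, g1 <= g2 -> g2 <= g1 + 1 ->
    exists C : R, forall s t (u : H g1), 0 <= s -> s < t -> t <= T ->
      (hnorm g2 (prop g1 s t u) <= (C * ((t - s) `^ (g1 - g2) * `|u|))%:E)%E;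
  prop_increment : forall g1 g2, g1 <= g2 -> g2 <= g1 + 1 ->
    exists C : R, forall s t (u : H g2), 0 <= s -> s < t -> t <= T ->
      `|prop g1 s t (emb H g1 g2 u) - emb H g1 g2 u|
        <= C * ((t - s) `^ (g2 - g1) * `|u|)
}.

Record usual_filtration {R : realType} {d} {Omega : measurableType d}
    (P : probability Omega R) (T : R) (Ft : R -> set (set Omega)) : Prop :=
  UsualFiltration {
  filtration_sigma : forall t, 0 <= t <= T -> sigma_algebra setT (Ft t);
  filtration_sub : forall t, 0 <= t <= T -> Ft t `<=` measurable;
  filtration_incr : forall s t, Delta2 T (s, t) -> Ft s `<=` Ft t;
  filtration_complete : forall N : set Omega, P.-negligible N -> Ft 0 N;
  filtration_right : forall t, 0 <= t < T ->
    forall B, (forall u, t < u <= T -> Ft u B) -> Ft t B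
}.

Definition borel (E : ptopologicalType) := g_sigma_algebraType (@open E).

Section random_variables.
Context {R : realType} {d : measure_display} {Omega : measurableType d}.
Variables (P : probability Omega R) (E : normedModType R).

Definition measurable_wrt (G : set (set Omega)) (X : Omega -> E) :=
  measurable_fun setT (X : g_sigma_algebraType G -> borel E).

(* Bochner integral of X over B: simple functions have finite range. *)
Definition simple (X : Omega -> E) :=
  finite_set (range X) /\ forall y, measurable (X @^-1` [set y]).

Definition simple_integral (B : set Omega) (X : Omega -> E) : E :=
  \sum_(y \in range X) fine (P (B `&` X @^-1` [set y])) *: y.

Definition bochner_integral (B : set Omega) (X : Omega -> E) (I : E) :=
  exists X_ : (Omega -> E)^nat,
    [/\ forall n, simple (X_ n),
        (\int[P]_(w in B) `|(X_ n w - X w)%R|%:E)%E @[n --> \oo] --> 0%E &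
        simple_integral B (X_ n) @[n --> \oo] --> I].

(* Z is a version of the conditional expectation of X given G. *)
Definition condexp (G : set (set Omega)) (X Z : Omega -> E) :=
  measurable_wrt G Z /\
  forall B, G B -> exists2 I, bochner_integral B X I & bochner_integral B Z I.

End random_variables.

Section processes.
Context {R : realType} (H : monotone_family R) (T : R).
Context {L : operator_family H T} (S : propagator L).
Context {d : measure_display} {Omega : measurableType d}.
Variables (P : probability Omega R) (Ft : R -> set (set Omega)).
Context {g : R}.
Implicit Types (A : R -> R -> Omega -> H g) (Y : R -> Omega -> H g).

Definition delta1 Y (s t : R) (w : Omega) : H g := Y t w - S g s t (Y s w).

Definition delta2 A (s r t : R) (w : Omega) : H g :=
  A s t w - S g r t (A s r w) - A r t w.

Definition holder_norm (beta m : R) A : \bar R :=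
  ereal_sup [set (Lmnorm P m g (A z.1 z.2) * ((z.2 - z.1) `^ beta)^-1%:E)%E |
    z in [set z | Delta2 T z /\ z.1 < z.2]].

Record C2_space (beta m : R) A : Prop := C2Space {
  C2_measurable : measurable_fun (Delta2 T `*` setT)
    ((fun z => A z.1.1 z.1.2 z.2) :
       measurableTypeR R * measurableTypeR R * Omega -> borel (H g));
  C2_adapted : forall s t, Delta2 T (s, t) -> measurable_wrt (Ft t) (A s t);
  C2_bounded : exists M : R, forall s t, Delta2 T (s, t) ->
    (Lmnorm P m g (A s t) <= M%:E)%E;
  C2_continuous : forall z, Delta2 T z ->
    Lmnorm P m g (A z'.1 z'.2 \- A z.1 z.2)
      @[z' --> within (Delta2 T) (nbhs z)] --> 0%E;
  C2_holder : (holder_norm beta m A < +oo)%E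
}.

Record Chat_space (beta m : R) Y : Prop := ChatSpace {
  Chat_measurable : measurable_fun (`[0, T] `*` setT)
    ((fun z => Y z.1 z.2) : measurableTypeR R * Omega -> borel (H g));
  Chat_adapted : forall t, 0 <= t <= T -> measurable_wrt (Ft t) (Y t);
  Chat_finite : forall t, 0 <= t <= T -> (Lmnorm P m g (Y t) < +oo)%E;
  Chat_continuous : forall t, 0 <= t <= T ->
    Lmnorm P m g (Y t' \- Y t) @[t' --> within `[0, T] (nbhs t)] --> 0%E;
  Chat_holder : (holder_norm beta m (delta1 Y) < +oo)%E
}.

(* A partition of [s, t] with points s < t_1 < ... < t_n = t is given by the
   list pi = [:: t_1; ...; t_n], as in itv_partition; its intervals are the
   pairs of consecutive points. *)
Definition intervals (s : R) (pi : seq R) : seq (R * R) := zip (s :: pi) pi.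

Definition mesh (s : R) (pi : seq R) : R :=
  \big[Num.max/0]_(p <- intervals s pi) (p.2 - p.1).

Definition partition_sum A (s t : R) (pi : seq R) (w : Omega) : H g :=
  \sum_(p <- intervals s pi) S g p.2 t (A p.1 p.2 w).

Definition sewing_limit (m : R) A Y := forall s t, Delta2 T (s, t) ->
  forall e : R, 0 < e -> exists2 delta : R, 0 < delta &
    forall pi, itv_partition s t pi -> mesh s pi < delta ->
      (Lmnorm P m g (delta1 Y s t \- partition_sum A s t pi)%R < e%:E)%E.

Definition is_sewing (alpha m : R) A Y :=
  [/\ Chat_space alpha m Y, {ae P, forall w, Y 0 w = 0} & sewing_limit m A Y].

End processes.

(* Main.v *)
Require Import Defs.
From HB Require Import structures.
From mathcomp Require Import all_boot all_order all_algebra.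
From mathcomp Require Import all_classical all_reals all_analysis.
From mathcomp Require Import measurable_realfun ring lra.

(* The analytic engine is a moment inequality for sums: if Y_i is measurable
   with respect to G_{i+1}, then the L^m norm of the sum of the Y_i is at most
   2 m times the sum of the norms of E[Y_i | G_i], plus a constant times the
   square root of the sum of the squared norms of the Y_i.  It comes from the
   second-order Taylor bound of |x + y|^m in a Hilbert space and replaces the
   Burkholder-Davis-Gundy inequality.

   Inserting a point r_i in each interval [p_i, p_{i+1}] changes the Riemann
   sum by the sum of the S_{r_i, t} Lambda_{p_i, r_i, p_{i+1}}, to which this
   inequality applies.  Along dyadic refinements the changes decay
   geometrically, hence the sums converge; running the same estimate on the
   remainders shows that the limit does not depend on the partitions.

   For the bound in H_(gamma + eta), the midpoints r_i of the dyadic intervals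
   of [s, t] stay away from t, so that S_{r_i, t} regularizes at the price of
   a power of t - r_i.  The weighted sums of h^z2 (t - r_i)^(- eta) and of
   h^(2 z1) (t - r_i)^(- 2 theta), with theta = max(eta + z1 - z2, 0), still
   decay geometrically in the level because eta < z2 and theta < z1. *)

Set Implicit Arguments.
Unset Strict Implicit.
Unset Printing Implicit Defensive.

Import Order.TTheory GRing.Theory Num.Theory.
Import numFieldNormedType.Exports.

Local Open Scope classical_set_scope.
Local Open Scope ring_scope.

(** * Borel measurability in separable normed spaces *)

Section borel_measurability.
Context {d : measure_display} {T : measurableType d} {R : realType}.

Lemma measurable_borelP (E : ptopologicalType) (X : T -> borel E) :
  (forall U : set E, open U -> measurable (X @^-1` U)) -> measurable_fun setT X.
Proof.
move=> h; apply: (@measurability _ _ _ (borel E) _ _ (@open E)) => // _ [U oU <-].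
by rewrite setTI; exact: h.
Qed.

Lemma measurable_borel_open (E : ptopologicalType) (X : T -> borel E) (U : set E) :
  measurable_fun setT X -> open U -> measurable (X @^-1` U).
Proof.
move=> mX oU; rewrite -[_ @^-1` _]setTI; apply: mX => //.
exact: sub_sigma_algebra.
Qed.

Lemma measurable_borelR (X : T -> R) :
  measurable_fun setT (X : T -> borel R) <-> measurable_fun setT (X : T -> R).
Proof.
split=> mX.
  apply: (measurability _ (RGenOInfty.measurableE R)) => // _ [_ [x ->] <-].
  by rewrite setTI; apply: measurable_borel_open mX _; exact: interval_open.
apply: measurable_borelP => U oU; rewrite -[_ @^-1` _]setTI; apply: mX => //.
exact: open_measurable.
Qed.

Lemma measurable_borel_comp (E F : ptopologicalType) (f : E -> F) (X : T -> E) :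
  continuous f -> measurable_fun setT (X : T -> borel E) ->
  measurable_fun setT (f \o X : T -> borel F).
Proof.
move=> /continuousP cf mX; apply: measurable_borelP => U oU.
by rewrite comp_preimage; apply: measurable_borel_open mX _; exact: cf.
Qed.

End borel_measurability.

Definition dense_sequence {R : realType} {E : normedModType R} (e : nat -> E) :=
  forall (x : E) (eps : R), 0 < eps -> exists n, `|x - e n| < eps.

Lemma ex_natSinv_lt (R : realType) (eps : R) : 0 < eps ->
  exists k : nat, k.+1%:R^-1 < eps.
Proof.
move=> eps0; exists (Num.truncn eps^-1).
by rewrite invf_plt ?posrE// truncnS_gt.
Qed.

Lemma separable_dense_sequence (R : realType) (H : monotone_family R) (g : R) :
  exists e : nat -> H g, dense_sequence e.
Proof.
have [D cD dD] := separable H g.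
have /(@pcard_surjP (H g) _ D [set: nat])[e eD] : (D #<= [set: nat])%card by [].
exists e => x eps eps0.
have [||y [xy Dy]] := dD (ball x eps).
- by exists x; exact: ballxx.
- exact: ball_open.
have [n _ eny] := eD _ Dy.
by exists n; rewrite eny; move: xy; rewrite -ball_normE.
Qed.

Section separable_measurability.
Context {d : measure_display} {T : measurableType d} {R : realType}.
Variables (E1 E2 : normedModType R) (e1 : nat -> E1) (e2 : nat -> E2).
Hypotheses (he1 : dense_sequence e1) (he2 : dense_sequence e2).

Lemma measurable_borel_comp2 (F : ptopologicalType) (f : E1 * E2 -> F)
    (X : T -> E1) (Y : T -> E2) :
  continuous f -> measurable_fun setT (X : T -> borel E1) ->
  measurable_fun setT (Y : T -> borel E2) ->
  measurable_fun setT ((fun w => f (X w, Y w)) : T -> borel F).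
Proof.
move=> /continuousP cf mX mY; apply: measurable_borelP => U /cf oU.
set V := f @^-1` U in oU.
pose box (i : nat * nat * nat) : set T :=
  X @^-1` ball (e1 i.1.1) (i.2.+1%:R^-1) `&` Y @^-1` ball (e2 i.1.2) (i.2.+1%:R^-1).
pose good (i : nat * nat * nat) : Prop :=
  forall x y, ball (e1 i.1.1) (i.2.+1%:R^-1) x ->
    ball (e2 i.1.2) (i.2.+1%:R^-1) y -> V (x, y).
have -> : (fun w => f (X w, Y w)) @^-1` U =
    \bigcup_i (if `[< good i >] then box i else set0).
  apply/seteqP; split => w /=.
    move=> Uw; have : nbhs (X w, Y w) V by apply: open_nbhs_nbhs; split.
    move=> /nbhs_ballP[eps /= eps0 epsV].
    have [k keps] := ex_natSinv_lt (divr_gt0 eps0 (ltr0Sn R 1)).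
    have k0 : 0 < k.+1%:R^-1 :> R by rewrite invr_gt0.
    have [i iX] := he1 (X w) k0; have [j jY] := he2 (Y w) k0.
    have iX' : ball (e1 i) k.+1%:R^-1 (X w) by rewrite -ball_normE /= distrC.
    have jY' : ball (e2 j) k.+1%:R^-1 (Y w) by rewrite -ball_normE /= distrC.
    exists (i, j, k) => //; case: asboolP => [_|]; first by split.
    case=> x y bx bY; apply: epsV; split => /=.
      by apply: (@ball_splitr _ _ (e1 i)); [apply: (le_ball (ltW keps)) iX'|
        apply: (le_ball (ltW keps)) bx].
    by apply: (@ball_splitr _ _ (e2 j)); [apply: (le_ball (ltW keps)) jY'|
      apply: (le_ball (ltW keps)) bY].
  by case=> i _; case: asboolP => // gi [Xi Yi]; exact: gi.
apply: countable_bigcupT_measurable; first exact: countableP.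
move=> i; case: asboolP => // _.
by apply: measurableI; [apply: measurable_borel_open mX _|apply: measurable_borel_open mY _];
  apply: ball_open; rewrite invr_gt0.
Qed.

End separable_measurability.

Definition cauchy_at {R : realType} {E : normedModType R} (u : nat -> E) : Prop :=
  forall k, exists N, forall n, (N <= n)%N -> `|u n - u N| <= k.+1%:R^-1.

Section measurable_vector_functions.
Context {d : measure_display} {T : measurableType d} {R : realType}.
Variables (E : normedModType R) (e : nat -> E).
Hypothesis he : dense_sequence e.
Local Notation measurableE X := (measurable_fun setT (X : T -> borel E)).

Lemma measurable_vec_cst (x : E) : measurableE (fun=> x).
Proof.
apply: measurable_borelP => U oU.
by rewrite (preimage_cst x U); case: ifP.
Qed.

Lemma measurable_vecD (X Y : T -> E) : measurableE X -> measurableE Y ->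
  measurableE (fun w => X w + Y w).
Proof.
by move=> mX mY; apply: (measurable_borel_comp2 he he (f := fun z => z.1 + z.2)) => //;
  exact: add_continuous.
Qed.

Lemma measurable_vecN (X : T -> E) : measurableE X -> measurableE (fun w => - X w).
Proof. by move=> mX; apply: (measurable_borel_comp (f := -%R)) => //; exact: opp_continuous. Qed.

Lemma measurable_vecB (X Y : T -> E) : measurableE X -> measurableE Y ->
  measurableE (fun w => X w - Y w).
Proof. by move=> mX mY; apply: measurable_vecD => //; exact: measurable_vecN. Qed.

Lemma measurable_vec_sum I (r : seq I) (X : I -> T -> E) :
  (forall i, measurableE (X i)) -> measurableE (fun w => \sum_(i <- r) X i w).
Proof.
move=> mX; elim: r => [|i r ih].
  by under [X in measurable_fun _ X]eq_fun do rewrite big_nil; exact: measurable_vec_cst.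
under [X in measurable_fun _ X]eq_fun do rewrite big_cons.
exact: measurable_vecD.
Qed.

Lemma measurable_vec_norm (X : T -> E) : measurableE X -> measurable_fun setT (fun w => `|X w|).
Proof.
move=> mX; apply/measurable_borelR.
by apply: (measurable_borel_comp (f := fun x : E => `|x|)) => //; exact: norm_continuous.
Qed.

Lemma measurable_vec_dist (X : T -> E) :
  (forall x, measurable_fun setT (fun w => `|X w - x|)) -> measurableE X.
Proof.
move=> mX; apply: measurable_borelP => U oU.
pose good (i : nat * nat) := ball (e i.1) (i.2.+1%:R^-1) `<=` U.
have -> : X @^-1` U = \bigcup_i (if `[< good i >]
    then (fun w => `|X w - e i.1|) @^-1` `]-oo, i.2.+1%:R^-1[ else set0).
  apply/seteqP; split => w /=.
    move=> Uw; have : nbhs (X w) U by apply: open_nbhs_nbhs; split.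
    move=> /nbhs_ballP[eps /= eps0 epsU].
    have [k keps] := ex_natSinv_lt (divr_gt0 eps0 (ltr0Sn R 1)).
    have k0 : 0 < k.+1%:R^-1 :> R by rewrite invr_gt0.
    have [i iX] := he (X w) k0.
    exists (i, k) => //; case: asboolP => [_|]; first by rewrite /= in_itv.
    case=> x bx; apply: epsU; apply: (@ball_splitr _ _ (e i)).
      by apply: (le_ball (ltW keps)); rewrite -ball_normE /= distrC.
    exact: (le_ball (ltW keps)) bx.
  case=> i _; case: asboolP => // gi /=; rewrite in_itv /= => Xi.
  by apply: gi; rewrite -ball_normE /= distrC.
apply: countable_bigcupT_measurable; first exact: countableP.
move=> i; case: asboolP => // _; rewrite -[_ @^-1` _]setTI.
exact: mX.
Qed.

Lemma measurable_vec_lim (X_ : nat -> T -> E) (X : T -> E) :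
  (forall n, measurableE (X_ n)) -> (forall w, X_ n w @[n --> \oo] --> X w) ->
  measurableE X.
Proof.
move=> mX cX; apply: measurable_vec_dist => x.
apply: (measurable_fun_cvg (h := fun n w => `|X_ n w - x|)) => [n|w _].
  by apply: measurable_vec_norm; apply: measurable_vecB => //; exact: measurable_vec_cst.
by apply: cvg_norm; apply: cvgB => //; exact: cvg_cst.
Qed.

Lemma measurable_vec_if (A : set T) (X Y : T -> E) : measurable A ->
  measurableE X -> measurableE Y ->
  measurableE (fun w => if w \in A then X w else Y w).
Proof.
move=> mA mX mY; apply: measurable_borelP => U oU.
rewrite (_ : _ @^-1` U = (A `&` X @^-1` U) `|` (~` A `&` Y @^-1` U)).
  apply: measurableU; apply: measurableI => //; try exact: measurableC;
  exact: measurable_borel_open.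
apply/seteqP; split => w /=.
  by case: ifPn; rewrite ?inE ?notin_setE; [left|right].
by case=> -[Aw Uw]; [rewrite mem_set|rewrite memNset].
Qed.

Lemma measurable_cauchy_at (X_ : nat -> T -> E) :
  (forall n, measurableE (X_ n)) -> measurable [set w | cauchy_at (X_ ^~ w)].
Proof.
move=> mX.
rewrite (_ : mkset _ = \bigcap_k \bigcup_N \bigcap_n
    [set w | (N <= n)%N -> `|X_ n w - X_ N w| <= k.+1%:R^-1]); last first.
  apply/seteqP; split => w /=.
    by move=> h k _; have [N hN] := h k; exists N => // n _; exact: hN.
  by move=> h k; have [N _ hN] := h k I; exists N => n; exact: hN.
apply: bigcapT_measurable => k; apply: bigcupT_measurable => N.
apply: bigcapT_measurable => n; case: (leqP N n) => Nn; last first.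
  by rewrite (_ : mkset _ = setT) //; apply/seteqP; split.
rewrite (_ : mkset _ = (fun w => `|X_ n w - X_ N w|) @^-1` `]-oo, k.+1%:R^-1]).
  rewrite -[_ @^-1` _]setTI.
  have : measurable_fun setT (fun w => `|X_ n w - X_ N w|).
    by apply: measurable_vec_norm; exact: measurable_vecB.
  exact.
by apply/seteqP; split => w /=; rewrite in_itv /=; [exact|].
Qed.

End measurable_vector_functions.

(* Equal to [0] where the sequence diverges, so that it is measurable. *)
Definition plim {T : Type} {R : realType} {E : completeNormedModType R}
    (X_ : nat -> T -> E) (w : T) : E :=
  if w \in [set w | cauchy_at (X_ ^~ w)] then lim (X_ n w @[n --> \oo]) else 0.

Section pointwise_limit.
Context {d : measure_display} {T : measurableType d} {R : realType}.
Variables (E : completeNormedModType R) (e : nat -> E).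
Hypothesis he : dense_sequence e.

Lemma cauchy_at_cvg (u : nat -> E) : cauchy_at u -> cvgn u.
Proof.
move=> cu; apply/cauchy_cvgP/cauchyP => eps eps0.
have [k keps] := ex_natSinv_lt eps0; have [N hN] := cu k.
exists (u N); exists N => // n /= Nn.
by rewrite -ball_normE /= distrC (le_lt_trans (hN _ Nn)).
Qed.

Lemma cvg_cauchy_at (u : nat -> E) : cvgn u -> cauchy_at u.
Proof.
move=> /cvg_cauchy/cauchyP cu k.
have [|x [N _ hN]] := cu (k.+1%:R^-1 / 2); first by rewrite divr_gt0 ?invr_gt0.
exists N => n Nn; apply/ltW; have := hN _ Nn; have := hN _ (leqnn N).
move=> /= /ball_splitr /[apply]; rewrite -ball_normE /= distrC; exact.
Qed.

Lemma measurable_plim (X_ : nat -> T -> E) :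
  (forall n, measurable_fun setT (X_ n : T -> borel E)) ->
  measurable_fun setT (plim X_ : T -> borel E).
Proof.
move=> mX; have mC := measurable_cauchy_at he mX.
apply: (measurable_vec_lim he (X_ := fun n w =>
    if w \in [set w | cauchy_at (X_ ^~ w)] then X_ n w else 0)) => [n|w].
  by apply: measurable_vec_if => //; exact: measurable_vec_cst.
rewrite /plim; case: ifPn => [|_]; last exact: cvg_cst.
by rewrite inE => /cauchy_at_cvg.
Qed.

Lemma cvg_plim (X_ : nat -> T -> E) w :
  cvgn (X_ ^~ w) -> X_ n w @[n --> \oo] --> plim X_ w.
Proof. by move=> cX; rewrite /plim mem_set //; exact: cvg_cauchy_at. Qed.

End pointwise_limit.

(** * Bounds in L^m *)

Lemma powR_le (R : realType) (r x y : R) : 0 <= r -> 0 <= x -> x <= y ->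
  x `^ r <= y `^ r.
Proof.
move=> r0 x0 xy; apply: ge0_ler_powR => //; rewrite nnegrE //.
exact: le_trans xy.
Qed.

Lemma powR_le_inv (R : realType) (r x y : R) : 0 < r -> 0 <= y ->
  x `^ r <= y `^ r -> x <= y.
Proof.
move=> r0 y0; apply: contraTT; rewrite -!ltNge => yx.
by apply: gt0_ltr_powR => //; rewrite nnegrE // (le_trans y0) // ltW.
Qed.

Lemma powR_invl (R : realType) (x r : R) : 0 <= x -> x^-1 `^ r = (x `^ r)^-1.
Proof. by move=> x0; rewrite -powR_inv1 // -powRrM mulN1r powRN. Qed.

Lemma powR_exprn (R : realType) (x r : R) n : 0 <= x -> (x ^+ n) `^ r = (x `^ r) ^+ n.
Proof.
move=> x0; elim: n => [|n ih]; first by rewrite !expr0 powR1.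
by rewrite !exprS powRM ?exprn_ge0 // ih.
Qed.

Section lower_integral.
Context {d : measure_display} {T : measurableType d} {R : realType}.
Variable mu : {measure set T -> \bar R}.

(* No measurability is assumed: the integral is a supremum over simple functions. *)
Lemma le_integral_nonmeasurable (f g : T -> \bar R) :
  (forall w, 0 <= f w)%E -> (forall w, f w <= g w)%E ->
  (\int[mu]_w f w <= \int[mu]_w g w)%E.
Proof.
move=> f0 fg; rewrite ge0_integralTE // ge0_integralTE; last first.
  by move=> w; exact: le_trans (fg w).
apply: le_ereal_sup => _ [h hf <-]; exists h => // w.
exact: le_trans (hf w) (fg w).
Qed.

End lower_integral.

Section Lm_bounds.
Context {d : measure_display} {Omega : measurableType d} {R : realType}.
Variables (P : probability Omega R) (m : R).
Hypothesis m1 : 1 <= m.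

Definition Lbound {E : normedModType R} (X : Omega -> E) (c : R) : Prop :=
  [/\ measurable_fun setT (X : Omega -> borel E), 0 <= c &
    (\int[P]_w (`|X w| `^ m)%:E <= (c `^ m)%:E)%E].

Let m0 : 0 < m. Proof. exact: lt_le_trans m1. Qed.

Lemma measurable_norm_powR (E : normedModType R) (X : Omega -> E) (r : R) :
  measurable_fun setT (X : Omega -> borel E) ->
  measurable_fun setT (fun w => (`|X w| `^ r)).
Proof. by move=> mX; apply: (measurableT_comp (measurable_powR r)); exact: measurable_vec_norm. Qed.

Lemma Lnorm_le (f : Omega -> \bar R) (c : R) : 0 <= c ->
  ('N[P]_m%:E[f] <= c%:E)%E = (\int[P]_w (`|f w| `^ m) <= (c `^ m)%:E)%E.
Proof.
move=> c0; rewrite -poweR_Lnorm ?gt_eqF // -poweR_EFin.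
apply/idP/idP => h.
  apply: gt0_ler_poweR => //; first exact: ltW.
    by rewrite in_itv /= leey Lnorm_ge0.
  by rewrite in_itv /= leey lee_fin c0.
move: h; have := Lnorm_ge0 P m%:E f.
case: ('N[P]_m%:E[f])%E => [r||] //=.
  by rewrite !lee_fin => r0; exact: powR_le_inv.
by rewrite gt_eqF.
Qed.

Lemma Lnorm_norm_le (E : normedModType R) (X : Omega -> E) c : 0 <= c ->
  (Lnorm P m%:E (fun w => (`|X w|)%:E) <= c%:E)%E =
  (\int[P]_w (`|X w| `^ m)%:E <= (c `^ m)%:E)%E.
Proof.
move=> c0; rewrite (Lnorm_le _ c0).
by under eq_integral do rewrite abse_EFin normr_id poweR_EFin.
Qed.

Lemma Lbound_le (E : normedModType R) (X : Omega -> E) c c' : c <= c' ->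
  Lbound X c -> Lbound X c'.
Proof.
move=> cc' [mX c0 hX]; split => //; first exact: le_trans cc'.
by apply: le_trans hX _; rewrite lee_fin powR_le // ltW.
Qed.

Lemma Lbound_dom (E F : normedModType R) (X : Omega -> E) (Y : Omega -> F) k c :
  measurable_fun setT (Y : Omega -> borel F) -> 0 <= k ->
  {ae P, forall w, `|Y w| <= k * `|X w|} -> Lbound X c -> Lbound Y (k * c).
Proof.
move=> mY k0 YX [mX c0 hX]; split => //; first exact: mulr_ge0.
have mXm := measurable_norm_powR m mX; have mYm := measurable_norm_powR m mY.
apply: (@le_trans _ _ (\int[P]_w ((k `^ m)%:E * (`|X w| `^ m)%:E))%E).
  apply: ae_ge0_le_integral => //.
  - exact/measurable_EFinP.
  - by move=> w _; rewrite -EFinM lee_fin mulr_ge0 ?powR_ge0.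
  - by apply: emeasurable_funM => //; exact/measurable_EFinP.
  apply: filterS YX => w YX _.
  by rewrite -EFinM -powRM // lee_fin powR_le // ltW.
rewrite ge0_integralZl //.
- rewrite powRM // EFinM lee_pmul //.
  + by rewrite lee_fin powR_ge0.
  + by apply: integral_ge0 => w _; rewrite lee_fin powR_ge0.
- exact/measurable_EFinP.
- by rewrite lee_fin powR_ge0.
Qed.

Lemma Lbound_map (E F : normedModType R) (f : E -> F) (X : Omega -> E) k c :
  continuous f -> 0 <= k -> (forall x, `|f x| <= k * `|x|) ->
  Lbound X c -> Lbound (f \o X) (k * c).
Proof.
move=> cf k0 fk hX; apply: Lbound_dom (hX) => //.
  by case: hX => mX _ _; exact: measurable_borel_comp.
by apply: nearW => w; exact: fk.
Qed.

Lemma Lbound_ae (E : normedModType R) (X Y : Omega -> E) c :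
  measurable_fun setT (Y : Omega -> borel E) -> {ae P, forall w, X w = Y w} ->
  Lbound X c -> Lbound Y c.
Proof.
move=> mY XY hX; rewrite -[c]mul1r; apply: Lbound_dom hX => //.
by apply: filterS XY => w ->; rewrite mul1r.
Qed.

Lemma Lbound_norm (E : normedModType R) (X : Omega -> E) c :
  Lbound X c -> Lbound (fun w => `|X w| : R^o) c.
Proof.
move=> hX; rewrite -[c]mul1r; apply: Lbound_dom (hX) => //.
  by case: hX => mX _ _; apply/measurable_borelR; exact: measurable_vec_norm.
by apply: nearW => w; rewrite normr_id mul1r.
Qed.

Lemma Lbound_cst0 (E : normedModType R) c : 0 <= c ->
  Lbound (fun=> 0 : E) c.
Proof.
move=> c0; split => //.
rewrite integral0_eq ?lee_fin ?powR_ge0 // => w _.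
by rewrite normr0 powR0 // gt_eqF.
Qed.

Lemma Lbound_eq0 (E : normedModType R) (X : Omega -> E) :
  Lbound X 0 -> {ae P, forall w, X w = 0}.
Proof.
move=> [mX _]; rewrite powR0 ?gt_eqF // => hX.
have mXm : measurable_fun setT (fun w => (`|X w| `^ m)%:E).
  exact/measurable_EFinP/measurable_norm_powR.
have : (\int[P]_w `|(`|X w| `^ m)%:E| = 0)%E.
  apply/eqP; rewrite eq_le integral_ge0 ?andbT //.
  apply: le_trans hX; apply: ge0_le_integral => //.
    by apply: measurableT_comp.
  by move=> w _; rewrite abse_EFin ger0_norm ?powR_ge0.
move/(ae_eq_integral_abs P measurableT mXm); apply: filterS => w /(_ I) /= [].
by move=> /eqP; rewrite powR_eq0 normr_eq0 => /andP[/eqP].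
Qed.

Lemma Lbound_inf (E : normedModType R) (X : Omega -> E) c : 0 <= c ->
  (forall eps, 0 < eps -> Lbound X (c + eps)) -> Lbound X c.
Proof.
move=> c0 h; have [mX _ _] := h 1 ltr01; split => //.
rewrite -Lnorm_norm_le //; apply/lee_addgt0Pr => eps eps0.
have [_ ? +] := h eps eps0.
by rewrite -Lnorm_norm_le.
Qed.

Section separable.
Variables (E : normedModType R) (e : nat -> E).
Hypothesis he : dense_sequence e.

Lemma LboundD (X Y : Omega -> E) a b :
  Lbound X a -> Lbound Y b -> Lbound (fun w => X w + Y w) (a + b).
Proof.
move=> [mX a0 hX] [mY b0 hY].
have mXY := measurable_vecD he mX mY.
have ab0 : 0 <= a + b by rewrite addr_ge0.
split => //.
have mn := measurable_vec_norm mX; have mn' := measurable_vec_norm mY.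
have NX : (Lnorm P m%:E (EFin \o (fun w => `|X w|)%R) <= a%:E)%E by rewrite Lnorm_norm_le.
have NY : (Lnorm P m%:E (EFin \o (fun w => `|Y w|)%R) <= b%:E)%E by rewrite Lnorm_norm_le.
have : (Lnorm P m%:E (EFin \o ((fun w => `|X w|) \+ (fun w => `|Y w|))%R) <= (a + b)%:E)%E.
  by apply: le_trans (minkowski_EFin P mn mn' m1) _; rewrite EFinD leeD.
rewrite (Lnorm_le _ ab0); apply: le_trans; apply: ge0_le_integral => //=.
- by apply/measurable_EFinP/measurable_norm_powR.
- apply/measurable_EFinP; apply: (measurableT_comp (measurable_powR m)).
  by apply: measurableT_comp => //; exact: measurable_funD.
move=> w _; rewrite lee_fin; apply: powR_le; [exact: ltW|exact: normr_ge0|].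
by rewrite [leRHS]ger0_norm ?addr_ge0 // ler_normD.
Qed.

Lemma LboundN (X : Omega -> E) a : Lbound X a -> Lbound (fun w => - X w) a.
Proof.
move=> hX; rewrite -[a]mul1r; apply: Lbound_dom (hX) => //.
  by case: hX => mX _ _; exact: measurable_vecN.
by apply: nearW => w; rewrite normrN mul1r.
Qed.

Lemma LboundB (X Y : Omega -> E) a b :
  Lbound X a -> Lbound Y b -> Lbound (fun w => X w - Y w) (a + b).
Proof. by move=> hX /LboundN; exact: LboundD. Qed.

Lemma Lbound_sum (I : Type) (r : seq I) (X : I -> Omega -> E) (a : I -> R) :
  (forall i, Lbound (X i) (a i)) ->
  Lbound (fun w => \sum_(i <- r) X i w) (\sum_(i <- r) a i).
Proof.
move=> h; elim: r => [|i r ih].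
  rewrite big_nil; under eq_fun do rewrite big_nil.
  exact: Lbound_cst0.
rewrite big_cons; under eq_fun do rewrite big_cons.
exact: LboundD.
Qed.

Lemma Lbound_ae_eq (X Y : Omega -> E) :
  (forall eps, 0 < eps -> Lbound (fun w => X w - Y w) eps) ->
  {ae P, forall w, X w = Y w}.
Proof.
move=> h; have /Lbound_eq0 : Lbound (fun w => X w - Y w) 0.
  by apply: Lbound_inf => // eps; rewrite add0r; exact: h.
by apply: filterS => w /eqP; rewrite subr_eq0 => /eqP.
Qed.

Lemma Lbound_lim_dominated (X_ : nat -> Omega -> E) (X Z : Omega -> E) k c :
  (forall n, measurable_fun setT (X_ n : Omega -> borel E)) ->
  measurable_fun setT (X : Omega -> borel E) ->
  (forall w, X_ n w @[n --> \oo] --> X w) -> 0 <= k ->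
  (forall n w, `|X_ n w - X w| <= k * `|Z w|) -> Lbound Z c ->
  forall eps, 0 < eps -> \forall n \near \oo, Lbound (fun w => X_ n w - X w) eps.
Proof.
move=> mX_ mX cX k0 XZ hZ eps eps0.
have mB n : measurable_fun setT ((fun w => X_ n w - X w) : Omega -> borel E).
  exact: (measurable_vecB he).
pose f n w := (`|X_ n w - X w| `^ m)%:E.
have mZ : measurable_fun setT ((fun w => k *: Z w) : Omega -> borel E).
  case: hZ => mZ _ _; apply: (measurable_borel_comp (f := fun x => k *: x)) => //.
  by move=> x; apply: cvgZ; [exact: cvg_cst|exact: cvg_id].
have hkZ : Lbound (fun w => k *: Z w) (k * c).
  by apply: Lbound_dom hZ => //; apply: nearW => w; rewrite normrZ ger0_norm.
have intZ : P.-integrable setT (fun w => (`|k *: Z w| `^ m)%:E).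
  apply/integrableP; split; first exact/measurable_EFinP/measurable_norm_powR.
  case: hkZ => _ _; under eq_integral do rewrite -[X in (X%:E)%E]ger0_norm ?powR_ge0 //.
  by move=> /le_lt_trans; apply; rewrite ltry.
have [|||//||_ _] := @dominated_convergence _ _ _ P setT measurableT f (cst 0%E)
    (fun w => (`|k *: Z w| `^ m)%:E).
- by move=> n; apply/measurable_EFinP/measurable_norm_powR.
- exact: measurable_cst.
- apply: nearW => w _; apply/fine_cvgP; split; first exact: nearW.
  have cXw : X_ n w - X w @[n --> \oo] --> 0.
    by rewrite -(subrr (X w)); apply: cvgB => //; exact: cvg_cst.
  apply/cvgr0Pnorm_le => del del0 /=.
  have del1 : 0 < del `^ m^-1 by rewrite powR_gt0.
  apply: filterS (cvgr0_norm_le _ cXw _ del1) => n hn.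
  rewrite ger0_norm ?powR_ge0 // (le_trans (powR_le (ltW m0) (normr_ge0 _) hn)) //.
  by rewrite -powRrM mulVf ?gt_eqF // powRr1 // ltW.
- apply: nearW => w n _; rewrite /f abse_EFin ger0_norm ?powR_ge0 // lee_fin.
  apply: powR_le; [exact: ltW|exact: normr_ge0|].
  by rewrite normrZ (ger0_norm k0); exact: XZ.
rewrite integral0 => /fine_cvgP[fin cf].
have del1 : 0 < eps `^ m by rewrite powR_gt0.
apply: filterS2 fin (cvgr0_norm_le _ cf _ del1) => n fin hn; split => //; first exact: ltW.
have fin' : (\int[P]_x f n x)%E \is a fin_num := fin.
have : (\int[P]_x f n x <= (eps `^ m)%:E)%E; last by [].
by rewrite -(fineK fin') lee_fin; apply: le_trans hn; exact: ler_norm.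
Qed.

End separable.

Section completeness.
Variables (E : completeNormedModType R) (e : nat -> E).
Hypothesis he : dense_sequence e.

Lemma dense_sequence_real : exists f : nat -> R^o, dense_sequence f.
Proof.
exists (fun n => ratr (odflt 0 (@unpickle rat n))) => x eps eps0.
have : x - eps < x + eps by lra.
move=> /rat_in_itvoo[q]; rewrite in_itv /= => /andP[q1 q2].
exists (pickle q); rewrite pickleK /= ltr_norml; apply/andP; split; lra.
Qed.

Lemma geometric_sum_le (rho : R) N : 0 <= rho < 1 ->
  \sum_(n < N) rho ^+ n <= (1 - rho)^-1.
Proof.
move=> /andP[r0 r1]; have r1' : 0 < 1 - rho by rewrite subr_gt0.
rewrite -[leRHS]mul1r ler_pdivlMr // mulrC.
have -> : (1 - rho) * \sum_(n < N) rho ^+ n = 1 - rho ^+ N.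
  by rewrite -[1 in RHS](expr1n _ N) subrXX; congr (_ * _); apply: eq_bigr => i _;
    rewrite expr1n mul1r.
by rewrite gerBl exprn_ge0.
Qed.

Lemma Lbound_series (X : nat -> Omega -> E) (B rho : R) :
  (forall n, measurable_fun setT (X n : Omega -> borel E)) ->
  0 <= B -> 0 <= rho < 1 ->
  (forall n, Lbound (fun w => X n.+1 w - X n w) (B * rho ^+ n)) ->
  {ae P, forall w, cvgn (X ^~ w)} /\
  forall k, Lbound (fun w => plim X w - X k w) (B * rho ^+ k / (1 - rho)).
Proof.
move=> mX B0 rho01 hX.
have /andP[r0 r1] := rho01; have r1' : 0 < 1 - rho by rewrite subr_gt0.
pose G k N w : R^o := \sum_(n < N) `|X (k + n).+1 w - X (k + n)%N w|.
have bet0 k : 0 <= B * rho ^+ k / (1 - rho).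
  by rewrite !mulr_ge0 ?invr_ge0 ?exprn_ge0 // ltW.
have LG k N : Lbound (G k N) (B * rho ^+ k / (1 - rho)).
  have [f hf] := dense_sequence_real.
  have : Lbound (G k N) (\sum_(n < N) B * rho ^+ (k + n)).
    by apply: (Lbound_sum hf) => i; apply: Lbound_norm; exact: hX.
  apply: Lbound_le; rewrite -mulr_sumr -mulrA ler_wpM2l //.
  under eq_bigr do rewrite exprD.
  by rewrite -mulr_sumr ler_wpM2l ?exprn_ge0 // geometric_sum_le.
have G0 k N w : 0 <= G k N w by apply: sumr_ge0.
have Gnd k w N N' : (N <= N')%N -> G k N w <= G k N' w.
  move=> NN'; rewrite /G -!(big_mkord xpredT (fun n => `|X (k + n).+1 w - X (k + n)%N w|)).
  by rewrite (big_cat_nat _ NN') //= lerDl sumr_ge0.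
pose g k N w := (G k N w `^ m)%:E.
have mg k N : measurable_fun setT (g k N).
  have [mG _ _] := LG k N; have := measurable_norm_powR m mG.
  by move/measurable_EFinP; apply: eq_measurable_fun => w _; rewrite /g /= ger0_norm.
have g0 k N w : (0 <= g k N w)%E by rewrite lee_fin powR_ge0.
have gnd k w : {homo (g k) ^~ w : n n' / (n <= n')%N >-> (n <= n')%E}.
  by move=> N N' NN'; rewrite lee_fin; apply: powR_le; [exact: ltW| |exact: Gnd].
have cg k w : cvgn ((g k) ^~ w) by apply: ereal_nondecreasing_is_cvgn; exact: gnd.
have ig k : (\int[P]_w limn ((g k) ^~ w) <= ((B * rho ^+ k / (1 - rho)) `^ m)%:E)%E.
  rewrite (@monotone_convergence _ _ _ P setT measurableT (g k) (mg k)
    (fun N w _ => g0 k N w) (fun w _ => gnd k w)).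
  apply: lime_le.
    apply: ereal_nondecreasing_is_cvgn => N N' NN'; apply: ge0_le_integral => //.
    by move=> w _; exact: gnd.
  apply: nearW => N; have [_ _] := LG k N; apply: le_trans.
  by rewrite le_eqVlt; apply/orP; left; apply/eqP; apply: eq_integral => w _; rewrite /g ger0_norm.
have mlg k : measurable_fun setT (fun w => limn ((g k) ^~ w)).
  by apply: (emeasurable_fun_cvg (g k)) => // w _; exact: cg.
have gle k w N : (g k N w <= limn ((g k) ^~ w))%E.
  by apply: lime_ge => //; exists N => // n; exact: gnd.
have lg0 k w : (0 <= limn ((g k) ^~ w))%E.
  by apply: le_trans (gle k w 0%N); rewrite lee_fin powR_ge0.
have XG k N w : `|X (k + N)%N w - X k w| <= G k N w.
  elim: N => [|N ih]; first by rewrite addn0 subrr normr0 /G big_ord0.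
  rewrite /G big_ord_recr /= -/(G k N w) addnS.
  rewrite (_ : _ - X k w = (X (k + N)%N w - X k w) + (X (k + N).+1 w - X (k + N)%N w)).
    by apply: le_trans (ler_normD _ _) _; rewrite lerD.
  by rewrite [RHS]addrC addrA subrK.
have aecvg : {ae P, forall w, cvgn (X ^~ w)}.
  have : P.-integrable setT (fun w => limn ((g 0%N) ^~ w)).
    apply/integrableP; split => //.
    under eq_integral do rewrite gee0_abs //.
    by apply: le_lt_trans (ig 0%N) _; rewrite ltry.
  move/(integrable_ae measurableT); apply: filterS => w /(_ I) fin.
  set L := fine (limn ((g 0%N) ^~ w)).
  have GL N : G 0%N N w <= L `^ m^-1.
    have : (g 0%N N w <= L%:E)%E by rewrite fineK.
    rewrite lee_fin => h; rewrite -[leLHS](@powRr1 _ (G 0%N N w)) // -(mulfV (x := m)) ?gt_eqF //.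
    by rewrite powRrM; apply: powR_le; rewrite ?invr_ge0 ?powR_ge0 // ltW.
  have : cvgn (series (fun n => `|X n.+1 w - X n w|)).
    apply: nondecreasing_is_cvgn.
      by apply: nondecreasing_series => *; exact: normr_ge0.
    exists (L `^ m^-1) => _ [N _ <-]; have := GL N.
    by rewrite /G /series /= big_mkord.
  move/normed_cvg => /=.
  rewrite (_ : series _ = (fun n => X n w - X 0%N w)); last first.
    apply/funext => n; rewrite /series /= telescope_sumr //.
  move=> /cvg_ex[l cl]; apply/cvg_ex; exists (l + X 0%N w).
  rewrite (_ : X ^~ w = fun n => (X n w - X 0%N w) + X 0%N w); last first.
    by apply/funext => n; rewrite subrK.
  by apply: cvgD => //; exact: cvg_cst.
split => // k.
have mpl := measurable_plim he mX.
split => //; first exact: (measurable_vecB he).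
apply: le_trans (ig k); apply: ae_ge0_le_integral => //.
- by apply/measurable_EFinP/measurable_norm_powR; exact: (measurable_vecB he).
apply: filterS aecvg => w cw _.
have : (0 <= limn ((g k) ^~ w))%E by [].
case E1 : (limn ((g k) ^~ w)) => [L||] //; rewrite ?leey //.
rewrite lee_fin => L0; rewrite lee_fin.
have XL N : `|X (k + N)%N w - X k w| <= L `^ m^-1.
  have : (g k N w <= L%:E)%E by rewrite -E1.
  rewrite lee_fin => h; apply: le_trans (XG k N w) _.
  rewrite -[leLHS](@powRr1 _ (G k N w)) // -(mulfV (x := m)) ?gt_eqF //.
  by rewrite powRrM; apply: powR_le; rewrite ?invr_ge0 ?powR_ge0 // ltW.
have : `|plim X w - X k w| <= L `^ m^-1.
  have c1 : `|X n w - X k w| @[n --> \oo] --> `|plim X w - X k w|.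
    by apply: cvg_norm; apply: cvgB; [exact: cvg_plim|exact: cvg_cst].
  rewrite -(cvg_lim _ c1) //; apply: limr_le; first by apply/cvg_ex; eexists; exact: c1.
  exists k => // n /= kn.
  by rewrite -(subnKC kn).
move=> /(powR_le (ltW m0) (normr_ge0 _)) /le_trans; apply.
by rewrite -powRrM mulVf ?gt_eqF // powRr1.
Qed.

End completeness.
End Lm_bounds.

(** * Powers of real numbers *)

Section scalar_inequalities.
Context {R : realType}.
Implicit Types (a b c m n p r s x y z : R).

Lemma powR_addr x r s : 0 <= x -> 0 < r + s -> x `^ (r + s) = x `^ r * x `^ s.
Proof. by move=> x0 rs; rewrite powRD // gt_eqF. Qed.

Lemma powR_split x r : 0 <= x -> 0 < r -> x `^ r = x `^ (r - 1) * x.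
Proof. by move=> x0 r0; rewrite mulrC mulr_powRB1. Qed.

Lemma powR_split2 x r : 0 <= x -> 2 <= r -> x `^ r = x `^ (r - 2) * x ^+ 2.
Proof.
move=> x0 r2; rewrite -powR_mulrn // -powR_addr //; last by lra.
by congr (_ `^ _); lra.
Qed.

Lemma powR_sqrt x r : 0 <= x -> Num.sqrt x `^ r = x `^ (r / 2).
Proof. by move=> x0; rewrite -powR12_sqrt // -powRrM mulrC. Qed.

Lemma powR_ge_tangent x y r : 0 <= x -> 0 <= y -> 1 <= r ->
  x `^ r + x `^ (r - 1) * y <= (x + y) `^ r.
Proof.
move=> x0 y0 r1; rewrite (@powR_split (x + y)) ?addr_ge0 //; last by lra.
rewrite (@powR_split x) //; last by lra.
rewrite -mulrDr ler_wpM2r ?addr_ge0 // powR_le //; [lra|lra].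
Qed.

Lemma powR_superadditive x y r : 0 <= x -> 0 <= y -> 1 <= r ->
  x `^ r + y `^ r <= (x + y) `^ r.
Proof.
move=> x0 y0 r1; have r0 : 0 < r by lra.
rewrite !(@powR_split _ r) ?addr_ge0 // mulrDr.
by apply: lerD; rewrite ler_wpM2r // powR_le //; lra.
Qed.

Lemma powR_mul_le_max x y r s : 0 <= x -> 0 <= y -> 0 <= r -> 0 <= s -> 0 < r + s ->
  x `^ r * y `^ s <= x `^ (r + s) + y `^ (r + s).
Proof.
move=> x0 y0 r0 s0 rs; have [xy|/ltW yx] := leP x y.
  rewrite [X in _ + X]powR_addr // ler_wpDl ?powR_ge0 //.
  by rewrite ler_wpM2r ?powR_ge0 // powR_le.
rewrite [X in X + _]powR_addr // ler_wpDr ?powR_ge0 //.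
by rewrite ler_wpM2l ?powR_ge0 // powR_le.
Qed.

Lemma expR_le_quadratic z : z <= 2^-1 -> expR z <= 1 + z + 2 * z ^+ 2.
Proof.
move=> z2; have := expR_ge1Dx (- z); rewrite expRN => h.
have z1 : 0 < 1 - z by lra.
have e0 : 0 < expR z by exact: expR_gt0.
have : expR z * (1 - z) <= 1.
  by rewrite -ler_pdivlMl // mulr1.
move=> h2; rewrite -(ler_pM2r z1); apply: le_trans h2 _.
have : 0 <= z ^+ 2 * (1 - 2 * z) by rewrite mulr_ge0 ?sqr_ge0 //; lra.
by nra.
Qed.

Definition smoothness_cst m : R :=
  (3 * m + 1) `^ m + m * (3 * m) `^ (m - 1) + m / 2 + 9 * m ^+ 2 / 2.

Lemma smoothness_cst_ge1 m : 2 <= m -> 1 <= smoothness_cst m.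
Proof.
move=> m2; rewrite /smoothness_cst.
have : 0 <= (3 * m + 1) `^ m by exact: powR_ge0.
have : 0 <= (3 * m) `^ (m - 1) by exact: powR_ge0.
by nra.
Qed.

(* The second-order Taylor bound of [|x + y|^m], with [a = |x|], [b = |y|],
   [s = <x, y>] and [n = |x + y|]. *)
Lemma powR_taylor m a b s n : 2 <= m -> 0 <= a -> 0 <= b -> 0 <= n ->
  n ^+ 2 = a ^+ 2 + 2 * s + b ^+ 2 -> `|s| <= a * b ->
  n `^ m <= a `^ m + m * (a `^ (m - 2) * s) +
    smoothness_cst m * (a `^ (m - 2) * b ^+ 2 + b `^ m).
Proof.
move=> m2 a0 b0 n0 nE /ler_normlP[s1 s2].
have m0 : 0 < m by lra.
have C1 := smoothness_cst_ge1 m2.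
have [bm am an] : [/\ 0 <= b `^ m, 0 <= a `^ m & 0 <= a `^ (m - 2)].
  by rewrite !powR_ge0.
have nab : n <= a + b by nra.
have [ab|ab] := leP a (3 * m * b).
  have n3 : n `^ m <= (3 * m + 1) `^ m * b `^ m.
    by rewrite -powRM //; [apply: powR_le|]; nra.
  have lo : - (m * (3 * m) `^ (m - 1) * b `^ m) <= m * (a `^ (m - 2) * s).
    have h1 : a `^ (m - 2) * a <= (3 * m * b) `^ (m - 1).
      have -> : a `^ (m - 2) * a = a `^ (m - 1).
        by rewrite (@powR_split a (m - 1)) //; [congr (_ `^ _ * _)|]; lra.
      by apply: powR_le => //; lra.
    have h2 : (3 * m * b) `^ (m - 1) * b = (3 * m) `^ (m - 1) * b `^ m.
      by rewrite powRM //; [rewrite -mulrA -powR_split|nra].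
    have : - (a `^ (m - 2) * (a * b)) <= a `^ (m - 2) * s.
      by rewrite -mulrN ler_wpM2l //; lra.
    have : a `^ (m - 2) * a * b <= (3 * m * b) `^ (m - 1) * b by rewrite ler_wpM2r.
    rewrite h2; nra.
  have : (3 * m + 1) `^ m * b `^ m + m * (3 * m) `^ (m - 1) * b `^ m
      <= smoothness_cst m * b `^ m.
    rewrite -mulrDl ler_wpM2r // /smoothness_cst; nra.
  have : 0 <= smoothness_cst m * (a `^ (m - 2) * b ^+ 2).
    by rewrite !mulr_ge0 ?sqr_ge0 //; lra.
  lra.
have a1 : 0 < a by nra.
pose u := (2 * s + b ^+ 2) / a ^+ 2.
have a2 : 0 < a ^+ 2 by rewrite exprn_gt0.
have uE : u * a ^+ 2 = 2 * s + b ^+ 2 by rewrite mulfVK // gt_eqF.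
have nu : n ^+ 2 = a ^+ 2 * (1 + u) by rewrite mulrDr mulr1 [_ * u]mulrC uE nE addrA.
have u1 : 0 <= 1 + u by rewrite -(pmulr_rge0 _ a2) -nu sqr_ge0.
have ba : b <= a by nra.
have uab : u * a <= 3 * b.
  rewrite -(ler_pM2r a1) -mulrA -expr2 uE; nra.
have uab2 : - (3 * b) <= u * a.
  rewrite -(ler_pM2r a1) -[_ * a * a]mulrA -expr2 uE; nra.
have z2 : m / 2 * u <= 2^-1.
  rewrite -(ler_pM2r a1); nra.
have E : n `^ m = a `^ m * (1 + u) `^ (m / 2).
  have -> : n `^ m = (n ^+ 2) `^ (m / 2).
    by rewrite -powR_mulrn // -powRrM; congr (_ `^ _); lra.
  rewrite nu powRM //; last exact: ltW.
  by congr (_ * _); rewrite -powR_mulrn // -powRrM; congr (_ `^ _); lra.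
have h1 : (1 + u) `^ (m / 2) <= 1 + m / 2 * u + 2 * (m / 2 * u) ^+ 2.
  apply: le_trans (expR_le_quadratic z2); rewrite [m / 2 * u]mulrC expRM.
  by apply: powR_le; [lra| |exact: expR_ge1Dx].
have amE := powR_split2 a0 m2.
have h3 : a `^ m * u = a `^ (m - 2) * (2 * s + b ^+ 2).
  by rewrite amE -mulrA; congr (_ * _); rewrite mulrC.
have h4 : a `^ m * u ^+ 2 <= a `^ (m - 2) * (9 * b ^+ 2).
  rewrite amE -mulrA ler_wpM2l //; nra.
have h5 : n `^ m <= a `^ m * (1 + m / 2 * u + 2 * (m / 2 * u) ^+ 2).
  by rewrite E ler_wpM2l.
have h6 : a `^ m * (1 + m / 2 * u + 2 * (m / 2 * u) ^+ 2) =
   a `^ m + m / 2 * (a `^ m * u) + m ^+ 2 / 2 * (a `^ m * u ^+ 2) by field.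
have h7 : m ^+ 2 / 2 * (a `^ m * u ^+ 2) <= m ^+ 2 / 2 * (a `^ (m - 2) * (9 * b ^+ 2)).
  by rewrite ler_wpM2l // divr_ge0 ?sqr_ge0.
have h8 : (m / 2 + 9 * m ^+ 2 / 2) * (a `^ (m - 2) * b ^+ 2) <=
    smoothness_cst m * (a `^ (m - 2) * b ^+ 2).
  rewrite ler_wpM2r ?mulr_ge0 ?sqr_ge0 // /smoothness_cst.
  have := powR_ge0 (3 * m + 1) m; have := powR_ge0 (3 * m) (m - 1); nra.
have : 0 <= smoothness_cst m * b `^ m by rewrite mulr_ge0 //; lra.
rewrite h6 h3 in h5; nra.
Qed.

Lemma martingale_step_le m a b c : 2 <= m -> 0 <= a -> 0 <= b -> 0 <= c ->
  a `^ m + m * (2 * (a `^ (m - 1) * c)) +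
    smoothness_cst m * (2 * (a `^ (m - 2) * b ^+ 2) + b `^ m) <=
  Num.sqrt ((a + 2 * m * c) ^+ 2 + 3 * smoothness_cst m * b ^+ 2) `^ m.
Proof.
move=> m2 a0 b0 c0; have C1 := smoothness_cst_ge1 m2.
set C := smoothness_cst m in C1 *.
set q := a + 2 * m * c.
have q0 : 0 <= q by rewrite /q; nra.
have aq : a <= q by rewrite /q; nra.
have b20 : 0 <= b ^+ 2 by exact: sqr_ge0.
have Cb0 : 0 <= C * b ^+ 2 by nra.
rewrite powR_sqrt; last by rewrite addr_ge0 ?sqr_ge0 //; nra.
set p := m / 2; have p1 : 1 <= p by rewrite /p; lra.
have -> : q ^+ 2 + 3 * C * b ^+ 2 = (q ^+ 2 + 2 * C * b ^+ 2) + C * b ^+ 2 by ring.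
have Cb2 : 0 <= 2 * C * b ^+ 2 by nra.
have q20 : 0 <= q ^+ 2 by exact: sqr_ge0.
apply: le_trans (powR_superadditive _ Cb0 p1); last by rewrite addr_ge0.
have h1 := powR_ge_tangent q20 Cb2 p1.
have sqp x (r : R) : 0 <= x -> (x ^+ 2) `^ r = x `^ (2 * r).
  by move=> x0; rewrite -powR_mulrn // -powRrM.
have h2 : (q ^+ 2) `^ p = q `^ m by rewrite sqp //; congr (_ `^ _); rewrite /p; lra.
have h3 : (q ^+ 2) `^ (p - 1) = q `^ (m - 2).
  by rewrite sqp //; congr (_ `^ _); rewrite /p; lra.
have h4 : C * b `^ m <= (C * b ^+ 2) `^ p.
  rewrite powRM //; last by lra.
  rewrite sqp // (_ : 2 * p = m); last by rewrite /p; lra.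
  by rewrite ler_wpM2r ?powR_ge0 // le1r_powR.
have h5 : a `^ (m - 2) <= q `^ (m - 2) by apply: powR_le => //; lra.
have h6 : a `^ m + a `^ (m - 1) * (2 * m * c) <= q `^ m.
  by apply: powR_ge_tangent => //; [nra|lra].
have h7 : a `^ (m - 2) * (2 * C * b ^+ 2) <= q `^ (m - 2) * (2 * C * b ^+ 2).
  by rewrite ler_wpM2r.
rewrite h2 h3 in h1; nra.
Qed.

Lemma martingale_sum_le m (C S Q c b : R) : 0 <= m -> 0 <= C -> 0 <= S -> 0 <= c ->
  0 <= Q ->
  Num.sqrt ((2 * m * S + Num.sqrt Q + 2 * m * c) ^+ 2 + C * b ^+ 2) <=
  2 * m * (S + c) + Num.sqrt (Q + C * b ^+ 2).
Proof.
move=> m0 C0 S0 c0 Q0; have b0 := sqr_ge0 b.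
have Q0' : 0 <= Q + C * b ^+ 2 by nra.
have r0 := sqrtr_ge0 Q; have r0' := sqrtr_ge0 (Q + C * b ^+ 2).
have rE := sqr_sqrtr Q0; have rE' := sqr_sqrtr Q0'.
have rr' : Num.sqrt Q <= Num.sqrt (Q + C * b ^+ 2) by rewrite ler_wsqrtr // lerDl mulr_ge0.
move: r0 r0' rE rE' rr'.
set r := Num.sqrt Q; set r' := Num.sqrt (Q + _) => r0 r0' rE rE' rr'.
have y0 : 0 <= 2 * m * (S + c) + r' by rewrite addr_ge0 // !mulr_ge0 // addr_ge0.
rewrite -[leRHS](ger0_norm y0) -sqrtr_sqr ler_wsqrtr //.
have : 0 <= m * (S + c) * (r' - r).
  by apply: mulr_ge0; [apply: mulr_ge0 => //|]; lra.
nra.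
Qed.

End scalar_inequalities.

(** * Moments in a Hilbert space *)

Section inner_product.
Context {R : realType} (H : monotone_family R) {g : R}.
Implicit Types (u v : H g) (a : R).

Lemma inner0l (w : H g) : inner (0 : H g) w = 0.
Proof.
have := innerPl (- 1) (0 : H g) 0 w.
by rewrite scaler0 addr0 mulN1r addNr.
Qed.

Lemma innerDl u v (w : H g) : inner (u + v) w = inner u w + inner v w.
Proof. by have := innerPl 1 u v w; rewrite scale1r mul1r. Qed.

Lemma innerZl a u (w : H g) : inner (a *: u) w = a * inner u w.
Proof. by have := innerPl a u 0 w; rewrite addr0 inner0l addr0. Qed.

Lemma innerDr u v (w : H g) : inner w (u + v) = inner w u + inner w v.
Proof. by rewrite !(innerC w) innerDl. Qed.

Lemma innerZr a u (w : H g) : inner w (a *: u) = a * inner w u.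
Proof. by rewrite !(innerC w) innerZl. Qed.

Lemma innerBr u v (w : H g) : inner w (u - v) = inner w u - inner w v.
Proof. by rewrite innerDr -scaleN1r innerZr mulN1r. Qed.

Lemma sqr_normD u v : `|u + v| ^+ 2 = `|u| ^+ 2 + 2 * inner u v + `|v| ^+ 2.
Proof.
rewrite -!inner_norm innerDl !innerDr (innerC v u); ring.
Qed.

Lemma inner_polar u v : inner u v = (`|u + v| ^+ 2 - `|u| ^+ 2 - `|v| ^+ 2) / 2.
Proof. by rewrite sqr_normD; field. Qed.

Lemma ler_norm_inner u v : `|inner u v| <= `|u| * `|v|.
Proof.
have [->|v0] := eqVneq v 0.
  by rewrite innerC inner0l !normr0 mulr0.
have nv : 0 < `|v| ^+ 2 by rewrite exprn_gt0 // normr_gt0.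
have : 0 <= `|(`|v| ^+ 2) *: u + (- inner u v) *: v| ^+ 2 by exact: sqr_ge0.
rewrite sqr_normD innerZl innerZr.
have -> : `|(`|v| ^+ 2) *: u| = `|v| ^+ 2 * `|u|.
  by rewrite normrZ ger0_norm // sqr_ge0.
have -> : `|(- inner u v) *: v| ^+ 2 = inner u v ^+ 2 * `|v| ^+ 2.
  by rewrite normrZ exprMn normrN real_normK // num_real.
move=> h.
rewrite -(@ler_pXn2r _ 2) ?nnegrE ?mulr_ge0 // -normrX (ger0_norm (sqr_ge0 _)).
rewrite exprMn -(ler_pM2l nv); nra.
Qed.

Lemma normD_powR_le m u v : 2 <= m ->
  `|u + v| `^ m <= `|u| `^ m + m * (`|u| `^ (m - 2) * inner u v) +
    smoothness_cst m * (`|u| `^ (m - 2) * `|v| ^+ 2 + `|v| `^ m).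
Proof.
move=> m2; apply: powR_taylor => //; first exact: sqr_normD.
exact: ler_norm_inner.
Qed.

Lemma measurable_inner {d} {Omega : measurableType d} (X Y : Omega -> H g) :
  measurable_fun setT (X : Omega -> borel (H g)) ->
  measurable_fun setT (Y : Omega -> borel (H g)) ->
  measurable_fun setT (fun w => inner (X w) (Y w)).
Proof.
move=> mX mY; have [e he] := separable_dense_sequence H g.
under eq_fun do rewrite inner_polar.
have mn (Z : Omega -> H g) : measurable_fun setT (Z : Omega -> borel (H g)) ->
    measurable_fun setT (fun w => `|Z w| ^+ 2).
  by move=> mZ; apply: measurable_funX; exact: measurable_vec_norm.
apply: measurable_funM => //; apply: measurable_funB; last exact: mn.
apply: measurable_funB; last exact: mn.
by apply: mn; exact: (measurable_vecD he).
Qed.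

End inner_product.

Section conditional_bounds.
Context {d : measure_display} {Omega : measurableType d} {R : realType}.
Variables (P : probability Omega R) (m : R) (H : monotone_family R) (g : R).
Hypothesis m2 : 2 <= m.
Implicit Types (X Y Z : Omega -> H g) (a b c : R) (G : set (set Omega)).
Local Notation E := (H g).
Local Notation Lbound := (Lbound P m).

Let m1 : 1 <= m. Proof. by apply: le_trans m2; rewrite ler1n. Qed.
Let m0 : 0 < m. Proof. exact: lt_le_trans m1. Qed.

Lemma mixed_moment_le X Y a b j k : Lbound X a -> Lbound Y b ->
  0 <= j -> 0 <= k -> j + k = m ->
  (\int[P]_w (`|X w| `^ j * `|Y w| `^ k)%:E <= (2 * (a `^ j * b `^ k))%:E)%E.
Proof.
move=> LX LY j0 k0 jk; have jk0 : 0 < j + k by rewrite jk.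
have [mX a0 hX] := LX; have [mY b0 hY] := LY.
have mXp (r : R) : measurable_fun setT (fun w => `|X w| `^ r) by exact: measurable_norm_powR.
have mYp (r : R) : measurable_fun setT (fun w => `|Y w| `^ r) by exact: measurable_norm_powR.
have mXY : measurable_fun setT (fun w => (`|X w| `^ j * `|Y w| `^ k)%:E).
  by apply/measurable_EFinP; exact: measurable_funM.
have [aE|a1] := eqVneq a 0.
  rewrite aE in LX; have X0 := Lbound_eq0 m1 LX.
  have [j1|j1] := eqVneq j 0.
    have km : k = m by rewrite -jk j1 add0r.
    rewrite j1 km powRr0 mul1r; under eq_integral do rewrite powRr0 mul1r.
    apply: le_trans hY _; rewrite lee_fin; have := powR_ge0 b m; lra.
  rewrite (@ge0_ae_eq_integral _ _ _ P setT _ (cst 0%E)) //.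
  - by rewrite integral0 lee_fin !mulr_ge0 ?powR_ge0.
  by apply: filterS X0 => w -> _; rewrite normr0 powR0 // mul0r.
have [bE|b1] := eqVneq b 0.
  rewrite bE in LY; have Y0 := Lbound_eq0 m1 LY.
  have [k1|k1] := eqVneq k 0.
    have jm : j = m by rewrite -jk k1 addr0.
    rewrite k1 jm powRr0 mulr1; under eq_integral do rewrite powRr0 mulr1.
    apply: le_trans hX _; rewrite lee_fin; have := powR_ge0 a m; lra.
  rewrite (@ge0_ae_eq_integral _ _ _ P setT _ (cst 0%E)) //.
  - by rewrite integral0 lee_fin !mulr_ge0 ?powR_ge0.
  by apply: filterS Y0 => w -> _; rewrite normr0 [0 `^ k]powR0 // mulr0.
have a2 : 0 < a by rewrite lt_neqAle eq_sym a1.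
have b2 : 0 < b by rewrite lt_neqAle eq_sym b1.
have pa (r : R) : 0 < a `^ r by rewrite powR_gt0.
have pb (r : R) : 0 < b `^ r by rewrite powR_gt0.
set q := a `^ j * b `^ k.
have q0 : 0 < q by rewrite mulr_gt0.
have pw w : `|X w| `^ j * `|Y w| `^ k <=
    (q / a `^ m) * `|X w| `^ m + (q / b `^ m) * `|Y w| `^ m.
  have := @powR_mul_le_max R (`|X w| / a) (`|Y w| / b) j k.
  rewrite !divr_ge0 ?(ltW a2) ?(ltW b2) // => /(_ isT isT j0 k0 jk0).
  rewrite jk !powRM ?invr_ge0 ?(ltW a2) ?(ltW b2) //.
  rewrite !powR_invl ?(ltW a2) ?(ltW b2) //.
  rewrite mulrACA -invfM -/q => h.
  have := ler_wpM2l (ltW q0) h.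
  by rewrite mulrCA mulfV ?gt_eqF // mulr1 mulrDr !mulrA ![q * _ / _]mulrAC.
apply: (@le_trans _ _ (\int[P]_w ((q / a `^ m)%:E * (`|X w| `^ m)%:E +
   (q / b `^ m)%:E * (`|Y w| `^ m)%:E))%E).
  apply: ge0_le_integral => //.
    by apply: emeasurable_funD; apply: emeasurable_funM => //; exact/measurable_EFinP.
  by move=> w _; rewrite -!EFinM -EFinD lee_fin.
have qa : 0 <= q / a `^ m by rewrite divr_ge0 // ltW.
have qb : 0 <= q / b `^ m by rewrite divr_ge0 // ltW.
have mX' : measurable_fun setT (fun w => (`|X w| `^ m)%:E) by exact/measurable_EFinP.
have mY' : measurable_fun setT (fun w => (`|Y w| `^ m)%:E) by exact/measurable_EFinP.
rewrite ge0_integralD //; try exact: emeasurable_funM;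
  try by move=> w _; rewrite -EFinM lee_fin mulr_ge0 ?powR_ge0.
rewrite !ge0_integralZl ?lee_fin //.
have -> : 2 * q = q / a `^ m * a `^ m + q / b `^ m * b `^ m.
  by rewrite !divfK ?gt_eqF // mulr_natl mulr2n.
by rewrite EFinD !EFinM leeD // lee_wpmul2l // lee_fin.
Qed.

Lemma mixed_moment_integrable X Y a b j k (f : Omega -> R) :
  Lbound X a -> Lbound Y b -> 0 <= j -> 0 <= k -> j + k = m ->
  measurable_fun setT f -> (forall w, `|f w| <= `|X w| `^ j * `|Y w| `^ k) ->
  P.-integrable setT (EFin \o f).
Proof.
move=> LX LY j0 k0 jk mf fXY; apply/integrableP; split; first exact/measurable_EFinP.
have [[mX _ _] [mY _ _]] := (LX, LY).
have h := mixed_moment_le LX LY j0 k0 jk.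
apply: le_lt_trans (_ : _ < +oo)%E; last first.
  by apply: le_lt_trans h _; rewrite ltry.
apply: ge0_le_integral => //.
- by apply: measurableT_comp => //; exact/measurable_EFinP.
- by apply/measurable_EFinP; apply: measurable_funM; exact: measurable_norm_powR.
by move=> w _; rewrite lee_fin.
Qed.

Lemma mixed_moment_Rle X Y a b j k (f : Omega -> R) :
  Lbound X a -> Lbound Y b -> 0 <= j -> 0 <= k -> j + k = m ->
  measurable_fun setT f -> (forall w, `|f w| <= `|X w| `^ j * `|Y w| `^ k) ->
  \int[P]_w f w <= 2 * (a `^ j * b `^ k).
Proof.
move=> LX LY j0 k0 jk mf fXY.
have h := mixed_moment_le LX LY j0 k0 jk.
have [[mX _ _] [mY _ _]] := (LX, LY).
have mXY : measurable_fun setT (fun w => `|X w| `^ j * `|Y w| `^ k).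
  by apply: measurable_funM; exact: measurable_norm_powR.
have i1 := mixed_moment_integrable LX LY j0 k0 jk mf fXY.
have i2 : P.-integrable setT (EFin \o (fun w => `|X w| `^ j * `|Y w| `^ k)).
  apply: (mixed_moment_integrable LX LY j0 k0 jk mXY) => w.
  by rewrite ger0_norm // mulr_ge0 ?powR_ge0.
apply: (@le_trans _ _ (\int[P]_w (`|X w| `^ j * `|Y w| `^ k))).
  by apply: le_Rintegral => // w _; apply: le_trans (ler_norm _) (fXY w).
by rewrite /Rintegral -lee_fin fineK // integrable_fin_num.
Qed.

Definition dual_density X Y w : R := `|X w| `^ (m - 2) * inner (X w) (Y w).

Lemma measurable_dual_density X Y :
  measurable_fun setT (X : Omega -> borel E) ->
  measurable_fun setT (Y : Omega -> borel E) ->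
  measurable_fun setT (dual_density X Y).
Proof.
move=> mX mY; apply: measurable_funM; last exact: measurable_inner.
exact: measurable_norm_powR.
Qed.

Lemma norm_dual_density_le X Y w :
  `|dual_density X Y w| <= `|X w| `^ (m - 1) * `|Y w| `^ 1.
Proof.
rewrite /dual_density normrM ger0_norm ?powR_ge0 // powRr1 //.
rewrite (@powR_split _ _ (m - 1)) //; last by have := m2; lra.
rewrite -mulrA (_ : m - 1 - 1 = m - 2); last by lra.
by rewrite ler_wpM2l ?powR_ge0 // ler_norm_inner.
Qed.

Let mm1 : 0 <= m - 1. Proof. by rewrite subr_ge0. Qed.

Lemma dual_density_integrable X Y a b : Lbound X a -> Lbound Y b ->
  P.-integrable setT (EFin \o dual_density X Y).
Proof.
move=> LX LY; have [[mX _ _] [mY _ _]] := (LX, LY).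
apply: (mixed_moment_integrable LX LY mm1 ler01); first by rewrite subrK.
  exact: measurable_dual_density.
exact: norm_dual_density_le.
Qed.

(* The size [c] of the conditional expectation of [Y] given [G], as seen by
   testing [Y] against the duality map of [G]-measurable variables; no
   conditional expectation is involved. *)
Definition cond_bound G Y c : Prop := 0 <= c /\
  forall X a, measurable_wrt G X -> Lbound X a ->
    \int[P]_w dual_density X Y w <= 2 * (a `^ (m - 1) * c).

Lemma Lbound_cond_bound G Y b : Lbound Y b -> cond_bound G Y b.
Proof.
move=> LY; have [mY b0 _] := LY; split => // X a _ LX; have [mX _ _] := LX.
rewrite -[b](@powRr1 _ b) //.
apply: (mixed_moment_Rle LX LY mm1 ler01); first by rewrite subrK.
  exact: measurable_dual_density.
exact: norm_dual_density_le.
Qed.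

Lemma cond_bound_le G Y c c' : c <= c' -> cond_bound G Y c -> cond_bound G Y c'.
Proof.
move=> cc' [c0 h]; split=> [|X a GX LX]; first exact: le_trans cc'.
by apply: le_trans (h _ _ GX LX) _; rewrite ler_wpM2l // ler_wpM2l // powR_ge0.
Qed.

Lemma cond_bound_sub G G' Y c : (forall X, measurable_wrt G X -> measurable_wrt G' X) ->
  cond_bound G' Y c -> cond_bound G Y c.
Proof. by move=> GG' [c0 h]; split => // X a /GG'; exact: h. Qed.

Lemma cond_boundD G X Y a b c c' : Lbound X a -> Lbound Y b ->
  cond_bound G X c -> cond_bound G Y c' ->
  cond_bound G (fun w => X w + Y w) (c + c').
Proof.
move=> LX LY [c0 h] [c0' h']; split => [|Z z GZ LZ]; first exact: addr_ge0.
have -> : dual_density Z (fun w => X w + Y w) =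
    (fun w => dual_density Z X w + dual_density Z Y w).
  by apply/funext => w; rewrite /dual_density innerDr mulrDr.
rewrite RintegralD //; try exact: dual_density_integrable.
- by rewrite !mulrDr lerD // ?h // h'.
- exact: dual_density_integrable LZ LX.
- exact: dual_density_integrable LZ LY.
Qed.

Lemma cond_bound_ae G X Y c : measurable_fun setT (X : Omega -> borel E) ->
  measurable_fun setT (Y : Omega -> borel E) -> {ae P, forall w, X w = Y w} ->
  cond_bound G X c -> cond_bound G Y c.
Proof.
move=> mX mY XY [c0 h]; split => // Z a GZ LZ; have [mZ _ _] := LZ.
suff -> : \int[P]_w dual_density Z Y w = \int[P]_w dual_density Z X w by exact: h.
rewrite /Rintegral; congr fine; apply: ae_eq_integral => //.
- by apply/measurable_EFinP; exact: measurable_dual_density.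
- by apply/measurable_EFinP; exact: measurable_dual_density.
by apply: filterS XY => w XY _; rewrite /dual_density XY.
Qed.

Lemma cond_bound_sum (I : Type) (r : seq I) G (Y : I -> Omega -> E) (b c : I -> R) :
  (forall i, Lbound (Y i) (b i)) -> (forall i, cond_bound G (Y i) (c i)) ->
  cond_bound G (fun w => \sum_(i <- r) Y i w) (\sum_(i <- r) c i).
Proof.
move=> LY cY; have [e he] := separable_dense_sequence H g.
elim: r => [|i r ih].
  rewrite big_nil; under eq_fun do rewrite big_nil.
  exact/Lbound_cond_bound/Lbound_cst0.
rewrite big_cons; under eq_fun do rewrite big_cons.
apply: (cond_boundD (LY i)) => //.
exact: (Lbound_sum m1 he).
Qed.

Lemma cond_bound_inf G Y c : 0 <= c ->
  (forall eps, 0 < eps -> cond_bound G Y (c + eps)) -> cond_bound G Y c.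
Proof.
move=> c0 h; split => // X a GX LX; apply/ler_addgt0Pr => eps eps0.
set k := 2 * a `^ (m - 1) + 1.
have k0 : 0 < k by rewrite /k; have := powR_ge0 a (m - 1); lra.
have [_ hc] := h _ (divr_gt0 eps0 k0).
apply: le_trans (hc _ _ GX LX) _; rewrite !mulrDr lerD2l mulrA mulrCA.
rewrite -[leRHS]mulr1 ler_pM2l // ler_pdivrMr // mul1r /k; lra.
Qed.

Lemma Lbound_martingale_step G X Y a b c : measurable_wrt G X ->
  Lbound X a -> Lbound Y b -> cond_bound G Y c ->
  Lbound (fun w => X w + Y w)
    (Num.sqrt ((a + 2 * m * c) ^+ 2 + 3 * smoothness_cst m * b ^+ 2)).
Proof.
move=> GX LX LY [c0 hY]; have [e he] := separable_dense_sequence H g.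
have [mX a0 _] := LX; have [mY b0 _] := LY.
have LXY := LboundD m1 he LX LY; have [mXY _ _] := LXY.
split => //; set C := smoothness_cst m.
have n2 : 0 <= m - 2 by rewrite subr_ge0.
pose fm Z w := `|Z w : E| `^ m.
have mfm Z : measurable_fun setT (Z : Omega -> borel E) -> measurable_fun setT (fm Z).
  exact: measurable_norm_powR.
have fmE Z w : `|fm Z w| <= `|Z w| `^ m * `|Z w| `^ 0.
  by rewrite powRr0 mulr1 ger0_norm ?powR_ge0.
have ifm Z z : Lbound Z z -> P.-integrable setT (EFin \o fm Z).
  move=> LZ; have [mZ _ _] := LZ.
  by apply: (mixed_moment_integrable LZ LZ (ltW m0) (lexx 0)); rewrite ?addr0 //; exact: mfm.
have ifmE Z z : Lbound Z z -> \int[P]_w fm Z w <= z `^ m.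
  move=> LZ; have [_ _ h] := LZ; have := integrable_fin_num measurableT (ifm _ _ LZ).
  by rewrite /Rintegral => fin; rewrite -lee_fin fineK.
pose f2 w := `|X w| `^ (m - 2) * `|Y w| ^+ 2.
have f2E w : `|f2 w| <= `|X w| `^ (m - 2) * `|Y w| `^ 2.
  by rewrite ger0_norm ?mulr_ge0 ?powR_ge0 ?sqr_ge0 // /f2 powR_mulrn.
have mf2 : measurable_fun setT f2.
  apply: measurable_funM; first exact: measurable_norm_powR.
  by apply: measurable_funX; exact: measurable_vec_norm.
have m22 : m - 2 + 2 = m by rewrite subrK.
have if2 := mixed_moment_integrable LX LY n2 (ler0n _ 2) m22 mf2 f2E.
have if2E := mixed_moment_Rle LX LY n2 (ler0n _ 2) m22 mf2 f2E.
have iXY := dual_density_integrable LX LY.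
have iC1 : P.-integrable setT (EFin \o (fun w => m * dual_density X Y w)).
  by have := integrableZl measurableT m iXY; apply: eq_integrable.
have iC2 : P.-integrable setT (EFin \o (fun w => f2 w + fm Y w)).
  by have := integrableD measurableT if2 (ifm _ _ LY); apply: eq_integrable.
have iC3 : P.-integrable setT (EFin \o (fun w => C * (f2 w + fm Y w))).
  by have := integrableZl measurableT C iC2; apply: eq_integrable.
have iC4 : P.-integrable setT (EFin \o (fun w => fm X w + m * dual_density X Y w)).
  by have := integrableD measurableT (ifm _ _ LX) iC1; apply: eq_integrable.
have iC5 : P.-integrable setT
    (EFin \o (fun w => fm X w + m * dual_density X Y w + C * (f2 w + fm Y w))).
  by have := integrableD measurableT iC4 iC3; apply: eq_integrable.
have fin := integrable_fin_num measurableT (ifm _ _ LXY).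
have -> : (\int[P]_w (`|X w + Y w| `^ m)%:E =
    (\int[P]_w fm (fun w => X w + Y w) w)%:E)%E by rewrite /Rintegral fineK.
rewrite lee_fin; apply: (@le_trans _ _
    (\int[P]_w (fm X w + m * dual_density X Y w + C * (f2 w + fm Y w)))).
  apply: le_Rintegral => // [|w _]; first exact: ifm LXY.
  exact: normD_powR_le.
rewrite RintegralD // RintegralD //; last exact: ifm LX.
rewrite !RintegralZl // RintegralD //; last exact: ifm LY.
apply: le_trans (martingale_step_le m2 a0 b0 c0).
apply: lerD.
  apply: lerD; first exact: ifmE.
  by rewrite ler_wpM2l ?(ltW m0) // hY.
rewrite ler_wpM2l //; first exact: le_trans ler01 (smoothness_cst_ge1 m2).
apply: lerD; last exact: ifmE.
by rewrite -(powR_mulrn 2 b0).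
Qed.

End conditional_bounds.

Section martingale_sums.
Context {d : measure_display} {Omega : measurableType d} {R : realType}.
Variables (P : probability Omega R) (m : R) (H : monotone_family R) (g : R).
Hypothesis m2 : 2 <= m.
Local Notation E := (H g).

Let m1 : 1 <= m. Proof. by apply: le_trans m2; rewrite ler1n. Qed.
Let m0 : 0 < m. Proof. exact: lt_le_trans m1. Qed.

Lemma Lbound_martingale_sum (N : nat) (Y : nat -> Omega -> E)
    (G : nat -> set (set Omega)) (b c : nat -> R) :
  (forall i, (i < N)%N -> Lbound P m (Y i) (b i)) ->
  (forall i, (i < N)%N -> cond_bound P m (G i) (Y i) (c i)) ->
  (forall i k, (i < k < N)%N -> measurable_wrt (G k) (Y i)) ->
  Lbound P m (fun w => \sum_(i < N) Y i w)
    (2 * m * (\sum_(i < N) c i) +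
     Num.sqrt (3 * smoothness_cst m * \sum_(i < N) b i ^+ 2)).
Proof.
have [e he] := separable_dense_sequence H g.
have C1 := smoothness_cst_ge1 m2.
elim: N => [|N ih] LY cY GY.
  under eq_fun do rewrite big_ord0.
  by rewrite !big_ord0 !mulr0 sqrtr0 addr0; exact: Lbound_cst0.
under eq_fun do rewrite big_ord_recr /=.
have S0 : 0 <= \sum_(i < N) c i.
  by apply: sumr_ge0 => i _; have [] := cY i (ltn_trans (ltn_ord i) (ltnSn N)).
have [c0 _] := cY N (ltnSn N).
rewrite !big_ord_recr /= [3 * _ * (_ + _)]mulrDr.
apply: (Lbound_le m1); last first.
  apply: (Lbound_martingale_step m2 (G := G N)); last first.
  - exact: cY.
  - exact: LY.
  - apply: ih => [i iN|i iN|i k /andP[ik kN]].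
    + by apply: LY; exact: ltn_trans (ltnSn N).
    + by apply: cY; exact: ltn_trans (ltnSn N).
    + by apply: GY; rewrite ik (ltn_trans kN).
  - apply: (measurable_vec_sum he) => i.
    by apply: GY; rewrite ltn_ord ltnSn.
apply: martingale_sum_le => //; first exact: ltW.
- by rewrite mulr_ge0 //; exact: le_trans ler01 C1.
- rewrite !mulr_ge0 //; first exact: le_trans ler01 C1.
  by apply: sumr_ge0 => i _; exact: sqr_ge0.
Qed.

End martingale_sums.

Section bochner.
Context {d : measure_display} {Omega : measurableType d} {R : realType}.
Variables (P : probability Omega R) (E : normedModType R).

Lemma measurable_simple (X : Omega -> E) : simple X ->
  measurable_fun setT (X : Omega -> borel E).
Proof.
move=> [fX mX]; apply: measurable_borelP => U oU.
have -> : X @^-1` U = \bigcup_(y in range X `&` U) X @^-1` [set y].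
  apply/seteqP; split => w /=; first by move=> Uw; exists (X w).
  by case=> y [_ Uy] ->.
apply: fin_bigcup_measurable => //.
exact: finite_setIl.
Qed.

Variables (e : nat -> E) (l : E -> R) (k : R).
Hypothesis he : dense_sequence e.
Hypotheses (lD : forall x y, l (x + y) = l x + l y)
  (lZ : forall a x, l (a *: x) = a * l x) (lk : forall x, `|l x| <= k * `|x|).

Let l0 : l 0 = 0. Proof. by rewrite -(scale0r (0 : E)) lZ mul0r. Qed.

Let lB x y : l (x - y) = l x - l y.
Proof. by rewrite lD -scaleN1r lZ mulN1r. Qed.

Let l_continuous : continuous l.
Proof.
move=> x; apply/cvgrPdist_le => eps eps0.
have k1 : 0 < `|k| + 1 by rewrite ltr_wpDl.
near=> y; rewrite -lB; apply: le_trans (lk _) _.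
apply: (@le_trans _ _ ((`|k| + 1) * `|x - y|)).
  by rewrite ler_wpM2r // (le_trans (ler_norm k)) // lerDl.
rewrite -ler_pdivlMl //; near: y.
apply: cvgr_dist_le; first exact: cvg_id.
by rewrite mulr_gt0 // invr_gt0.
Unshelve. all: by end_near. Qed.

Lemma functional_simple_integral (B : set Omega) (X : Omega -> E) :
  measurable B -> simple X ->
  P.-integrable B (EFin \o (l \o X)) /\
  \int[P]_(w in B) l (X w) = l (simple_integral P B X).
Proof.
move=> mB [fX mX].
set s := finmap.enum_fset (fset_set (range X)).
have lE w : l (X w) = \sum_(y <- s) l y * \1_(X @^-1` [set y]) w.
  rewrite (bigD1_seq (X w)) /=; last exact: finmap.fset_uniq.
    rewrite indicE mem_set // mulr1 big1 ?addr0 // => y yX.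
    rewrite indicE memNset ?mulr0 //= => Xy; by rewrite Xy eqxx in yX.
  by rewrite in_fset_set //; apply/mem_set; exists w.
have i1 y : P.-integrable B (EFin \o (fun w => l y * \1_(X @^-1` [set y]) w)).
  have h : P.-integrable B (EFin \o \1_(X @^-1` [set y])).
    apply: integrableS (integrable_indic _ _) => //.
  by have := integrableZl mB (l y) h; apply: eq_integrable.
have hs (r : seq E) : P.-integrable B
    (EFin \o (fun w => \sum_(y <- r) l y * \1_(X @^-1` [set y]) w)) /\
    \int[P]_(w in B) (\sum_(y <- r) l y * \1_(X @^-1` [set y]) w) =
    \sum_(y <- r) l y * fine (P (B `&` X @^-1` [set y])).
  elim: r => [|y r [ih1 ih2]].
    split; first by apply: eq_integrable (integrable0 _ _) => // w _; rewrite /= big_nil.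
    under eq_Rintegral do rewrite big_nil.
    by rewrite big_nil Rintegral_cst // mul0r.
  split.
    have := integrableD mB (i1 y) ih1; apply: eq_integrable => // w _.
    by rewrite /= big_cons EFinD.
  under eq_Rintegral do rewrite big_cons.
  rewrite RintegralD // ih2 big_cons; congr (_ + _).
  rewrite RintegralZl //; last first.
    by apply: integrableS (integrable_indic _ _).
  by rewrite /Rintegral integral_indic // setIC.
have [h1 h2] := hs s; split.
  by apply: eq_integrable h1 => // w _; rewrite /= lE.
under eq_Rintegral do rewrite lE.
rewrite h2 /simple_integral fsbig_finite //= -/s.
elim: {h1 h2 hs lE} (s : seq E) => [|y r ih]; first by rewrite !big_nil l0.
by rewrite !big_cons lD lZ ih mulrC.
Qed.

Lemma functional_bochner_integral (B : set Omega) (X : Omega -> E) I :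
  measurable B -> measurable_fun setT (X : Omega -> borel E) ->
  P.-integrable B (EFin \o (l \o X)) -> bochner_integral P B X I ->
  \int[P]_(w in B) l (X w) = l I.
Proof.
move=> mB mX iX [X_ [sX cX cI]].
have c1 : l (simple_integral P B (X_ n)) @[n --> \oo] --> l I.
  by apply: continuous_cvg => //; exact: l_continuous.
have c2 : l (simple_integral P B (X_ n)) @[n --> \oo] --> \int[P]_(w in B) l (X w).
  apply/cvgrPdist_le => eps eps0.
  have k1 : 0 < `|k| + 1 by rewrite ltr_wpDl.
  have /fine_cvgP[fin cf] := cX.
  have del0 : 0 < (`|k| + 1)^-1 * eps by rewrite mulr_gt0 // invr_gt0.
  apply: filterS2 fin (cvgr0_norm_le _ cf _ del0) => n fin hn.
  have [in1 <-] := functional_simple_integral mB (sX n).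
  rewrite -RintegralB //.
  have iB : P.-integrable B (EFin \o (fun w => l (X w) - l (X_ n w))).
    by have := integrableB mB iX in1; apply: eq_integrable.
  apply: le_trans (le_normr_Rintegral mB iB) _.
  rewrite -lee_fin /Rintegral fineK; last first.
    by apply: integrable_fin_num => //; have := integrable_norm iB.
  have mB' : measurable_fun B (fun w => `|X_ n w - X w|).
    apply: measurable_funTS; apply: measurable_vec_norm.
    by apply: (measurable_vecB he) => //; exact: measurable_simple.
  apply: (@le_trans _ _ (\int[P]_(w in B) ((`|k| + 1)%:E * (`|X_ n w - X w|)%:E))%E).
    apply: ge0_le_integral => //.
    - by case/integrableP: (integrable_norm iB).
    - by apply: emeasurable_funM => //; exact/measurable_EFinP.
    move=> w _ /=; rewrite -EFinM lee_fin -lB; apply: le_trans (lk _) _.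
    rewrite distrC ler_wpM2r // (le_trans (ler_norm k)) // lerDl //.
  rewrite ge0_integralZl //; last first.
  - exact/measurable_EFinP.
  rewrite -(fineK fin) -EFinM lee_fin -ler_pdivlMl //.
  exact: le_trans (ler_norm _) hn.
exact: cvg_unique c2 c1.
Qed.

End bochner.

Lemma measurable_norm_lt {d : measure_display} {T : measurableType d} {R : realType}
    (E : normedModType R) (X Y : T -> E) :
  measurable_fun setT (X : T -> borel E) -> measurable_fun setT (Y : T -> borel E) ->
  measurable [set w | `|X w| < `|Y w|].
Proof.
move=> mX mY.
have mf : measurable_fun setT (fun w => `|Y w| - `|X w|).
  by apply: measurable_funB; exact: measurable_vec_norm.
have := mf measurableT `]0, +oo[%classic (measurable_itv _).
rewrite setTI; congr measurable; apply/seteqP; split => w /=;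
  by rewrite in_itv /= andbT subr_gt0.
Qed.

Section conditional_expectation.
Context {d : measure_display} {Omega : measurableType d} {R : realType}.
Variables (P : probability Omega R) (m : R) (H : monotone_family R).
Hypothesis m2 : 2 <= m.
Variable G : set (set Omega).
Hypotheses (sG : sigma_algebra setT G) (Gm : G `<=` measurable).

Let m1 : 1 <= m. Proof. by apply: le_trans m2; rewrite ler1n. Qed.
Let m0 : 0 < m. Proof. exact: lt_le_trans m1. Qed.

Lemma sub_sigma_measurable (B : set Omega) :
  measurable (B : set (g_sigma_algebraType G)) <-> G B.
Proof.
split; last exact: sub_sigma_algebra.
by apply: smallest_sub.
Qed.

Lemma measurable_wrt_measurable (E : normedModType R) (X : Omega -> E) :
  measurable_wrt G X -> measurable_fun setT (X : Omega -> borel E).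
Proof.
move=> mX; apply: measurable_borelP => U oU; apply: Gm.
by apply/sub_sigma_measurable; exact: measurable_borel_open mX oU.
Qed.

Section orthogonality.
Variable g : R.
Local Notation E := (H g).
Implicit Types X V : Omega -> E.

Fixpoint nearest_approx (e : nat -> E) (W : Omega -> E) (n : nat) (w : Omega) : E :=
  if n is k.+1 then
    if w \in [set w | `|W w - e k| < `|W w - nearest_approx e W k w|] then e k
    else nearest_approx e W k w
  else 0.

Lemma nearest_approx_dist e W n w : `|W w - nearest_approx e W n w| <= `|W w|.
Proof.
elim: n => [|n ih] /=; first by rewrite subr0.
by case: ifPn => // /[!inE] /ltW h; exact: le_trans ih.
Qed.

Lemma nearest_approx_le e W n k w : (k < n)%N ->
  `|W w - nearest_approx e W n w| <= `|W w - e k|.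
Proof.
elim: n => // n ih; rewrite ltnS leq_eqVlt => /predU1P[->|kn] /=.
  by case: ifPn => //; rewrite notin_setE /= => /negP; rewrite -leNgt.
by apply: le_trans (ih kn); case: ifPn => [|//]; rewrite inE => /ltW.
Qed.

Lemma nearest_approx_cvg e W w : dense_sequence e ->
  nearest_approx e W n w @[n --> \oo] --> W w.
Proof.
move=> he; apply/cvgrPdist_lt => eps eps0.
have [k hk] := he (W w) _ eps0.
exists k.+1 => // n /= kn; apply: le_lt_trans hk.
exact: nearest_approx_le.
Qed.

Lemma measurable_nearest_approx e W n : dense_sequence e -> measurable_wrt G W ->
  measurable_wrt G (nearest_approx e W n).
Proof.
move=> he GW; elim: n => [|n ih].
  exact: (@measurable_vec_cst _ (g_sigma_algebraType G) _ E 0).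
apply: (@measurable_vec_if _ (g_sigma_algebraType G) _ E
    [set w | `|W w - e n| < `|W w - nearest_approx e W n w|] (fun=> e n)) => //.
apply: (@measurable_norm_lt _ (g_sigma_algebraType G)); apply: (measurable_vecB he GW).
  exact: (@measurable_vec_cst _ (g_sigma_algebraType G) _ E (e n)).
exact: ih.
Qed.

Lemma inner_cst_integrable (y : E) V b : Lbound P m V b ->
  P.-integrable setT (EFin \o (fun w => inner y (V w))).
Proof.
move=> LV; pose Y (w : Omega) : E := y.
have LY : Lbound P m Y `|y|.
  split => //; first exact: measurable_vec_cst.
  rewrite (eq_integral (cst (`|y| `^ m)%:E)) // integral_cst //.
  apply: le_trans (lee_wpmul2l _ (probability_le1 P measurableT)) _.
    by rewrite lee_fin powR_ge0.
  by rewrite mule1.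
have iYV := dual_density_integrable m2 LY LV.
have [->|y0] := eqVneq y 0.
  by apply: eq_integrable (integrable0 _ _) => // w _; rewrite /= inner0l.
have := integrableZl measurableT (`|y| `^ (m - 2))^-1 iYV.
apply: eq_integrable => // w _; rewrite /= -EFinM /dual_density mulKf //.
by rewrite gt_eqF // powR_gt0 // normr_gt0.
Qed.

Lemma orthogonal_sub_sigma X V a b : measurable_wrt G X -> Lbound P m X a ->
  Lbound P m V b ->
  (forall B (y : E), G B -> \int[P]_(w in B) inner y (V w) = 0) ->
  \int[P]_w dual_density m X V w = 0.
Proof.
move=> GX LX LV V0; have [[mX _ _] [mV _ _]] := (LX, LV).
have [e he] := separable_dense_sequence H g.
pose W w : E := (`|X w| `^ (m - 2)) *: X w.
have WE w : inner (W w) (V w) = dual_density m X V w.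
  by rewrite /W innerZl.
have Wn w : `|W w| = `|X w| `^ (m - 1).
  rewrite normrZ ger0_norm ?powR_ge0 // [RHS]powR_split //; last by have := m2; lra.
  by congr (_ `^ _ * _); lra.
have GW : measurable_wrt G W.
  have [f hf] := dense_sequence_real (R := R).
  apply: (@measurable_borel_comp2 _ (g_sigma_algebraType G) R R^o E f e hf he E
    (fun z => z.1 *: z.2) (fun w => `|X w| `^ (m - 2)) X) => //.
  - by move=> z; apply: cvgZ; [exact: cvg_fst|exact: cvg_snd].
  - apply/measurable_borelR; apply: (measurableT_comp (measurable_powR _)).
    exact: measurable_vec_norm.
pose Wa := nearest_approx e W.
have GWa n : measurable_wrt G (Wa n) by exact: measurable_nearest_approx.
have mWa n := measurable_wrt_measurable (GWa n).
have mW := measurable_wrt_measurable GW.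
pose D w := 2 * (`|X w| `^ (m - 1) * `|V w| `^ 1).
have mD : measurable_fun setT (fun w => `|X w| `^ (m - 1) * `|V w| `^ 1).
  by apply: measurable_funM; exact: measurable_norm_powR.
have iD : P.-integrable setT (EFin \o D).
  have h : P.-integrable setT (EFin \o (fun w => `|X w| `^ (m - 1) * `|V w| `^ 1)).
    apply: (@mixed_moment_integrable _ _ _ P m H g m2 X V a b (m - 1) 1 _ LX LV);
      rewrite ?subrK ?subr_ge0 ?ler01 //.
    by move=> w; rewrite ger0_norm // mulr_ge0 ?powR_ge0.
  by have := integrableZl measurableT 2 h; apply: eq_integrable.
have Wa2 n w : `|Wa n w| <= 2 * `|X w| `^ (m - 1).
  rewrite -Wn (_ : Wa n w = W w - (W w - Wa n w)); last by rewrite subKr.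
  apply: le_trans (ler_normB _ _) _; rewrite mulr_natl mulr2n lerD2l.
  exact: nearest_approx_dist.
have WaD n w : `|inner (Wa n w) (V w)| <= D w.
  apply: le_trans (ler_norm_inner _ _) _; rewrite /D powRr1 // mulrA.
  by rewrite ler_wpM2r.
have D0 w : 0 <= D w by apply: le_trans (WaD 0%N w).
have iWa n : P.-integrable setT (EFin \o (fun w => inner (Wa n w) (V w))).
  apply: le_integrable iD => //.
    by apply/measurable_EFinP; exact: measurable_inner.
  by move=> w _; rewrite /= lee_fin (ger0_norm (D0 w)) WaD.
have iV y := inner_cst_integrable y LV.
have W0 n : forall B, G B -> \int[P]_(w in B) inner (Wa n w) (V w) = 0.
  elim: n => [|n ih] B GB.
    under eq_Rintegral do rewrite inner0l.
    by rewrite Rintegral_cst ?mul0r //; exact: Gm.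
  set C := [set w | `|W w - e n| < `|W w - Wa n w|].
  have GC : G C.
    apply/sub_sigma_measurable.
    apply: (@measurable_norm_lt _ (g_sigma_algebraType G)); apply: (measurable_vecB he GW).
      exact: (@measurable_vec_cst _ (g_sigma_algebraType G) _ E (e n)).
    exact: GWa.
  have mB := Gm GB; have mC := Gm GC.
  rewrite -(setUIDK B C) Rintegral_setU //; last 4 first.
  - exact: measurableI.
  - exact: measurableD.
  - by rewrite setUIDK; apply: integrableS (iWa n.+1).
  - by rewrite disj_set2E; apply/eqP; rewrite setDE setIACA setICr setI0.
  rewrite (@eq_Rintegral _ _ _ _ _ (fun w => inner (e n) (V w))); last first.
    by move=> w; rewrite inE => -[_ Cw]; rewrite /Wa /= mem_set.
  rewrite V0; last by apply/sub_sigma_measurable/measurableI; exact/sub_sigma_measurable.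
  rewrite (@eq_Rintegral _ _ _ _ _ (fun w => inner (Wa n w) (V w))); last first.
    by move=> w; rewrite inE => -[_ Cw]; rewrite /Wa /= memNset.
  rewrite ih ?addr0 //.
  by apply/sub_sigma_measurable/measurableD; exact/sub_sigma_measurable.
have [|||||_ _] := @dominated_convergence _ _ _ P setT measurableT
    (fun n w => (inner (Wa n w) (V w))%:E) (EFin \o dual_density m X V) (EFin \o D).
- by move=> n; apply/measurable_EFinP; exact: measurable_inner.
- by apply/measurable_EFinP; exact: measurable_dual_density.
- apply: nearW => w _ /=; apply/fine_cvgP; split; first exact: nearW.
  apply/cvgrPdist_le => eps eps0 /=.
  have V1 : 0 < `|V w| + 1 by rewrite ltr_wpDl.
  have del0 : 0 < (`|V w| + 1)^-1 * eps by rewrite mulr_gt0 // invr_gt0.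
  have /cvgrPdist_le/(_ _ del0) := @nearest_approx_cvg e W w he.
  apply: filterS => n hn /=.
  rewrite -WE !(innerC _ (V w)) -innerBr; apply: le_trans (ler_norm_inner _ _) _.
  apply: (@le_trans _ _ ((`|V w| + 1) * `|W w - Wa n w|)); last by rewrite -ler_pdivlMl.
  by rewrite ler_wpM2r // lerDl.
- exact: iD.
- by apply: nearW => w n _; rewrite /= lee_fin WaD.
have GT : G setT by case: sG => G0 GC _; rewrite -(setD0 setT); exact: GC.
rewrite (_ : [sequence _]_n = cst 0%E); last first.
  apply/funext => n /=.
  have := W0 n _ GT; rewrite /Rintegral => h.
  by rewrite -(fineK (integrable_fin_num measurableT (iWa n))) h.
by move=> /(cvg_lim (@ereal_hausdorff R)); rewrite lim_cst // /Rintegral => <-.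
Qed.

End orthogonality.

Lemma cond_bound_condexp (g1 g : R) (f : {linear H g1 -> H g}) (k : R)
    (X Z : Omega -> H g1) (b c : R) :
  continuous f -> (forall x, `|f x| <= k * `|x|) ->
  measurable_fun setT (X : Omega -> borel (H g1)) -> condexp P G X Z ->
  Lbound P m (f \o X) b -> Lbound P m (f \o Z) c ->
  cond_bound P m G (f \o X) c.
Proof.
move=> cf fk mX [GZ XZ] LX LZ.
have [e he] := separable_dense_sequence H g.
have [e1 he1] := separable_dense_sequence H g1.
have mZ := measurable_wrt_measurable GZ.
have LV := LboundB m1 he LX LZ.
have hV : cond_bound P m G (fun w => f (X w) - f (Z w)) 0.
  split => // W a GW LW; rewrite (orthogonal_sub_sigma GW LW LV) ?mulr0 // => B y GB.
  have [I XI ZI] := XZ B GB; have mB := Gm GB.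
  pose l x := inner y (f x).
  have lD x x' : l (x + x') = l x + l x' by rewrite /l linearD innerDr.
  have lZ' a' x : l (a' *: x) = a' * l x by rewrite /l linearZ innerZr.
  have lk x : `|l x| <= (`|y| * k) * `|x|.
    by apply: le_trans (ler_norm_inner _ _) _; rewrite -mulrA ler_wpM2l.
  have iy Y u : Lbound P m (f \o Y) u -> P.-integrable B (EFin \o (l \o Y)).
    move=> LY; apply: (@integrableS _ _ _ P setT) => //.
    exact: (inner_cst_integrable y LY).
  have := functional_bochner_integral he1 lD lZ' lk mB mX (iy _ _ LX) XI.
  have := functional_bochner_integral he1 lD lZ' lk mB mZ (iy _ _ LZ) ZI.
  under [X in _ -> _ -> X = _]eq_Rintegral do rewrite innerBr.
  rewrite RintegralB //; [|exact: iy LX|exact: iy LZ].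
  by move=> -> ->; rewrite subrr.
have := cond_boundD m2 LV LZ hV (Lbound_cond_bound m2 G LZ).
rewrite add0r; congr cond_bound.
by apply/funext => w /=; rewrite subrK.
Qed.
End conditional_expectation.

(** * Lifts of the propagator to smoother spaces *)

Section hnorm_theory.
Context {R : realType} (H : monotone_family R).

Lemma hnorm_emb g g' (v : H g') : g <= g' -> hnorm g' (emb H g g' v) = `|v|%:E.
Proof.
move=> gg'; rewrite /hnorm -[RHS]ereal_inf1; congr ereal_inf.
apply/seteqP; split => [_ [v' /= /(emb_inj gg') -> <-] //|_ ->].
by exists v.
Qed.

Lemma hnorm_id g (u : H g) : hnorm g u = `|u|%:E.
Proof. by rewrite -{1}[u]emb_id hnorm_emb. Qed.

Lemma hnorm_ge0 g g' (u : H g) : (0 <= hnorm g' u)%E.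
Proof. by apply: le_ereal_inf_tmp => _ [v _ <-]; rewrite lee_fin. Qed.

Lemma hnorm_lty g g' (u : H g) : (hnorm g' u < +oo)%E -> exists v, emb H g g' v = u.
Proof.
move=> h; apply: contrapT => /forallNP nex; move: h; rewrite /hnorm.
rewrite (_ : [set v | _] = set0) ?image_set0 ?ereal_inf0 //.
by apply/seteqP; split => // v /= /nex.
Qed.

Lemma linear_continuous_bound g g' (f : {linear H g -> H g'}) : continuous f ->
  exists2 C : R, 0 < C & forall u, `|f u| <= C * `|u|.
Proof.
move=> cf; have /linear_boundedP/pinfty_ex_gt0[C C0 hC] : bounded_near f (nbhs 0).
  exact/linear_bounded_continuous.
by exists C.
Qed.

Lemma bound_linear_continuous g g' (f : {linear H g -> H g'}) (C : R) :
  (forall u, `|f u| <= C * `|u|) -> continuous f.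
Proof.
move=> hC; apply/linear_bounded_continuous/linear_boundedP.
apply: filterS (nbhs_pinfty_ge (num_real C)) => k Ck u.
by apply: le_trans (hC u) _; rewrite ler_wpM2r.
Qed.

End hnorm_theory.

Lemma lerD1 (R : realType) (x : R) : x <= x + 1.
Proof. by rewrite lerDl. Qed.

Section propagator_lifts.
Context {R : realType} (T : R) (H : monotone_family R) (L : operator_family H T).
Variable S : propagator L.

Lemma propagator_bound g : exists2 C : R, 0 < C &
  forall s t (u : H g), Delta2 T (s, t) -> `|S g s t u| <= C * `|u|.
Proof.
have g1 : g <= g + 1 by rewrite lerDl.
have [C hC] := prop_smoothing S (lexx g) g1.
exists (Num.max C 1); first by rewrite lt_max ltr01 orbT.
move=> s t u [/= s0 st tT].
move: st; rewrite le_eqVlt => /predU1P[st|st].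
  rewrite st prop_id; last by rewrite -st s0 st tT.
  by rewrite ler_peMl // le_max lexx orbT.
have := hC s t u s0 st tT; rewrite subrr powRr0 mul1r hnorm_id lee_fin => h.
by apply: le_trans h _; rewrite ler_wpM2r // le_max lexx.
Qed.

(* [f] is the operator [S_{s,t}] seen as a map from [H_g] to the smaller space [H_g']. *)
Definition is_lift {g g'} (s t : R) (f : H g -> H g') : Prop :=
  forall u, emb H g g' (f u) = S g s t u.

Lemma ex_lift_unit g1 g2 : g1 <= g2 -> g2 <= g1 + 1 ->
  exists2 C : R, 0 < C & forall s t, 0 <= s -> s < t -> t <= T ->
    exists2 f : {linear H g1 -> H g2}, is_lift s t f &
      forall u, `|f u| <= C * (t - s) `^ (g1 - g2) * `|u|.
Proof.
move=> g12 g21; have [C hC] := prop_smoothing S g12 g21.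
exists (Num.max C 1); first by rewrite lt_max ltr01 orbT.
move=> s t s0 st tT.
pose f u := xget 0 [set v : H g2 | emb H g1 g2 v = S g1 s t u].
have fE u : emb H g1 g2 (f u) = S g1 s t u.
  have [v vE] : exists v, emb H g1 g2 v = S g1 s t u.
    by apply: hnorm_lty; apply: le_lt_trans (hC s t u s0 st tT) _; rewrite ltry.
  by rewrite /f; case: xgetP => [y -> //|/(_ v)].
have flin : linear f.
  by move=> a u v; apply: (emb_inj g12); rewrite linearP !fE linearP.
pose F : {linear H g1 -> H g2} :=
  HB.pack f (GRing.isLinear.Build R (H g1) (H g2) *:%R f flin).
exists F => // u.
have := hC s t u s0 st tT; rewrite -fE hnorm_emb // lee_fin => h.
apply: le_trans h _; rewrite mulrA ler_wpM2r // ler_wpM2r ?powR_ge0 //.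
by rewrite le_max lexx.
Qed.

Lemma ex_lift g1 g2 : g1 <= g2 ->
  exists2 C : R, 0 < C & forall s t, 0 <= s -> s < t -> t <= T ->
    exists2 f : {linear H g1 -> H g2}, is_lift s t f &
      forall u, `|f u| <= C * (t - s) `^ (g1 - g2) * `|u|.
Proof.
move=> g12; have [n hn] : exists n : nat, g2 <= g1 + n.+1%:R.
  by exists (Num.truncn (g2 - g1)); rewrite -lerBlDl ltW // truncnS_gt.
elim: n g1 g12 hn => [|n ih] g1 g12 hn; first exact: ex_lift_unit.
have [h|h] := leP g2 (g1 + 1); first exact: ex_lift_unit.
have [C1 C10 h1] := ex_lift_unit (lerD1 g1) (lexx (g1 + 1)).
have [|C2 C20 h2] := ih (g1 + 1) (ltW h).
  by rewrite -addrA (addrC 1) natr1.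
exists (C2 * C1 * 2 `^ (g2 - g1)); first by rewrite !mulr_gt0 ?powR_gt0.
move=> s t s0 st tT; pose r := (s + t) / 2.
have sr : s < r by rewrite /r; lra.
have rt : r < t by rewrite /r; lra.
have [f1 f1E f1C] := h1 s r s0 sr (le_trans (ltW rt) tT).
have [f2 f2E f2C] := h2 r t (le_trans s0 (ltW sr)) rt tT.
exists [the {linear H g1 -> H g2} of f2 \o f1] => [u|u] /=.
  rewrite -(emb_comp _ (lerD1 g1) (ltW h)) f2E -prop_emb.
  - by rewrite f1E prop_comp //; split => //=; exact: ltW.
  - exact: lerD1.
  - by split => /=; [exact: le_trans (ltW sr)|exact: ltW|].
apply: le_trans (f2C _) _.
have tr : t - r = (t - s) / 2 by rewrite /r; lra.
have rs : r - s = (t - s) / 2 by rewrite /r; lra.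
rewrite tr; set x := (t - s) / 2; rewrite rs -/x in f1C.
have x0 : 0 < x by rewrite /x; lra.
have -> : t - s = 2 * x by rewrite /x; lra.
have x1 r' : 0 <= x `^ r' by exact: powR_ge0.
apply: le_trans (ler_wpM2l _ (f1C u)) _.
  by rewrite mulr_ge0 // ltW.
rewrite (powRM _ (ler0n _ 2) (ltW x0)).
rewrite le_eqVlt; apply/orP; left; apply/eqP.
have p0 : 2 `^ (g2 - g1) != 0 :> R by rewrite gt_eqF // powR_gt0.
have -> : 2 `^ (g1 - g2) = (2 `^ (g2 - g1))^-1 :> R by rewrite -powRN opprB.
have <- : x `^ (g1 + 1 - g2) * x `^ (g1 - (g1 + 1)) = x `^ (g1 - g2).
  rewrite -powRD; last by rewrite (gt_eqF x0) implybT.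
  by congr (_ `^ _); lra.
by field.
Qed.

Lemma ex_smoothing g g' g2 : g <= g' -> g <= g2 ->
  exists2 C : R, 0 < C & forall s t, 0 <= s -> s <= t -> t <= T -> s < t \/ g2 = g ->
    exists2 f : {linear H g -> H g2}, is_lift s t f & continuous f /\
      forall v : H g', `|f (emb H g g' v)| <= C * (t - s) `^ (- Num.max (g2 - g') 0) * `|v|.
Proof.
move=> gg' gg2.
have [C0 C00 hC0] := propagator_bound g.
have [g2g'|g'g2] := leP g2 g'.
  have [C1 C10 hC1] := linear_continuous_bound (emb_continuous (m:=H) g2g').
  have [C2 C20 hC2] := propagator_bound g'.
  exists (C1 * C2); first exact: mulr_gt0.
  move=> s t s0 st tT stg.
  have D2 : Delta2 T (s, t) by [].
  have fE (f : {linear H g -> H g2}) : is_lift s t f -> forall v : H g',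
      `|f (emb H g g' v)| <= C1 * C2 * (t - s) `^ (- Num.max (g2 - g') 0) * `|v|.
    move=> lf v; have -> : f (emb H g g' v) = emb H g2 g' (S g' s t v).
      by apply: (emb_inj gg2); rewrite lf prop_emb // emb_comp.
    have -> : Num.max (g2 - g') 0 = 0 by apply/max_idPr; rewrite subr_le0.
    rewrite oppr0 powRr0 mulr1; apply: le_trans (hC1 _) _.
    by rewrite -mulrA ler_wpM2l ?(ltW C10) // hC2.
  case: stg => [lst|g2E].
    have [C hC lift] := ex_lift gg2.
    have [f lf fC] := lift s t s0 lst tT; exists f => //; split; last exact: fE.
    exact: bound_linear_continuous fC.
  move: gg2 g2g' hC1 fE; rewrite g2E => gg2 g2g' hC1 fE.
  have lf : is_lift s t (S g s t) by move=> u; rewrite emb_id.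
  exists (S g s t) => //; split; last exact: fE.
  exact: prop_bounded.
have [C hC lift] := ex_lift gg2.
have [C' hC' lift'] := ex_lift (ltW g'g2).
exists C' => // s t s0 st tT stg.
have lst : s < t.
  case: stg => // g2E; move: gg' g'g2; rewrite g2E => h1 h2.
  by have := le_lt_trans h1 h2; rewrite ltxx.
have [f lf fC] := lift s t s0 lst tT; exists f => //; split.
  exact: bound_linear_continuous fC.
have [f' lf' fC'] := lift' s t s0 lst tT.
have D2 : Delta2 T (s, t) by [].
move=> v; have -> : f (emb H g g' v) = f' v.
  by apply: (emb_inj gg2); rewrite lf prop_emb // -lf' emb_comp // ltW.
have -> : Num.max (g2 - g') 0 = g2 - g' by apply/max_idPl; rewrite subr_ge0 ltW.
by rewrite opprB.
Qed.

Lemma hnorm_lift_le g g' g2 (f : H g -> H g2) (k : R) : 0 < k ->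
  (forall v : H g', `|f (emb H g g' v)| <= k * `|v|) ->
  forall u, ((k^-1 * `|f u|)%:E <= hnorm g' u)%E.
Proof.
move=> k0 hf u; apply: le_ereal_inf_tmp => _ [v /= <- <-].
by rewrite lee_fin ler_pdivrMl.
Qed.

End propagator_lifts.

Import HBNNSimple.

Section lower_integral_ae.
Context {d : measure_display} {Omega : measurableType d} {R : realType}.
Variables (P : probability Omega R).

Lemma ae_le_integral_nonmeasurable (f g : Omega -> \bar R) :
  (forall w, 0 <= f w)%E -> (forall w, 0 <= g w)%E -> measurable_fun setT g ->
  {ae P, forall w, (f w <= g w)%E} -> (\int[P]_w f w <= \int[P]_w g w)%E.
Proof.
move=> f0 g0 mg fg; rewrite ge0_integralTE //.
apply: ge_ereal_sup => _ [h /= hf <-]; rewrite -integralT_nnsfun.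
apply: ae_ge0_le_integral => //.
- by move=> w _; rewrite lee_fin.
- exact/measurable_EFinP.
by apply: filterS fg => w fg _; exact: le_trans (hf w) fg.
Qed.

Variable m : R.
Hypothesis m1 : 1 <= m.
Variable (H : monotone_family R).
Let m0 : 0 < m. Proof. exact: lt_le_trans m1. Qed.

Lemma Lmnorm_LboundP g (X : Omega -> H g) c : 0 <= c ->
  measurable_fun setT (X : Omega -> borel (H g)) ->
  (Lmnorm P m g X <= c%:E)%E <-> Lbound P m X c.
Proof.
move=> c0 mX; rewrite /Lmnorm.
rewrite (_ : (fun w => hnorm g (X w)) = (fun w => (`|X w|)%:E)); last first.
  by apply/funext => w; exact: hnorm_id.
rewrite Lnorm_norm_le //; split=> [h|[]] //.
Qed.

Lemma Lbound_Lmnorm g g' (X : Omega -> H g) (Y : Omega -> H g') c : g <= g' ->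
  {ae P, forall w, X w = emb H g g' (Y w)} -> Lbound P m Y c ->
  (Lmnorm P m g' X <= c%:E)%E.
Proof.
move=> gg' XY [mY c0 hY]; rewrite /Lmnorm Lnorm_le //.
apply: le_trans hY; apply: ae_le_integral_nonmeasurable => //.
- by move=> w; exact: poweR_ge0.
- by apply/measurable_EFinP/measurable_norm_powR.
apply: filterS XY => w ->; rewrite hnorm_emb //.
by rewrite abse_EFin normr_id poweR_EFin.
Qed.

Lemma Lmnorm_Lbound_lift g g' g2 (f : {linear H g -> H g2}) (X : Omega -> H g) k c :
  0 < k -> 0 <= c -> continuous f ->
  (forall v : H g', `|f (emb H g g' v)| <= k * `|v|) ->
  measurable_fun setT (X : Omega -> borel (H g)) ->
  (Lmnorm P m g' X <= c%:E)%E -> Lbound P m (f \o X) (k * c).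
Proof.
move=> k0 c0 cf fk mX; rewrite /Lmnorm Lnorm_le // => hX.
have mfX : measurable_fun setT (f \o X : Omega -> borel (H g2)).
  exact: measurable_borel_comp.
split => //; first by rewrite mulr_ge0 // ltW.
have mfXm : measurable_fun setT (fun w => (`|f (X w)| `^ m)%:E).
  by apply/measurable_EFinP; exact: (measurable_norm_powR m mfX).
have km : 0 < k `^ m by rewrite powR_gt0.
have : (\int[P]_w ((k `^ m)^-1%:E * (`|f (X w)| `^ m)%:E) <= (c `^ m)%:E)%E.
  apply: le_trans hX; apply: le_integral_nonmeasurable => w.
    by rewrite -EFinM lee_fin mulr_ge0 ?powR_ge0 // invr_ge0 ltW.
  have := hnorm_lift_le k0 fk (X w).
  have -> : ((k `^ m)^-1%:E * (`|f (X w)| `^ m)%:E)%E =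
      ((k^-1 * `|f (X w)|)%:E `^ m)%E.
    rewrite poweR_EFin -EFinM powRM ?invr_ge0 ?(ltW k0) //.
    by rewrite powR_invl // ltW.
  move=> h; apply: gt0_ler_poweR.
  - exact: ltW.
  - by rewrite in_itv /= leey andbT lee_fin mulr_ge0 // invr_ge0 ltW.
  - by rewrite in_itv /= leey abse_ge0.
  - by rewrite gee0_abs // hnorm_ge0.
rewrite ge0_integralZl //; last by rewrite lee_fin invr_ge0 ltW.
by rewrite lee_pdivrMl // -EFinM powRM // ltW.
Qed.

End lower_integral_ae.

(** * Refinement of Riemann sums *)

Section two_level_smoothing.
Context {R : realType} (T : R) (H : monotone_family R) (L : operator_family H T).
Variable S : propagator L.

Definition smoothing_cst (g g' g2 C : R) : Prop := 0 < C /\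
  forall s t, 0 <= s -> s <= t -> t <= T -> s < t \/ g2 = g ->
  exists f : {linear H g -> H g2}, [/\ is_lift S s t f, continuous f,
    forall v : H g',
      `|f (emb H g g' v)| <= C * (t - s) `^ (- Num.max (g2 - g') 0) * `|v| &
    forall v : H g, `|f v| <= C * (t - s) `^ (g - g2) * `|v|].

Lemma ex_smoothing_cst g g' g2 : g <= g' -> g <= g2 ->
  exists C, smoothing_cst g g' g2 C.
Proof.
move=> gg' gg2.
have [C1 C10 h1] := ex_smoothing S gg' gg2.
have [C2 C20 h2] := ex_smoothing S (lexx g) gg2.
exists (Num.max C1 C2); split; first by rewrite lt_max C10.
move=> s t s0 st tT stg.
have [f lf [cf fv]] := h1 s t s0 st tT stg.
have [f' lf' [_ fv']] := h2 s t s0 st tT stg.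
exists f; split => // v.
  apply: le_trans (fv v) _; rewrite ler_wpM2r // ler_wpM2r ?powR_ge0 //.
  by rewrite le_max lexx.
have -> : f v = f' (emb H g g v) by apply: (emb_inj gg2); rewrite lf lf' emb_id.
apply: le_trans (fv' v) _.
have -> : Num.max (g2 - g) 0 = g2 - g by apply/max_idPl; rewrite subr_ge0.
rewrite opprB ler_wpM2r // ler_wpM2r ?powR_ge0 //.
by rewrite le_max lexx orbT.
Qed.

End two_level_smoothing.

Section filtrations.
Context {R : realType} {d : measure_display} {Omega : measurableType d}.
Variables (P : probability Omega R) (T : R) (Ft : R -> set (set Omega)).
Hypotheses (T0 : 0 < T) (uF : usual_filtration P T Ft).
Variable E : normedModType R.
Implicit Types X Y : Omega -> E.

Lemma measurable_wrt_incr s t X : Delta2 T (s, t) ->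
  measurable_wrt (Ft s) X -> measurable_wrt (Ft t) X.
Proof.
move=> st mX; have [/= s0 st' tT] := st.
have s01 : 0 <= s <= T by rewrite s0 (le_trans st').
apply: (@measurable_borelP _ (g_sigma_algebraType (Ft t))) => U oU.
have := @measurable_borel_open _ (g_sigma_algebraType (Ft s)) E X U mX oU.
move/(sub_sigma_measurable (filtration_sigma uF s01)) => h.
by apply: sub_sigma_algebra; exact: (filtration_incr uF st).
Qed.

Lemma measurable_wrt_sub t X : 0 <= t <= T ->
  measurable_wrt (Ft t) X -> measurable_fun setT (X : Omega -> borel E).
Proof.
move=> tT; apply: measurable_wrt_measurable; first exact: (filtration_sigma uF).
exact: (filtration_sub uF).
Qed.

Lemma measurable_wrt_ae t X Y : 0 <= t <= T -> {ae P, forall w, X w = Y w} ->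
  measurable_wrt (Ft t) X -> measurable_wrt (Ft t) Y.
Proof.
move=> tT XY mX; have /andP[t0 tT'] := tT.
have sFt := filtration_sigma uF tT.
have neg N : P.-negligible N -> <<s Ft t>> N.
  move=> /(filtration_complete uF) FN; apply: sub_sigma_algebra.
  by apply: (filtration_incr uF (s := 0)) FN; split.
have negXY : P.-negligible [set w | X w != Y w].
  apply: negligibleS XY => w /= /eqP XYw; exact.
apply: (@measurable_borelP _ (g_sigma_algebraType (Ft t))) => U oU.
have mXU := @measurable_borel_open _ (g_sigma_algebraType (Ft t)) E X U mX oU.
rewrite (_ : Y @^-1` U = (X @^-1` U `\` [set w | X w != Y w]) `|`
   (Y @^-1` U `&` [set w | X w != Y w])).
  apply: (@measurableU _ (g_sigma_algebraType (Ft t))).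
    by apply: (@measurableD _ (g_sigma_algebraType (Ft t))) => //; exact: neg.
  by apply: neg; apply: negligibleS negXY => w [].
apply/seteqP; split => w /=.
  move=> YU; have [XYw|XYw] := eqVneq (X w) (Y w); last by right.
  by left; split; [rewrite /= XYw|].
by case=> [[XU /negP/negbNE/eqP <-]|[]].
Qed.

End filtrations.

Section refinements.
Context {R : realType} (T : R) (H : monotone_family R) (L : operator_family H T).
Variables (S : propagator L) (m gamma z1 z2 : R).
Context {d : measure_display} {Omega : measurableType d}.
Variables (P : probability Omega R) (Ft : R -> set (set Omega)).
Variables (A : R -> R -> Omega -> H gamma) (Lambda : R -> R -> R -> Omega -> H gamma).
Variables (K1 K2 : R).
Hypotheses (T0 : 0 < T) (m2 : 2 <= m) (z1b : 2^-1 < z1 <= 1) (z2b : 1 < z2).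
Hypothesis uF : usual_filtration P T Ft.
Hypothesis adA : forall s t, Delta2 T (s, t) -> measurable_wrt (Ft t) (A s t).
Hypotheses (K10 : 0 < K1) (K20 : 0 < K2).
Hypothesis hLambda : forall s r t, Delta3 T (s, r, t) ->
    [/\ measurable_wrt measurable (Lambda s r t),
        {ae P, forall w, delta2 S A s r t w = S gamma r t (Lambda s r t w)},
        (Lmnorm P m (gamma + z2 - z1)%R (Lambda s r t) <=
          (K1 * (t - s) `^ 2^-1 * (t - r) `^ (z1 - 2^-1))%:E)%E &
        exists2 Z, condexp P (Ft s) (Lambda s r t) Z &
          (Lmnorm P m gamma Z <=
            (K2 * (t - s) * (t - r) `^ (z2 - 1))%:E)%E].
Local Notation E := (H gamma).
Local Notation gamma' := (gamma + z2 - z1).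

Let m1 : 1 <= m. Proof. by apply: le_trans m2; rewrite ler1n. Qed.

Lemma Delta3_itv (s r t : R) : Delta3 T (s, r, t) ->
  [/\ 0 <= s <= T, 0 <= r <= T & 0 <= t <= T].
Proof. by case=> /= s0 sr rt tT; split; apply/andP; split; lra. Qed.

Lemma measurable_Lambda s r t : Delta3 T (s, r, t) ->
  measurable_fun setT (Lambda s r t : Omega -> borel E).
Proof.
move=> D3; have [mL _ _ _] := hLambda D3.
by apply: (measurable_wrt_measurable _ _ mL) => //; exact: sigma_algebra_measurable.
Qed.

Lemma measurable_wrt_delta2 s r t : Delta3 T (s, r, t) ->
  measurable_wrt (Ft t) (delta2 S A s r t).
Proof.
move=> [/= s0 sr rt tT]; have [e he] := separable_dense_sequence H gamma.
have Dst : Delta2 T (s, t) by split => //=; exact: le_trans rt.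
have Drt : Delta2 T (r, t) by split => //=; exact: le_trans sr.
have Dsr : Delta2 T (s, r) by split => //=; exact: le_trans tT.
apply: (@measurable_vecB _ (g_sigma_algebraType (Ft t)) _ _ e he); last exact: adA.
apply: (@measurable_vecB _ (g_sigma_algebraType (Ft t)) _ _ e he); first exact: adA.
apply: (@measurable_borel_comp _ (g_sigma_algebraType (Ft t)) _ _ (S gamma r t)).
  exact: prop_bounded.
exact: (measurable_wrt_incr uF Drt (adA Dsr)).
Qed.

Lemma prop_delta2 u r v t w : 0 <= u -> u <= r -> r <= v -> v <= t -> t <= T ->
  S gamma v t (delta2 S A u r v w) = S gamma v t (A u v w) -
    (S gamma r t (A u r w) + S gamma v t (A r v w)).
Proof.
move=> u0 ur rv vt tT; rewrite /delta2 !linearB /= prop_comp; first by rewrite opprD addrA.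
by split => //=; exact: le_trans ur.
Qed.

Section target.
Variables (g2 C : R).
Hypotheses (gg2 : gamma <= g2) (hC : smoothing_cst S gamma gamma' g2 C).

Definition increment_size (t u r v : R) : R :=
  C * (t - r) `^ (- Num.max (g2 - gamma') 0) *
  (K1 * (v - u) `^ 2^-1 * (v - r) `^ (z1 - 2^-1)).

Definition increment_drift (t u r v : R) : R :=
  C * (t - r) `^ (gamma - g2) * (K2 * (v - u) * (v - r) `^ (z2 - 1)).

Lemma refinement_term u r v t : 0 <= u -> u <= r -> r <= v -> v <= t -> t <= T ->
  r < t \/ g2 = gamma ->
  exists Y : Omega -> H g2, [/\
    {ae P, forall w, emb H gamma g2 (Y w) = S gamma v t (delta2 S A u r v w)},
    Lbound P m Y (increment_size t u r v),
    cond_bound P m (Ft u) Y (increment_drift t u r v) &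
    v < t \/ g2 = gamma -> measurable_wrt (Ft v) Y].
Proof.
move=> u0 ur rv vt tT rt; have [C0 hS] := hC.
have D3 : Delta3 T (u, r, v) by split => //=; exact: le_trans tT.
have [uT rT vT] := Delta3_itv D3.
have [f [lf cf fv fv0]] := hS r t (le_trans u0 ur) (le_trans rv vt) tT rt.
have [_ dE LL [Z cZ LZ]] := hLambda D3.
have mL := measurable_Lambda D3.
have eq1 : {ae P, forall w,
    emb H gamma g2 (f (Lambda u r v w)) = S gamma v t (delta2 S A u r v w)}.
  apply: filterS dE => w ->; rewrite lf prop_comp //.
  by split => //=; exact: le_trans ur.
have ge0 : 0 <= K1 * (v - u) `^ 2^-1 * (v - r) `^ (z1 - 2^-1).
  by rewrite !mulr_ge0 ?powR_ge0 // ltW.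
have uv : 0 <= v - u by rewrite subr_ge0 (le_trans ur).
have ge0' : 0 <= K2 * (v - u) * (v - r) `^ (z2 - 1).
  by rewrite !mulr_ge0 ?powR_ge0 // ltW.
exists (f \o Lambda u r v); split => //.
- have [tr|tr] := eqVneq (C * (t - r) `^ (- Num.max (g2 - gamma') 0)) 0.
    move: tr => /eqP; rewrite mulf_eq0 gt_eqF //= powR_eq0 => /andP[/eqP tr0 ne0].
    case: rt => [|g2E]; first by rewrite -subr_gt0 tr0 ltxx.
    have mx : Num.max (g2 - gamma') 0 = 0.
      by apply/max_idPr; have /andP[_] := z1b; have := z2b; lra.
    by move: ne0; rewrite mx oppr0 eqxx.
  apply: (Lmnorm_Lbound_lift m1 _ ge0 cf fv mL LL).
  by rewrite lt_neqAle eq_sym tr mulr_ge0 ?powR_ge0 // ltW.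
- have LZ' : Lbound P m Z (K2 * (v - u) * (v - r) `^ (z2 - 1)).
    by apply: (Lmnorm_LboundP P m1 ge0' _).1 LZ; case: cZ => /(measurable_wrt_sub uF uT).
  have LfZ : Lbound P m (f \o Z) (increment_drift t u r v).
    apply: (Lbound_map m1 cf _ fv0 LZ').
    by rewrite mulr_ge0 ?powR_ge0 // ltW.
  have [k hk fk] := linear_continuous_bound cf.
  have gg' : gamma <= gamma' by have /andP[_] := z1b; have := z2b; lra.
  have [k' hk' fk'] := linear_continuous_bound (emb_continuous (m := H) gg').
  have fk2 (y : H gamma') : `|f (emb H gamma gamma' y)| <= k * k' * `|y|.
    by apply: le_trans (fk _) _; rewrite -mulrA ler_wpM2l ?(ltW hk).
  have LfL := Lmnorm_Lbound_lift m1 (mulr_gt0 hk hk') ge0 cf fk2 mL LL.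
  exact: (cond_bound_condexp m2 (filtration_sigma uF uT) (filtration_sub uF uT)
    cf fk mL cZ LfL LfZ).
- move=> vt'; have [f' [lf' cf' _ _]] := hS v t (le_trans u0 (le_trans ur rv)) vt tT vt'.
  apply: (measurable_wrt_ae uF vT (X := f' \o delta2 S A u r v)).
    by apply: filterS eq1 => w h /=; apply: (emb_inj gg2); rewrite h lf'.
  apply: (@measurable_borel_comp _ (g_sigma_algebraType (Ft v)) _ _ f' _ cf').
  exact: measurable_wrt_delta2.
Qed.

Lemma refinement N (p r : nat -> R) t : 0 <= p 0%N -> t <= T ->
  (forall i, (i < N)%N -> p i <= r i /\ r i <= p i.+1) -> p N <= t ->
  (forall i, (i < N)%N -> r i < t \/ g2 = gamma) ->
  (forall i, (i.+1 < N)%N -> p i.+1 < t \/ g2 = gamma) ->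
  exists Y : Omega -> H g2, [/\
    {ae P, forall w, emb H gamma g2 (Y w) =
      \sum_(i < N) S gamma (p i.+1) t (A (p i) (p i.+1) w) -
      \sum_(i < N) (S gamma (r i) t (A (p i) (r i) w) +
                    S gamma (p i.+1) t (A (r i) (p i.+1) w))},
    Lbound P m Y (2 * m * (\sum_(i < N) increment_drift t (p i) (r i) (p i.+1)) +
       Num.sqrt (3 * smoothness_cst m *
         \sum_(i < N) increment_size t (p i) (r i) (p i.+1) ^+ 2)) &
    cond_bound P m (Ft (p 0%N)) Y
      (\sum_(i < N) increment_drift t (p i) (r i) (p i.+1))].
Proof.
move=> p0 tT pr pNt rt pt.
have [e he] := separable_dense_sequence H g2.
have pmono i j : (i <= j <= N)%N -> p i <= p j.
  move=> /andP[ij jN]; elim: j ij jN => [|j ih] ij jN.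
    by move: ij; rewrite leqn0 => /eqP ->.
  move: ij; rewrite leq_eqVlt => /predU1P[->//|ij].
  apply: le_trans (ih ij (ltnW jN)) _.
  by have [h1 h2] := pr _ jN; exact: le_trans h2.
have pge0 i : (i <= N)%N -> 0 <= p i.
  by move=> iN; apply: le_trans p0 _; apply: pmono.
have plet i : (i <= N)%N -> p i <= t.
  by move=> iN; apply: le_trans pNt; apply: pmono; rewrite iN leqnn.
pose Q i (Y : Omega -> H g2) := (i < N)%N -> [/\
    {ae P, forall w, emb H gamma g2 (Y w) =
       S gamma (p i.+1) t (delta2 S A (p i) (r i) (p i.+1) w)},
    Lbound P m Y (increment_size t (p i) (r i) (p i.+1)),
    cond_bound P m (Ft (p i)) Y (increment_drift t (p i) (r i) (p i.+1)) &
    p i.+1 < t \/ g2 = gamma -> measurable_wrt (Ft (p i.+1)) Y].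
have /choice[Y hY] : forall i, exists Y, Q i Y.
  move=> i; have [iN|iN] := boolP (i < N)%N; last first.
    by exists (fun=> 0) => iN'; rewrite iN' in iN.
  have [pr1 pr2] := pr i iN.
  have [Y hY] := refinement_term (pge0 i (ltnW iN)) pr1 pr2 (plet _ iN) tT (rt i iN).
  by exists Y.
exists (fun w => \sum_(i < N) Y i w); split.
- have : {ae P, forall w, forall i, (i < N)%N -> emb H gamma g2 (Y i w) =
       S gamma (p i.+1) t (delta2 S A (p i) (r i) (p i.+1) w)}.
    apply: ae_foralln => i; have [iN|iN] := boolP (i < N)%N.
      by have [h _ _ _] := hY i iN; apply: filterS h.
    by apply: nearW.
  apply: filterS => w hw; rewrite linear_sum -sumrB; apply: eq_bigr => i _.
  have iN := ltn_ord i; have [pr1 pr2] := pr i iN.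
  by rewrite hw // prop_delta2 // ?pge0 ?plet // ltnW.
- apply: (@Lbound_martingale_sum _ _ _ P m H g2 m2 N Y (fun i => Ft (p i))
    (fun i => increment_size t (p i) (r i) (p i.+1))
    (fun i => increment_drift t (p i) (r i) (p i.+1))).
  + by move=> i iN; have [] := hY i iN.
  + by move=> i iN; have [] := hY i iN.
  + move=> i k /andP[ik kN]; have iN := ltn_trans ik kN.
    have [_ _ _ h] := hY i iN; apply: (measurable_wrt_incr uF) (h _).
      split => /=; [exact: pge0|by apply: pmono; rewrite ik ltnW|].
      by apply: le_trans tT; apply: plet; exact: ltnW.
    by apply: pt; exact: leq_ltn_trans kN.
- have h i : (i < N)%N -> cond_bound P m (Ft (p 0%N)) (Y i)
      (increment_drift t (p i) (r i) (p i.+1)).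
    move=> iN; have [_ _ cY _] := hY i iN; apply: cond_bound_sub cY => X.
    apply: (measurable_wrt_incr uF); split => //=; first by apply: pmono; rewrite /= ltnW.
    by apply: le_trans tT; apply: plet; exact: ltnW.
  apply: (cond_bound_sum m2 _ (b := fun i : 'I_N => increment_size t (p i) (r i) (p i.+1))).
  + by move=> i; have [] := hY i (ltn_ord i).
  + by move=> i; exact: h.
Qed.

End target.
End refinements.

Section partition_power_sums.
Context {R : realType}.

Lemma powR_sqr (x r : R) : 0 <= x -> (x `^ r) ^+ 2 = x `^ (2 * r).
Proof. by move=> x0; rewrite -powR_mulrn ?powR_ge0 // -powRrM mulrC. Qed.

Lemma sum_powR_le N (l : nat -> R) (a h : R) : 0 <= a ->
  (forall i, (i < N)%N -> 0 <= l i <= h) ->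
  \sum_(i < N) l i `^ (1 + 2 * a) <= (\sum_(i < N) l i) `^ (1 + a) * h `^ a.
Proof.
move=> a0 lh; set D := \sum_(i < N) l i.
have D0 : 0 <= D by apply: sumr_ge0 => i _; have /andP[] := lh i (ltn_ord i).
have -> : D `^ (1 + a) * h `^ a = \sum_(i < N) l i * (D `^ a * h `^ a).
  rewrite -mulr_suml -/D mulrA; congr (_ * _).
  by rewrite powR_addr //; [rewrite powRr1|lra].
apply: ler_sum => i _; have /andP[l0 lih] := lh i (ltn_ord i).
have lD : l i <= D.
  by rewrite /D (bigD1 i) //= lerDl; apply: sumr_ge0 => j _; have /andP[] := lh j (ltn_ord j).
have -> : l i `^ (1 + 2 * a) = l i * (l i `^ a * l i `^ a).
  have -> : 1 + 2 * a = (1 + a) + a by lra.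
  by rewrite powR_addr //; [rewrite powR_addr //; [rewrite powRr1 // mulrA|lra]|lra].
by rewrite ler_wpM2l // ler_pM ?powR_ge0 // powR_le.
Qed.

End partition_power_sums.

Section refinement_control.
Context {R : realType} (T : R) (H : monotone_family R) (L : operator_family H T).
Variables (S : propagator L) (m gamma : R).
Context {d : measure_display} {Omega : measurableType d}.
Variables (P : probability Omega R) (Ft : R -> set (set Omega)).
Variable A : R -> R -> Omega -> H gamma.

Definition riemann_sum N (p : nat -> R) (t : R) (w : Omega) : H gamma :=
  \sum_(i < N) S gamma (p i.+1) t (A (p i) (p i.+1) w).

Definition refined_sum N (p r : nat -> R) (t : R) (w : Omega) : H gamma :=
  \sum_(i < N) (S gamma (r i) t (A (p i) (r i) w) +
                S gamma (p i.+1) t (A (r i) (p i.+1) w)).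

Definition refinement_control (B eps : R) : Prop := forall N p r t h,
  0 <= p 0%N -> p N <= t -> t <= T -> 0 <= h ->
  (forall i, (i < N)%N -> [/\ p i <= r i, r i <= p i.+1 & p i.+1 - p i <= h]) ->
  let Y w := riemann_sum N p t w - refined_sum N p r t w in
  Lbound P m Y (B * ((p N - p 0%N) `^ (2^-1 + eps) * h `^ eps)) /\
  cond_bound P m (Ft (p 0%N)) Y (B * ((p N - p 0%N) `^ (1 + eps) * h `^ eps)).

Lemma telescope_ord N (p : nat -> R) : \sum_(i < N) (p i.+1 - p i) = p N - p 0%N.
Proof.
rewrite -(big_mkord xpredT (fun i => p i.+1 - p i)).
by rewrite telescope_sumr.
Qed.

Lemma nondecreasing_points N (p : nat -> R) : (forall i, (i < N)%N -> p i <= p i.+1) ->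
  forall i j, (i <= j <= N)%N -> p i <= p j.
Proof.
move=> pr i j /andP[ij jN]; elim: j ij jN => [|j ih] ij jN.
  by move: ij; rewrite leqn0 => /eqP ->.
move: ij; rewrite leq_eqVlt => /predU1P[->//|ij].
exact: le_trans (ih ij (ltnW jN)) (pr _ jN).
Qed.

Hypothesis m2 : 2 <= m.
Hypothesis uF : usual_filtration P T Ft.
Hypothesis adA : forall s t, Delta2 T (s, t) -> measurable_wrt (Ft t) (A s t).

Let m1 : 1 <= m. Proof. by apply: le_trans m2; rewrite ler1n. Qed.

Let mge0 : 0 <= m. Proof. exact: le_trans ler01 m1. Qed.

Lemma measurable_wrt_prop s t (X : Omega -> H gamma) : Delta2 T (s, t) ->
  measurable_wrt (Ft s) X -> measurable_wrt (Ft t) (S gamma s t \o X).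
Proof.
move=> st mX; apply: (@measurable_borel_comp _ (g_sigma_algebraType (Ft t)) _ _ (S gamma s t)).
  exact: prop_bounded.
exact: (measurable_wrt_incr uF st mX).
Qed.

Lemma measurable_wrt_prop_A u v t : 0 <= u -> u <= v -> v <= t -> t <= T ->
  measurable_wrt (Ft t) (fun w => S gamma v t (A u v w)).
Proof.
move=> u0 uv vt tT; apply: measurable_wrt_prop.
  by split => //=; exact: le_trans uv.
by apply: adA; split => //=; exact: le_trans tT.
Qed.

Lemma measurable_wrt_riemann_sum N p t : 0 <= p 0%N -> p N <= t -> t <= T ->
  (forall i, (i < N)%N -> p i <= p i.+1) ->
  measurable_wrt (Ft t) (riemann_sum N p t).
Proof.
move=> p0 pN tT pp; have [e he] := separable_dense_sequence H gamma.
have pm := nondecreasing_points pp.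
apply: (@measurable_vec_sum _ (g_sigma_algebraType (Ft t)) _ _ e he) => i.
apply: measurable_wrt_prop_A => //.
- by apply: le_trans p0 (pm _ _ _); rewrite /= ltnW.
- exact: pp.
- by apply: le_trans pN; apply: pm; rewrite ltn_ord leqnn.
Qed.

Lemma measurable_wrt_refined_sum N p r t : 0 <= p 0%N -> p N <= t -> t <= T ->
  (forall i, (i < N)%N -> p i <= r i /\ r i <= p i.+1) ->
  measurable_wrt (Ft t) (refined_sum N p r t).
Proof.
move=> p0 pN tT pr; have [e he] := separable_dense_sequence H gamma.
have pp i : (i < N)%N -> p i <= p i.+1.
  by move=> iN; have [h1 h2] := pr i iN; exact: le_trans h2.
have pm := nondecreasing_points pp.
apply: (@measurable_vec_sum _ (g_sigma_algebraType (Ft t)) _ _ e he) => i.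
have [pr1 pr2] := pr i (ltn_ord i).
have p0i : 0 <= p i by apply: le_trans p0 (pm _ _ _); rewrite /= ltnW.
have pit : p i.+1 <= t by apply: le_trans pN; apply: pm; rewrite ltn_ord leqnn.
apply: (@measurable_vecD _ (g_sigma_algebraType (Ft t)) _ _ e he).
  by apply: measurable_wrt_prop_A => //; exact: le_trans pit.
by apply: measurable_wrt_prop_A => //; exact: le_trans pr1.
Qed.

Section from_Lambda.
Variables (z1 z2 : R) (Lambda : R -> R -> R -> Omega -> H gamma).
Variables (K1 K2 : R).
Hypotheses (T0 : 0 < T) (z1b : 2^-1 < z1 <= 1) (z2b : 1 < z2).
Hypotheses (K10 : 0 < K1) (K20 : 0 < K2).
Hypothesis hLambda : forall s r t, Delta3 T (s, r, t) ->
    [/\ measurable_wrt measurable (Lambda s r t),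
        {ae P, forall w, delta2 S A s r t w = S gamma r t (Lambda s r t w)},
        (Lmnorm P m (gamma + z2 - z1)%R (Lambda s r t) <=
          (K1 * (t - s) `^ 2^-1 * (t - r) `^ (z1 - 2^-1))%:E)%E &
        exists2 Z, condexp P (Ft s) (Lambda s r t) Z &
          (Lmnorm P m gamma Z <=
            (K2 * (t - s) * (t - r) `^ (z2 - 1))%:E)%E].

Let z1h : 2^-1 < z1. Proof. by have /andP[] := z1b. Qed.
Let z11 : z1 <= 1. Proof. by have /andP[] := z1b. Qed.

Lemma gamma_le_shift : gamma <= gamma + z2 - z1.
Proof. have := z11; have := z2b; lra. Qed.

Lemma A_diag0 u : 0 <= u <= T -> {ae P, forall w, A u u w = 0}.
Proof.
move=> /andP[u0 uT].
have [C hC] := ex_smoothing_cst S gamma_le_shift (lexx gamma).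
have [Y [Y1 LY _ _]] := refinement_term m2 z1b z2b uF adA K10 K20 hLambda (lexx gamma) hC
  u0 (lexx u) (lexx u) (lexx u) uT (or_intror erefl).
have : Lbound P m Y 0.
  apply: (Lbound_le m1 _ LY); rewrite /increment_size subrr.
  by rewrite (@powR0 _ 2^-1) ?gt_eqF // !(mulr0, mul0r).
move/(Lbound_eq0 m1); apply: filterS2 Y1 => w.
rewrite emb_id prop_id ?u0 // /delta2 prop_id ?u0 // => -> /eqP.
by rewrite subrr add0r oppr_eq0 => /eqP.
Qed.

Lemma ex_refinement_control : exists B eps, [/\ 0 <= B, 0 < eps & refinement_control B eps].
Proof.
pose eps := Num.min (z1 - 2^-1) (z2 - 1) / 2.
have eps0 : 0 < eps.
  by rewrite divr_gt0 // lt_min; apply/andP; split; have := z1h; have := z2b; lra.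
have eps1 : 2^-1 + 2 * eps <= z1.
  have : Num.min (z1 - 2^-1) (z2 - 1) <= z1 - 2^-1 by rewrite ge_min lexx.
  rewrite /eps; lra.
have eps2 : 1 + 2 * eps <= z2.
  have : Num.min (z1 - 2^-1) (z2 - 1) <= z2 - 1 by rewrite ge_min lexx orbT.
  rewrite /eps; lra.
have [C hC] := ex_smoothing_cst S gamma_le_shift (lexx gamma); have [C0 _] := hC.
pose B0 := C * (K1 * T `^ (z1 - 2^-1 - 2 * eps) + K2 * T `^ (z2 - 1 - 2 * eps)).
have B00 : 0 <= B0.
  by rewrite mulr_ge0 ?addr_ge0 ?mulr_ge0 ?powR_ge0 // ltW.
pose Cm := 3 * smoothness_cst m.
have Cm0 : 0 <= Cm by rewrite mulr_ge0 //; exact: le_trans ler01 (smoothness_cst_ge1 m2).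
pose B := 2 * m * B0 * T `^ 2^-1 + Num.sqrt Cm * B0 + B0.
have B1 : 0 <= 2 * m * B0 * T `^ 2^-1.
  by apply: mulr_ge0; [apply: mulr_ge0 => //; apply: mulr_ge0|exact: powR_ge0].
have B2 : 0 <= Num.sqrt Cm * B0 by rewrite mulr_ge0 // sqrtr_ge0.
exists B, eps; split => //; first by rewrite /B; lra.
have size_le t u r v : 0 <= u -> u <= r -> r <= v -> v <= T ->
    increment_size gamma z1 z2 K1 gamma C t u r v <= B0 * (v - u) `^ (2^-1 + 2 * eps).
  move=> u0 ur rv vT; rewrite /increment_size.
  have -> : Num.max (gamma - (gamma + z2 - z1)) 0 = 0.
    by apply/max_idPr; have := gamma_le_shift; lra.
  rewrite oppr0 powRr0 mulr1.
  have uv : 0 <= v - u by lra.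
  have h1 : (v - r) `^ (z1 - 2^-1) <= (v - u) `^ (z1 - 2^-1) by apply: powR_le; lra.
  have h2 : (v - u) `^ 2^-1 * (v - u) `^ (z1 - 2^-1) =
      (v - u) `^ (2^-1 + 2 * eps) * (v - u) `^ (z1 - 2^-1 - 2 * eps).
    rewrite -!powR_addr //; [congr (_ `^ _)|..]; lra.
  have h3 : (v - u) `^ (z1 - 2^-1 - 2 * eps) <= T `^ (z1 - 2^-1 - 2 * eps).
    by apply: powR_le; lra.
  have x0 : 0 <= (v - u) `^ (2^-1 + 2 * eps) by exact: powR_ge0.
  rewrite /B0 -!mulrA ler_wpM2l ?(ltW C0) //.
  apply: (@le_trans _ _ (K1 * ((v - u) `^ 2^-1 * (v - u) `^ (z1 - 2^-1)))).
    by rewrite ler_wpM2l ?(ltW K10) // ler_wpM2l ?powR_ge0.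
  rewrite h2 [leRHS]mulrDl; apply: ler_wpDr.
    by apply: mulr_ge0 => //; apply: mulr_ge0; [exact: ltW|exact: powR_ge0].
  by rewrite -mulrA ler_wpM2l ?(ltW K10) // mulrC ler_wpM2r.
have drift_le t u r v : 0 <= u -> u <= r -> r <= v -> v <= T ->
    increment_drift gamma z2 K2 gamma C t u r v <= B0 * (v - u) `^ (1 + 2 * eps).
  move=> u0 ur rv vT; rewrite /increment_drift subrr powRr0 mulr1.
  have uv : 0 <= v - u by lra.
  have h1 : (v - r) `^ (z2 - 1) <= (v - u) `^ (z2 - 1) by apply: powR_le; lra.
  have h2 : (v - u) * (v - u) `^ (z2 - 1) =
      (v - u) `^ (1 + 2 * eps) * (v - u) `^ (z2 - 1 - 2 * eps).
    rewrite mulr_powRB1 //; last by lra.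
    rewrite -!powR_addr //; [congr (_ `^ _)|..]; lra.
  have h3 : (v - u) `^ (z2 - 1 - 2 * eps) <= T `^ (z2 - 1 - 2 * eps).
    by apply: powR_le; lra.
  have x0 : 0 <= (v - u) `^ (1 + 2 * eps) by exact: powR_ge0.
  rewrite /B0 -!mulrA ler_wpM2l ?(ltW C0) //.
  apply: (@le_trans _ _ (K2 * ((v - u) * (v - u) `^ (z2 - 1)))).
    by rewrite ler_wpM2l ?(ltW K20) // ler_wpM2l.
  rewrite h2 [leRHS]mulrDl; apply: ler_wpDl.
    by apply: mulr_ge0 => //; apply: mulr_ge0; [exact: ltW|exact: powR_ge0].
  by rewrite -mulrA ler_wpM2l ?(ltW K20) // mulrC ler_wpM2r.
move=> N p r t h p0 pN tT h0 pr Y.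
have pr' i : (i < N)%N -> p i <= r i /\ r i <= p i.+1 by move=> iN; have [] := pr i iN.
have pp i : (i < N)%N -> p i <= p i.+1.
  by move=> iN; have [h1 h2] := pr' i iN; exact: le_trans h2.
have pm := nondecreasing_points pp.
have p0i i : (i <= N)%N -> 0 <= p i by move=> iN; apply: le_trans p0 (pm _ _ _).
have pit i : (i <= N)%N -> p i <= T.
  by move=> iN; apply: le_trans tT; apply: le_trans pN; apply: pm; rewrite iN leqnn.
have [Y' [YY' LY cY]] := refinement m2 z1b z2b uF adA K10 K20 hLambda (lexx gamma) hC
  p0 tT pr' pN (fun _ _ => or_intror erefl) (fun _ _ => or_intror erefl).
have tT' : 0 <= t <= T by rewrite tT andbT (le_trans (p0i N (leqnn N))).
have [e he] := separable_dense_sequence H gamma.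
have mY : measurable_fun setT (Y : Omega -> borel (H gamma)).
  apply: (measurable_vecB he); apply: (measurable_wrt_sub uF tT').
    exact: measurable_wrt_riemann_sum.
  exact: measurable_wrt_refined_sum.
have YE : {ae P, forall w, Y' w = Y w}.
  by apply: filterS YY' => w; rewrite emb_id.
have [mY' _ _] := LY.
pose l i := p i.+1 - p i.
have lE : \sum_(i < N) l i = p N - p 0%N by exact: telescope_ord.
have lh i : (i < N)%N -> 0 <= l i <= h.
  by move=> iN; rewrite subr_ge0 pp //=; have [] := pr i iN.
set D := p N - p 0%N in lE *.
have D0 : 0 <= D by rewrite subr_ge0 pm // leqnn.
have DT : D <= T by have := pit N (leqnn N); rewrite /D; lra.
have drift_sum : \sum_(i < N) increment_drift gamma z2 K2 gamma C t (p i) (r i) (p i.+1)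
    <= B0 * (D `^ (1 + eps) * h `^ eps).
  apply: (@le_trans _ _ (\sum_(i < N) B0 * l i `^ (1 + 2 * eps))).
    apply: ler_sum => i _; have [h1 h2] := pr' i (ltn_ord i).
    by apply: drift_le => //; [apply: p0i; exact: ltnW|exact: pit].
  rewrite -mulr_sumr ler_wpM2l // -lE; apply: sum_powR_le => //; exact: ltW.
have size_sum : \sum_(i < N) increment_size gamma z1 z2 K1 gamma C t (p i) (r i) (p i.+1) ^+ 2
    <= (B0 * (D `^ (2^-1 + eps) * h `^ eps)) ^+ 2.
  apply: (@le_trans _ _ (\sum_(i < N) B0 ^+ 2 * l i `^ (1 + 2 * (2 * eps)))).
    apply: ler_sum => i _; have [h1 h2] := pr' i (ltn_ord i).
    have iN := ltn_ord i.
    have -> : B0 ^+ 2 * l i `^ (1 + 2 * (2 * eps)) = (B0 * l i `^ (2^-1 + 2 * eps)) ^+ 2.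
      rewrite [RHS]exprMn powR_sqr; last by have /andP[] := lh i iN.
      by congr (_ * _ `^ _); lra.
    rewrite ler_pXn2r ?nnegrE //.
    - by apply: size_le => //; [apply: p0i; exact: ltnW|exact: pit].
    - by rewrite /increment_size !mulr_ge0 ?powR_ge0 // ltW.
    - by rewrite mulr_ge0 ?powR_ge0.
  rewrite -mulr_sumr [leRHS]exprMn ler_wpM2l ?sqr_ge0 // [leRHS]exprMn !powR_sqr //.
  have -> : 2 * (2^-1 + eps) = 1 + 2 * eps by lra.
  by rewrite -lE; apply: sum_powR_le => //; rewrite mulr_ge0 // ltW.
have De0 : 0 <= D `^ (2^-1 + eps) * h `^ eps by rewrite mulr_ge0 ?powR_ge0.
have De1 : 0 <= D `^ (1 + eps) * h `^ eps by rewrite mulr_ge0 ?powR_ge0.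
split; last first.
  apply: (cond_bound_ae (m := m) mY' mY YE); apply: cond_bound_le cY.
  by apply: le_trans drift_sum _; rewrite ler_wpM2r // /B; lra.
apply: (Lbound_ae m1 mY YE); apply: (Lbound_le m1 _ LY).
have DD : D `^ (1 + eps) <= T `^ 2^-1 * D `^ (2^-1 + eps).
  have -> : 1 + eps = 2^-1 + (2^-1 + eps) by lra.
  rewrite powR_addr //; last by lra.
  by rewrite ler_wpM2r ?powR_ge0 // powR_le.
have mm0 : 0 <= 2 * m by rewrite mulr_ge0.
apply: (@le_trans _ _ (2 * m * B0 * T `^ 2^-1 * (D `^ (2^-1 + eps) * h `^ eps) +
    Num.sqrt Cm * B0 * (D `^ (2^-1 + eps) * h `^ eps))).
  apply: lerD.
    rewrite -!(mulrA (2 * m)) ler_wpM2l //; apply: le_trans drift_sum _.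
    apply: (@le_trans _ _ (B0 * (T `^ 2^-1 * D `^ (2^-1 + eps) * h `^ eps))).
      by rewrite ler_wpM2l // ler_wpM2r ?powR_ge0.
    by rewrite !mulrA.
  apply: (@le_trans _ _ (Num.sqrt (Cm * (B0 * (D `^ (2^-1 + eps) * h `^ eps)) ^+ 2))).
    by rewrite ler_wsqrtr // ler_wpM2l.
  by rewrite sqrtrM // sqrtr_sqr ger0_norm; [rewrite !mulrA|apply: mulr_ge0].
by rewrite -mulrDl ler_wpM2r // /B; lra.
Qed.

End from_Lambda.
End refinement_control.

(** * The sewing process *)

Section clamp.
Context {R : realType}.
Implicit Types s t x y : R.

Definition clamp s t x : R := Num.min (Num.max s x) t.

Lemma clamp_ge s t x : s <= t -> s <= clamp s t x.
Proof. by move=> st; rewrite /clamp le_min le_max lexx st. Qed.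

Lemma clamp_le s t x : clamp s t x <= t.
Proof. by rewrite /clamp ge_min lexx orbT. Qed.

Lemma clamp_bot s t x : s <= t -> x <= s -> clamp s t x = s.
Proof. by move=> st xs; rewrite /clamp (max_idPl xs); apply/min_idPl. Qed.

Lemma clamp_top s t x : t <= x -> clamp s t x = t.
Proof. by move=> tx; apply/min_idPr; rewrite le_max tx orbT. Qed.

Lemma clamp_mid s t x : s <= x -> x <= t -> clamp s t x = x.
Proof. by move=> sx xt; rewrite /clamp (max_idPr sx); apply/min_idPl. Qed.

Lemma clamp_homo s t x y : x <= y -> clamp s t x <= clamp s t y.
Proof.
move=> xy; rewrite /clamp /Order.min /Order.max.
by do ! case: ifPn => //; rewrite -?leNgt => *; lra.
Qed.

Lemma clamp_contract s t x y : x <= y -> clamp s t y - clamp s t x <= y - x.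
Proof.
move=> xy; rewrite /clamp /Order.min /Order.max.
by do ! case: ifPn => //; rewrite -?leNgt => *; lra.
Qed.

End clamp.

Section dyadic_grid.
Context {R : realType} (T : R).
Hypothesis T0 : 0 < T.

Definition grid n i : R := T * (i%:R / 2 ^+ n).

Lemma grid0 n : grid n 0 = 0. Proof. by rewrite /grid mul0r mulr0. Qed.

Lemma grid_last n : grid n (2 ^ n) = T.
Proof. by rewrite /grid natrX mulfV ?mulr1 // expf_neq0. Qed.

Lemma grid_step n i : grid n i.+1 - grid n i = T / 2 ^+ n.
Proof.
rewrite /grid -natr1; field.
by rewrite expf_neq0.
Qed.

Lemma grid_double n i : grid n.+1 i.*2 = grid n i.
Proof.
rewrite /grid -mul2n natrM exprS; field.
by rewrite expf_neq0.
Qed.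

Lemma grid_le n i : grid n i <= grid n i.+1.
Proof. by rewrite -subr_ge0 grid_step divr_ge0 ?(ltW T0) // exprn_ge0. Qed.

Lemma grid_ge0 n i : 0 <= grid n i.
Proof. by rewrite /grid mulr_ge0 ?(ltW T0) // divr_ge0 // exprn_ge0. Qed.

Lemma sum_double (V : zmodType) (f : nat -> V) N :
  \sum_(i < N.*2) f i = \sum_(i < N) (f i.*2 + f i.*2.+1).
Proof.
elim: N => [|N ih]; first by rewrite !big_ord0.
by rewrite doubleS !big_ord_recr /= ih addrA.
Qed.

Lemma expn2S n : (2 ^ n.+1 = (2 ^ n).*2)%N.
Proof. by rewrite expnS mul2n. Qed.

End dyadic_grid.

Lemma ex_geometric_le (R : realType) (K rho e : R) : 0 <= rho < 1 -> 0 < e ->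
  exists n : nat, K * rho ^+ n <= e.
Proof.
move=> /andP[r0 r1] e0.
have : geometric K rho n @[n --> \oo] --> (0 : R) by apply: cvg_geometric; rewrite ger0_norm.
move=> /cvgrPdist_le/(_ _ e0)[n _ hn]; exists n.
have := hn n (leqnn n); rewrite /= sub0r normrN; apply: le_trans; exact: ler_norm.
Qed.

Lemma additivity_error_eq (V : zmodType) (a a' b b' c c' : V) :
  a - a' + (b - b') - (c - c' - (c - (a + b))) = c' - (a' + b').
Proof.
rewrite addrACA -opprD; move: (a + b) (a' + b') => x y.
have -> : c - c' - (c - x) = x - c'.
  by rewrite [LHS]addrC opprB [LHS]addrA subrK.
by rewrite opprB [LHS]addrC [LHS]addrA subrK.
Qed.

Section sewing_process.
Context {R : realType} (T : R) (H : monotone_family R) (L : operator_family H T).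
Variables (S : propagator L) (m gamma : R).
Context {d : measure_display} {Omega : measurableType d}.
Variables (P : probability Omega R) (Ft : R -> set (set Omega)).
Variable A : R -> R -> Omega -> H gamma.
Hypotheses (T0 : 0 < T) (m2 : 2 <= m) (uF : usual_filtration P T Ft).
Hypothesis adA : forall s t, Delta2 T (s, t) -> measurable_wrt (Ft t) (A s t).
Hypothesis A0 : forall u, 0 <= u <= T -> {ae P, forall w, A u u w = 0}.
Variables (B eps : R).
Hypotheses (B0 : 0 <= B) (eps0 : 0 < eps).
Hypothesis rc : refinement_control S m P Ft A B eps.
Local Notation E := (H gamma).
Local Notation riemann := (riemann_sum S A).

Let m1 : 1 <= m. Proof. by apply: le_trans m2; rewrite ler1n. Qed.

Definition grid_trace n s t i : R := clamp s t (grid T n i).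

Lemma grid_trace0 n s t : 0 <= s -> s <= t -> grid_trace n s t 0 = s.
Proof. by move=> s0 st; rewrite /grid_trace grid0 clamp_bot. Qed.

Lemma grid_trace_last n s t : t <= T -> grid_trace n s t (2 ^ n) = t.
Proof. by move=> tT; rewrite /grid_trace grid_last clamp_top. Qed.

Lemma grid_trace_le n s t i : grid_trace n s t i <= grid_trace n s t i.+1.
Proof. exact/clamp_homo/grid_le. Qed.

Lemma grid_trace_step n s t i : grid_trace n s t i.+1 - grid_trace n s t i <= T / 2 ^+ n.
Proof. by rewrite -(grid_step T n i); exact/clamp_contract/grid_le. Qed.

Lemma grid_trace_double n s t i : grid_trace n.+1 s t i.*2 = grid_trace n s t i.
Proof. by rewrite /grid_trace grid_double. Qed.

Lemma measurable_wrt_riemann_pt n s t t' : 0 <= s -> s <= t -> t <= t' -> t' <= T ->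
  measurable_wrt (Ft t') (riemann (2 ^ n) (grid_trace n s t) t').
Proof.
move=> s0 st tt' tT; apply: (measurable_wrt_riemann_sum S uF adA) => //.
- by rewrite grid_trace0.
- by rewrite grid_trace_last // (le_trans tt').
- by move=> i _; exact: grid_trace_le.
Qed.

Lemma prop_riemann_sum N p t t' w : 0 <= p 0%N -> p N <= t -> t <= t' -> t' <= T ->
  (forall i, (i < N)%N -> p i <= p i.+1) ->
  S gamma t t' (riemann N p t w) = riemann N p t' w.
Proof.
move=> p0 pN tt' tT pp; have pm := nondecreasing_points pp.
rewrite /riemann_sum linear_sum; apply: eq_bigr => i _.
have iN := ltn_ord i; rewrite prop_comp //; split => //=.
- by apply: le_trans p0 (pm _ _ _).
- by apply: le_trans pN; apply: pm; rewrite iN leqnn.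
Qed.

Lemma riemann_pt_refine n s t t' :
  riemann (2 ^ n.+1) (grid_trace n.+1 s t) t' =
  refined_sum S A (2 ^ n) (grid_trace n s t) (fun i => grid_trace n.+1 s t i.*2.+1) t'.
Proof.
apply/funext => w; rewrite /riemann_sum /refined_sum expn2S.
rewrite (sum_double (fun j => S gamma (grid_trace n.+1 s t j.+1) t'
  (A (grid_trace n.+1 s t j) (grid_trace n.+1 s t j.+1) w))).
apply: eq_bigr => i _; rewrite -doubleS !grid_trace_double.
by [].
Qed.

Let rho : R := 2^-1 `^ eps.

Let rho01 : 0 <= rho < 1.
Proof.
rewrite powR_ge0 /=; have : rho < 1 `^ eps by rewrite gt0_ltr_powR ?nnegrE //; lra.
by rewrite powR1.
Qed.

Let step_powR n : (T / 2 ^+ n) `^ eps = T `^ eps * rho ^+ n.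
Proof.
rewrite powRM ?(ltW T0) ?invr_ge0 ?exprn_ge0 //; congr (_ * _).
by rewrite -exprVn powR_exprn.
Qed.

Lemma riemann_pt_step n s t t' : 0 <= s -> s <= t -> t <= t' -> t' <= T ->
  let Y w := riemann (2 ^ n) (grid_trace n s t) t' w -
    riemann (2 ^ n.+1) (grid_trace n.+1 s t) t' w in
  Lbound P m Y (B * T `^ eps * (t - s) `^ (2^-1 + eps) * rho ^+ n) /\
  cond_bound P m (Ft s) Y (B * T `^ eps * (t - s) `^ (1 + eps) * rho ^+ n).
Proof.
move=> s0 st tt' tT Y; have tT' := le_trans tt' tT.
have [|||||hL hc] := rc (N := (2 ^ n)%N) (p := grid_trace n s t)
  (r := fun i => grid_trace n.+1 s t i.*2.+1)
  (t := t') (h := T / 2 ^+ n).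
- by rewrite grid_trace0.
- by rewrite grid_trace_last.
- by [].
- by rewrite divr_ge0 ?(ltW T0) // exprn_ge0.
- move=> i _; rewrite -!(grid_trace_double n) doubleS !grid_trace_le -doubleS.
  by rewrite !grid_trace_double grid_trace_step.
rewrite /Y riemann_pt_refine.
move: hL hc; rewrite grid_trace_last // grid_trace0 // step_powR => hL hc.
by split; [move: hL|move: hc]; congr (_ _ _); ring.
Qed.

(* A single grid of [0, T] serves all the intervals [s, t], which makes the limits
   additive (sewn_additive). *)
Definition sewn s t : Omega -> E := plim (fun n => riemann (2 ^ n) (grid_trace n s t) t).

Definition sewing_process t : Omega -> E := sewn 0 t.

Let B1 : R := B * T `^ eps / (1 - rho).

Let B10 : 0 <= B1.
Proof.
have /andP[_ r1] := rho01.
by rewrite /B1 divr_ge0 ?mulr_ge0 ?powR_ge0 // subr_ge0 ltW.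
Qed.

Lemma measurable_riemann_pt n s t : 0 <= s -> s <= t -> t <= T ->
  measurable_fun setT (riemann (2 ^ n) (grid_trace n s t) t : Omega -> borel E).
Proof.
move=> s0 st tT; apply: (measurable_wrt_sub (t := t) uF).
  by rewrite tT (le_trans s0).
exact: measurable_wrt_riemann_pt.
Qed.

Lemma sewn_approx s t k : 0 <= s -> s <= t -> t <= T ->
  Lbound P m (fun w => riemann (2 ^ k) (grid_trace k s t) t w - sewn s t w)
    (B1 * (t - s) `^ (2^-1 + eps) * rho ^+ k).
Proof.
move=> s0 st tT; have [e he] := separable_dense_sequence H gamma.
have := @Lbound_series _ _ _ P m m1 E e he (fun n => riemann (2 ^ n) (grid_trace n s t) t)
  (B * T `^ eps * (t - s) `^ (2^-1 + eps)) rho.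
case.
- by move=> n; exact: measurable_riemann_pt.
- by rewrite !mulr_ge0 ?powR_ge0.
- exact: rho01.
- move=> n; have [hL _] := riemann_pt_step n s0 st (lexx t) tT.
  have := LboundN m1 hL; congr (Lbound _ _ _ _).
  by apply/funext => w; rewrite opprB.
move=> _ /(_ k) /(LboundN m1); congr (Lbound _ _ _ _).
  by apply/funext => w; rewrite opprB.
by rewrite /B1; ring.
Qed.

Lemma measurable_sewn s t : 0 <= s -> s <= t -> t <= T -> measurable_wrt (Ft t) (sewn s t).
Proof.
move=> s0 st tT; have [e he] := separable_dense_sequence H gamma.
apply: (@measurable_plim _ (g_sigma_algebraType (Ft t)) _ _ e he) => n.
exact: measurable_wrt_riemann_pt.
Qed.

Lemma riemann_pt0 s t t' w : 0 <= s -> s <= t -> t <= T ->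
  riemann (2 ^ 0) (grid_trace 0 s t) t' w = S gamma t t' (A s t w).
Proof.
move=> s0 st tT; rewrite /riemann_sum expn0 big_ord1 grid_trace0 //.
by rewrite -[1%N](expn0 2) grid_trace_last.
Qed.

Lemma sewn_error s t : 0 <= s -> s <= t -> t <= T ->
  Lbound P m (fun w => A s t w - sewn s t w) (B1 * (t - s) `^ (2^-1 + eps)).
Proof.
move=> s0 st tT; have := sewn_approx 0 s0 st tT; rewrite mulr1.
congr (Lbound _ _ _ _); apply/funext => w.
by rewrite riemann_pt0 // prop_id // tT (le_trans s0).
Qed.

Lemma sewn_cond_error s t t' : 0 <= s -> s <= t -> t <= t' -> t' <= T ->
  cond_bound P m (Ft s) (fun w => S gamma t t' (A s t w - sewn s t w))
    (B1 * (t - s) `^ (1 + eps)).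
Proof.
move=> s0 st tt' t'T; have tT := le_trans tt' t'T.
have [e he] := separable_dense_sequence H gamma.
have [C C0 hC] := propagator_bound S gamma.
have D2 : Delta2 T (t, t') by split => //=; exact: le_trans st.
have /andP[r0 r1] := rho01.
have x0 : 0 <= (t - s) `^ (1 + eps) by exact: powR_ge0.
apply: cond_bound_inf => [|del del0]; first exact: mulr_ge0.
have [n hn] := ex_geometric_le (C * (B1 * (t - s) `^ (2^-1 + eps))) rho01 del0.
pose Y k w := riemann (2 ^ k) (grid_trace k s t) t' w -
  riemann (2 ^ k.+1) (grid_trace k.+1 s t) t' w.
have hY k := riemann_pt_step k s0 st tt' t'T.
pose Z w := S gamma t t' (riemann (2 ^ n) (grid_trace n s t) t w - sewn s t w).
have LZ : Lbound P m Z (C * (B1 * (t - s) `^ (2^-1 + eps) * rho ^+ n)).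
  exact: (Lbound_map m1 (prop_bounded D2) (ltW C0) (fun u => hC t t' u D2)
    (sewn_approx n s0 st tT)).
have cY := cond_bound_sum m2 (index_enum 'I_n) (Y := fun i : 'I_n => Y i)
  (fun i => (hY i).1) (fun i => (hY i).2).
have LY := Lbound_sum m1 he (index_enum 'I_n) (X := fun i : 'I_n => Y i)
  (fun i => (hY i).1).
have := cond_boundD m2 LY LZ cY (Lbound_cond_bound m2 (Ft s) LZ).
rewrite (_ : (fun w => _ + _) = (fun w => S gamma t t' (A s t w - sewn s t w))).
  apply: cond_bound_le; apply: lerD.
    rewrite -mulr_sumr; apply: le_trans (ler_wpM2l _ (geometric_sum_le n rho01)) _.
      by rewrite !mulr_ge0 ?powR_ge0.
    rewrite /B1 le_eqVlt; apply/orP; left; apply/eqP; ring.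
  by apply: le_trans hn; rewrite !mulrA.
apply/funext => w; rewrite /Z /Y.
rewrite -(big_mkord xpredT (fun k => riemann (2 ^ k) (grid_trace k s t) t' w -
  riemann (2 ^ k.+1) (grid_trace k.+1 s t) t' w)).
rewrite (@telescope_sumr_eq _ 0 n
  (fun k => - riemann (2 ^ k) (grid_trace k s t) t' w)) //; last first.
  by move=> k _; rewrite opprK addrC.
rewrite opprK riemann_pt0 // linearB /= (prop_riemann_sum _ (p := grid_trace n s t)).
- by rewrite [- _ + _]addrC addrA subrK -linearB.
- by rewrite grid_trace0.
- by rewrite grid_trace_last.
- by [].
- by [].
- by move=> i _; exact: grid_trace_le.
Qed.

Lemma riemann_pt_split n s t : 0 <= s -> s <= t -> t <= T ->
  {ae P, forall w,
    refined_sum S A (2 ^ n) (grid_trace n 0 t)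
      (fun i => clamp (grid_trace n 0 t i) (grid_trace n 0 t i.+1) s) t w =
    S gamma s t (riemann (2 ^ n) (grid_trace n 0 s) s w) + riemann (2 ^ n) (grid_trace n s t) t w}.
Proof.
move=> s0 st tT; have t0 := le_trans s0 st; have sT := le_trans st tT.
have sT' : 0 <= s <= T by rewrite s0.
have ptT i : 0 <= grid_trace n 0 t i <= T.
  by rewrite clamp_ge //= (le_trans (clamp_le _ _ _)).
have : {ae P, forall w i, A (grid_trace n 0 t i) (grid_trace n 0 t i) w = 0}.
  by apply: ae_foralln => i; exact: A0.
apply: filterS2 (A0 sT') => w Ass Apt.
have clampE y : s <= y -> clamp 0 t y = clamp s t y.
  by move=> sy; rewrite /clamp (max_idPr sy) (max_idPr (le_trans s0 sy)).
rewrite /refined_sum /riemann_sum linear_sum -big_split /=; apply: eq_bigr => i _.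
have := ptT i; have := ptT i.+1; have := Apt i; have := Apt i.+1; rewrite /grid_trace.
have y0 := grid_ge0 T0 n i; have yy' := grid_le T0 n i.
move: y0 yy'; set y := grid T n i; set y' := grid T n i.+1 => y0 yy'.
have pp' := @clamp_homo _ 0 t _ _ yy'.
have y'0 := le_trans y0 yy'.
set p := clamp 0 t y; set p' := clamp 0 t y' => Ap' Ap /andP[p'0 p'T] /andP[p0 pT].
rewrite -/p -/p' in pp'.
congr (_ + _).
  have [ys|ys] := leP y s.
    have pE : p = y by rewrite /p clamp_mid // (le_trans ys).
    have qE : clamp 0 s y = y by rewrite clamp_mid.
    have rE : clamp p p' s = clamp 0 s y'.
      have [y's|y's] := leP y' s.
        have p'E : p' = y' by rewrite /p' clamp_mid // (le_trans y's).
        by rewrite pE p'E clamp_top // clamp_mid.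
      rewrite (clamp_top _ (x := y')) ?(ltW y's) // clamp_mid // ?pE //.
      by rewrite /p' clampE ?(ltW y's) // clamp_ge.
    rewrite rE pE qE prop_comp //; split => //=; [exact: clamp_ge|exact: clamp_le].
  have sy' := le_trans (ltW ys) yy'.
  rewrite (clamp_top _ (x := y)) ?(ltW ys) // (clamp_top _ (x := y')) // Ass !linear0.
  have sp : s <= p by rewrite /p clampE ?(ltW ys) // clamp_ge.
  by rewrite clamp_bot // Ap linear0.
have [y's|sy'] := ltP y' s.
  have ys := le_trans yy' (ltW y's).
  rewrite (clamp_bot st ys) (clamp_bot st (ltW y's)) Ass linear0.
  have p'E : p' = y' by rewrite /p' clamp_mid // (le_trans (ltW y's)).
  by rewrite clamp_top ?Ap' ?linear0 // p'E ltW.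
rewrite -(clampE _ sy') -/p'; congr (S gamma _ _ (A _ _ _)).
have [sy|ys] := leP s y.
  rewrite -(clampE _ sy) -/p clamp_bot //.
  by rewrite /p clampE // clamp_ge.
have pE : p = y by rewrite /p clamp_mid // (le_trans (ltW ys)).
rewrite (clamp_bot st (ltW ys)) clamp_mid // ?pE ?(ltW ys) //.
by rewrite /p' clampE // clamp_ge.
Qed.

Lemma sewn_additive s t : 0 <= s -> s <= t -> t <= T ->
  {ae P, forall w, sewn 0 t w = S gamma s t (sewn 0 s w) + sewn s t w}.
Proof.
move=> s0 st tT; have t0 := le_trans s0 st; have sT := le_trans st tT.
have [e he] := separable_dense_sequence H gamma.
have [C C0 hC] := propagator_bound S gamma.
have D2 : Delta2 T (s, t) by [].
pose K := C * (B1 * (s - 0) `^ (2^-1 + eps)) + B1 * (t - s) `^ (2^-1 + eps) +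
   (B1 * (t - 0) `^ (2^-1 + eps) + B * ((t - 0) `^ (2^-1 + eps) * T `^ eps)).
apply: (Lbound_ae_eq m1) => del del0.
have [n hn] := ex_geometric_le K rho01 del0.
apply: (Lbound_le m1 hn).
have [|||||hL _] := rc (N := (2 ^ n)%N) (p := grid_trace n 0 t)
  (r := fun i => clamp (grid_trace n 0 t i) (grid_trace n 0 t i.+1) s) (t := t) (h := T / 2 ^+ n).
- by rewrite grid_trace0.
- by rewrite grid_trace_last.
- by [].
- by rewrite divr_ge0 ?(ltW T0) // exprn_ge0.
- by move=> i _; rewrite clamp_ge ?clamp_le ?grid_trace_step // grid_trace_le.
rewrite grid_trace_last // grid_trace0 // step_powR in hL.
have L1 := Lbound_map m1 (prop_bounded D2) (ltW C0) (fun u => hC s t u D2)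
  (sewn_approx n (lexx 0) s0 sT).
have L2 := sewn_approx n s0 st tT.
have L3 := sewn_approx n (lexx 0) t0 tT.
have := LboundB m1 he (LboundD m1 he L1 L2) (LboundB m1 he L3 hL).
have -> : K * rho ^+ n = C * (B1 * (s - 0) `^ (2^-1 + eps) * rho ^+ n) +
    B1 * (t - s) `^ (2^-1 + eps) * rho ^+ n +
    (B1 * (t - 0) `^ (2^-1 + eps) * rho ^+ n +
     B * ((t - 0) `^ (2^-1 + eps) * (T `^ eps * rho ^+ n))) by rewrite /K; ring.
have mS u v : 0 <= u -> u <= v -> v <= T -> measurable_fun setT (sewn u v : Omega -> borel E).
  move=> u0 uv vT; apply: (measurable_wrt_sub (t := v) uF); first by rewrite vT (le_trans u0).
  exact: measurable_sewn.
apply: (Lbound_ae m1).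
  apply: (measurable_vecB he); first exact: mS.
  apply: (measurable_vecD he); last exact: mS.
  apply: (measurable_borel_comp (f := S gamma s t)); first exact: prop_bounded D2.
  exact: mS.
apply: filterS (riemann_pt_split n s0 st tT) => w hw /=.
rewrite hw linearB /=.
exact: additivity_error_eq.
Qed.

Lemma delta1_sewing_process s t : 0 <= s -> s <= t -> t <= T ->
  {ae P, forall w, delta1 S sewing_process s t w = sewn s t w}.
Proof.
move=> s0 st tT; apply: filterS (sewn_additive s0 st tT) => w.
by rewrite /delta1 /sewing_process => ->; rewrite addrC addKr.
Qed.

Lemma sewing_process_adapted t : 0 <= t <= T -> measurable_wrt (Ft t) (sewing_process t).
Proof. by move=> /andP[t0 tT]; exact: measurable_sewn. Qed.

Lemma sewing_process0 : {ae P, forall w, sewing_process 0 w = 0}.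
Proof.
have T00 : 0 <= (0 : R) <= T by rewrite lexx ltW.
have := sewn_error (lexx 0) (lexx 0) (ltW T0).
rewrite subrr powR0; last by rewrite gt_eqF // addr_gt0.
rewrite mulr0 => /(Lbound_eq0 m1); apply: filterS2 (A0 T00) => w ->.
by rewrite sub0r => /eqP; rewrite oppr_eq0 => /eqP.
Qed.

Lemma measurable_delta1 (Y : R -> Omega -> E) s t : Delta2 T (s, t) ->
  (forall t, 0 <= t <= T -> measurable_wrt (Ft t) (Y t)) ->
  measurable_wrt (Ft t) (delta1 S Y s t).
Proof.
move=> [/= s0 st tT] mY; have [e he] := separable_dense_sequence H gamma.
apply: (@measurable_vecB _ (g_sigma_algebraType (Ft t)) _ _ e he).
  by apply: mY; rewrite tT (le_trans s0).
apply: (measurable_wrt_prop S uF) => //.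
by apply: mY; rewrite s0 (le_trans st).
Qed.

Lemma measurable_sewing_error s t : Delta2 T (s, t) ->
  measurable_wrt (Ft t) (fun w => A s t w - delta1 S sewing_process s t w).
Proof.
move=> D2; have [e he] := separable_dense_sequence H gamma.
apply: (@measurable_vecB _ (g_sigma_algebraType (Ft t)) _ _ e he); first exact: adA.
by apply: measurable_delta1 => // r; exact: sewing_process_adapted.
Qed.

Lemma sewing_process_error : exists B' : R, [/\ 0 <= B',
  forall s t, 0 <= s -> s <= t -> t <= T ->
    Lbound P m (fun w => A s t w - delta1 S sewing_process s t w)
      (B' * (t - s) `^ (2^-1 + eps)) &
  forall s t t', 0 <= s -> s <= t -> t <= t' -> t' <= T ->
    cond_bound P m (Ft s)
      (fun w => S gamma t t' (A s t w - delta1 S sewing_process s t w))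
      (B' * (t - s) `^ (1 + eps))].
Proof.
exists B1; split => // [s t s0 st tT|s t t' s0 st tt' t'T].
  have tT' : 0 <= t <= T by rewrite tT (le_trans s0).
  apply: (Lbound_ae m1) (sewn_error s0 st tT).
    by apply: (measurable_wrt_sub uF tT'); exact: measurable_sewing_error.
  by apply: filterS (delta1_sewing_process s0 st tT) => w ->.
have tT := le_trans tt' t'T.
have t'T' : 0 <= t' <= T by rewrite t'T (le_trans s0 (le_trans st tt')).
have D2 : Delta2 T (t, t') by split => //=; exact: le_trans st.
apply: cond_bound_ae (sewn_cond_error s0 st tt' t'T).
- apply: (measurable_wrt_sub uF t'T'); apply: (measurable_wrt_prop S uF D2).
  have [e he] := separable_dense_sequence H gamma.
  apply: (@measurable_vecB _ (g_sigma_algebraType (Ft t)) _ _ e he); first exact: adA.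
  exact: measurable_sewn.
- apply: (measurable_wrt_sub uF t'T'); apply: (measurable_wrt_prop S uF D2).
  exact: measurable_sewing_error.
by apply: filterS (delta1_sewing_process s0 st tT) => w ->.
Qed.

End sewing_process.

(** * Limits along partitions *)

Section partition_lists.
Context {R : realType}.
Implicit Types (s t : R) (pi : seq R).

Definition points s pi (i : nat) : R := nth 0 (s :: pi) i.

Lemma points_last s t pi : itv_partition s t pi -> points s pi (size pi) = t.
Proof. by case=> _ /eqP <-; rewrite /points nth_last /=; case: pi => //=. Qed.

Lemma points_lt s t pi i : itv_partition s t pi -> (i < size pi)%N ->
  points s pi i < points s pi i.+1.
Proof. by case=> /pathP h _ ipi; exact: h. Qed.

Lemma big_intervals (V : nmodType) s pi (F : R * R -> V) :
  \sum_(p <- intervals s pi) F p =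
  \sum_(i < size pi) F (points s pi i, points s pi i.+1).
Proof.
have sz : size (intervals s pi) = size pi.
  by rewrite /intervals size_zip /= (minn_idPr (leqnSn _)).
rewrite (big_nth (0, 0)) sz big_mkord; apply: eq_bigr => i _.
by rewrite /intervals nth_zip_cond -/(intervals s pi) sz ltn_ord.
Qed.

Lemma points_mesh s pi i : (i < size pi)%N ->
  points s pi i.+1 - points s pi i <= mesh s pi.
Proof.
move=> ipi; rewrite /mesh.
have sz : size (intervals s pi) = size pi.
  by rewrite /intervals size_zip /= (minn_idPr (leqnSn _)).
have : (points s pi i, points s pi i.+1) \in intervals s pi.
  apply/(nthP (0, 0)); exists i; first by rewrite sz.
  by rewrite /intervals nth_zip_cond -/(intervals s pi) sz ipi.
move=> h; exact: (le_bigmax_seq 0 (points s pi i, points s pi i.+1) xpredT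
  (fun p : R * R => p.2 - p.1) h isT).
Qed.

Lemma mesh_le s pi h : 0 <= h ->
  (forall i, (i < size pi)%N -> points s pi i.+1 - points s pi i <= h) -> mesh s pi <= h.
Proof.
move=> h0 hpi; rewrite /mesh big_seq_cond; apply: bigmax_le => // p /andP[pin _].
have sz : size (intervals s pi) = size pi.
  by rewrite /intervals size_zip /= (minn_idPr (leqnSn _)).
move: pin => /(nthP (0, 0))[i]; rewrite sz => ipi <-.
by rewrite /intervals nth_zip_cond -/(intervals s pi) sz ipi; exact: hpi.
Qed.

Definition local_grid n s t i : R := s + (t - s) * (i%:R / 2 ^+ n).

Lemma local_grid0 n s t : local_grid n s t 0 = s.
Proof. by rewrite /local_grid mul0r mulr0 addr0. Qed.

Lemma local_grid_last n s t : local_grid n s t (2 ^ n) = t.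
Proof. by rewrite /local_grid natrX mulfV ?expf_neq0 // mulr1 subrKC. Qed.

Lemma local_grid_step n s t i :
  local_grid n s t i.+1 - local_grid n s t i = (t - s) / 2 ^+ n.
Proof. by rewrite /local_grid -natr1; field; rewrite expf_neq0. Qed.

Lemma local_grid_double n s t i : local_grid n.+1 s t i.*2 = local_grid n s t i.
Proof.
by rewrite /local_grid -mul2n natrM exprS; field; rewrite expf_neq0.
Qed.

Definition local_partition n s t : seq R :=
  mkseq (fun i => local_grid n s t i.+1) (2 ^ n).

Lemma points_local_partition n s t i : (i <= 2 ^ n)%N ->
  points s (local_partition n s t) i = local_grid n s t i.
Proof.
case: i => [|i] ni; first by rewrite local_grid0.
by rewrite /points /= nth_mkseq.
Qed.

Lemma local_partitionP n s t : s < t -> itv_partition s t (local_partition n s t).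
Proof.
move=> st; have N0 : (0 < 2 ^ n)%N by rewrite expn_gt0.
have sz : size (local_partition n s t) = (2 ^ n)%N by rewrite size_mkseq.
split.
  apply/(pathP 0) => i; rewrite sz => ni.
  have := points_local_partition s t (ltnW ni); have := points_local_partition s t ni.
  rewrite /points /= => -> ->.
  by rewrite -subr_gt0 local_grid_step divr_gt0 ?subr_gt0 // exprn_gt0.
have := points_local_partition s t (leqnn (2 ^ n)).
rewrite local_grid_last /points -[X in nth _ _ X]sz nth_last /=.
case: (local_partition n s t) sz => [/esym/eqP|x l _ /= -> //].
by rewrite expn_eq0.
Qed.

Lemma local_partition_mesh n s t : s <= t ->
  mesh s (local_partition n s t) <= (t - s) / 2 ^+ n.
Proof.
move=> st; apply: mesh_le => [|i]; first by rewrite divr_ge0 ?subr_ge0 // exprn_ge0.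
rewrite size_mkseq => ni.
by rewrite !points_local_partition // ?(ltnW ni) // local_grid_step.
Qed.

End partition_lists.

Section partition_sums.
Context {R : realType} (T : R) (H : monotone_family R) (L : operator_family H T).
Variables (S : propagator L) (m gamma : R).
Context {d : measure_display} {Omega : measurableType d}.
Variables (P : probability Omega R) (Ft : R -> set (set Omega)).
Variable A : R -> R -> Omega -> H gamma.
Hypotheses (T0 : 0 < T) (m2 : 2 <= m) (uF : usual_filtration P T Ft).
Hypothesis adA : forall s t, Delta2 T (s, t) -> measurable_wrt (Ft t) (A s t).
Local Notation E := (H gamma).
Implicit Type Y : R -> Omega -> E.

Let m1 : 1 <= m. Proof. by apply: le_trans m2; rewrite ler1n. Qed.
Let mge0 : 0 <= m. Proof. exact: le_trans ler01 m1. Qed.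

Lemma partition_sumE s t pi w :
  partition_sum S A s t pi w = riemann_sum S A (size pi) (points s pi) t w.
Proof. by rewrite /partition_sum big_intervals. Qed.

Lemma delta1_telescope Y N p t w : 0 <= p 0%N -> p N = t -> t <= T ->
  (forall i, (i < N)%N -> p i <= p i.+1) ->
  \sum_(i < N) S gamma (p i.+1) t (delta1 S Y (p i) (p i.+1) w) = delta1 S Y (p 0%N) t w.
Proof.
move=> p0 pN tT pp; have pm := nondecreasing_points pp.
have t0 : 0 <= t by rewrite -pN; apply: le_trans p0 (pm _ _ _); rewrite leqnn.
rewrite /delta1 -[Y t w](@prop_id _ _ _ _ S gamma t) ?t0 //.
rewrite (eq_bigr (fun i : 'I_N => S gamma (p i.+1) t (Y (p i.+1) w) -
   S gamma (p i) t (Y (p i) w))) => [|i _].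
  rewrite -(big_mkord xpredT (fun i => S gamma (p i.+1) t (Y (p i.+1) w) -
   S gamma (p i) t (Y (p i) w))).
  by rewrite (@telescope_sumr _ 0 N (fun i => S gamma (p i) t (Y (p i) w))) // pN.
rewrite linearB /= prop_comp //; split => //=.
- by apply: le_trans p0 (pm _ _ _); rewrite /= ltnW.
- exact: pp.
- by rewrite -pN; apply: pm; rewrite ltn_ord leqnn.
Qed.

Section error_control.
Variables (Y : R -> Omega -> E) (B eps : R).
Hypotheses (B0 : 0 <= B) (eps0 : 0 < eps).
Hypothesis adY : forall t, 0 <= t <= T -> measurable_wrt (Ft t) (Y t).
Hypothesis LY : forall s t, 0 <= s -> s <= t -> t <= T ->
  Lbound P m (fun w => A s t w - delta1 S Y s t w) (B * (t - s) `^ (2^-1 + eps)).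
Hypothesis cY : forall s t t', 0 <= s -> s <= t -> t <= t' -> t' <= T ->
  cond_bound P m (Ft s) (fun w => S gamma t t' (A s t w - delta1 S Y s t w))
    (B * (t - s) `^ (1 + eps)).

Lemma partition_error : exists2 K, 0 <= K & forall N p t h,
  0 <= p 0%N -> p N = t -> t <= T -> 0 <= h ->
  (forall i, (i < N)%N -> p i <= p i.+1 /\ p i.+1 - p i <= h) ->
  Lbound P m (fun w => delta1 S Y (p 0%N) t w - riemann_sum S A N p t w)
    (K * h `^ (eps / 2)).
Proof.
have [e he] := separable_dense_sequence H gamma.
have [C C0 hC] := propagator_bound S gamma.
pose Cm := 3 * smoothness_cst m.
have Cm0 : 0 <= Cm by rewrite mulr_ge0 //; exact: le_trans ler01 (smoothness_cst_ge1 m2).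
pose K := 2 * m * (B * T `^ (1 + eps / 2)) + Num.sqrt Cm * (C * B * T `^ ((1 + eps) / 2)).
have TT0 (r : R) : 0 <= T `^ r by exact: powR_ge0.
have CB0 : 0 <= C * B by rewrite mulr_ge0 // ltW.
exists K.
  apply: addr_ge0; first by rewrite !mulr_ge0.
  by rewrite !mulr_ge0 ?sqrtr_ge0 // ltW.
move=> N p t h p0 pN tT h0 pph.
have pp i : (i < N)%N -> p i <= p i.+1 by move=> iN; have [] := pph i iN.
have pm := nondecreasing_points pp.
have p0i i : (i <= N)%N -> 0 <= p i by move=> iN; apply: le_trans p0 (pm _ _ _).
have pit i : (i <= N)%N -> p i <= t.
  by move=> iN; rewrite -pN; apply: pm; rewrite iN leqnn.
have piT i : (i <= N)%N -> p i <= T by move=> iN; exact: le_trans (pit i iN) tT.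
pose X i w := S gamma (p i.+1) t (A (p i) (p i.+1) w - delta1 S Y (p i) (p i.+1) w).
pose l i := p i.+1 - p i.
have LX i : (i < N)%N -> Lbound P m (X i) (C * (B * l i `^ (2^-1 + eps))).
  move=> iN; have D2 : Delta2 T (p i.+1, t) by split => //=; [exact: p0i|exact: pit].
  exact: (Lbound_map m1 (prop_bounded D2) (ltW C0) (fun u => hC _ _ u D2)
    (LY (p0i _ (ltnW iN)) (pp _ iN) (piT _ iN))).
have cX i : (i < N)%N -> cond_bound P m (Ft (p i)) (X i) (B * l i `^ (1 + eps)).
  by move=> iN; apply: cY => //; [apply: p0i; exact: ltnW|exact: pp|exact: pit].
have aX i k : (i < k < N)%N -> measurable_wrt (Ft (p k)) (X i).
  move=> /andP[ik kN]; have iN := ltn_trans ik kN.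
  have D2 : Delta2 T (p i.+1, t) by split => //=; [exact: p0i|exact: pit].
  have D2' : Delta2 T (p i, p i.+1).
    by split => //=; [apply: p0i; exact: ltnW|exact: pp|exact: piT].
  have D2k : Delta2 T (p i.+1, p k).
    by split => //=; [exact: p0i|apply: pm; rewrite ik ltnW|apply: piT; exact: ltnW].
  apply: (@measurable_borel_comp _ (g_sigma_algebraType (Ft (p k))) _ _ (S gamma (p i.+1) t)).
    exact: prop_bounded D2.
  apply: (measurable_wrt_incr uF D2k).
  apply: (@measurable_vecB _ (g_sigma_algebraType (Ft (p i.+1))) _ _ e he); first exact: adA.
  apply: (measurable_delta1 S uF D2') => r; exact: adY.
pose D := p N - p 0%N.
have lE : \sum_(i < N) l i = D by exact: telescope_ord.
have lh i : (i < N)%N -> 0 <= l i <= h.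
  by move=> iN; rewrite subr_ge0 pp //=; have [] := pph i iN.
have D0 : 0 <= D by rewrite subr_ge0 pm // leqnn.
have DT : D <= T by rewrite /D; have := piT N (leqnn N); lra.
have e20 : 0 <= eps / 2 by rewrite divr_ge0 // ltW.
have drift_sum : \sum_(i < N) B * l i `^ (1 + eps) <= B * T `^ (1 + eps / 2) * h `^ (eps / 2).
  rewrite -mulr_sumr -mulrA ler_wpM2l //.
  have -> : 1 + eps = 1 + 2 * (eps / 2) by lra.
  apply: le_trans (sum_powR_le e20 lh) _; rewrite lE ler_wpM2r ?powR_ge0 //.
  by apply: powR_le => //; lra.
have size_sum : \sum_(i < N) (C * (B * l i `^ (2^-1 + eps))) ^+ 2 <=
    (C * B * T `^ ((1 + eps) / 2) * h `^ (eps / 2)) ^+ 2.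
  rewrite (eq_bigr (fun i : 'I_N => (C * B) ^+ 2 * l i `^ (1 + 2 * eps))) => [|i _].
    have -> : (C * B * T `^ ((1 + eps) / 2) * h `^ (eps / 2)) ^+ 2 =
        (C * B) ^+ 2 * ((T `^ ((1 + eps) / 2)) ^+ 2 * (h `^ (eps / 2)) ^+ 2) by ring.
    rewrite -mulr_sumr ler_wpM2l ?sqr_ge0 //.
    apply: le_trans (sum_powR_le (ltW eps0) lh) _.
    rewrite lE !powR_sqr ?(ltW T0) //.
    have -> : 2 * ((1 + eps) / 2) = 1 + eps by lra.
    have -> : 2 * (eps / 2) = eps by lra.
    by rewrite ler_wpM2r ?powR_ge0 // powR_le //; have := eps0; lra.
  rewrite mulrA [LHS]exprMn powR_sqr; last by have /andP[] := lh i (ltn_ord i).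
  by congr (_ * _ `^ _); lra.
have XE : {ae P, forall w, - (\sum_(i < N) X i w) =
    delta1 S Y (p 0%N) t w - riemann_sum S A N p t w}.
  apply: nearW => w; rewrite -(delta1_telescope Y w p0 pN tT pp) /riemann_sum -sumrB -sumrN.
  by apply: eq_bigr => i _; rewrite /X (linearB (S gamma (p i.+1) t)) opprB.
have mE : measurable_fun setT
    ((fun w => delta1 S Y (p 0%N) t w - riemann_sum S A N p t w) : Omega -> borel E).
  have tT' : 0 <= t <= T by rewrite tT andbT -pN p0i.
  apply: (measurable_vecB he); apply: (measurable_wrt_sub uF tT').
    have D2 : Delta2 T (p 0%N, t) by split => //=; exact: pit.
    by apply: (measurable_delta1 S uF D2) => r; exact: adY.
  by apply: (measurable_wrt_riemann_sum S uF adA) => //; rewrite pN.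
apply: (Lbound_ae m1 mE XE); apply: (LboundN m1).
apply: (Lbound_le m1 _ (Lbound_martingale_sum m2 LX cX aX)).
rewrite /K [leRHS]mulrDl; apply: lerD.
  by rewrite -!(mulrA (2 * m)) ler_wpM2l // mulr_ge0.
apply: (@le_trans _ _ (Num.sqrt (Cm * (C * B * T `^ ((1 + eps) / 2) * h `^ (eps / 2)) ^+ 2))).
  by rewrite ler_wsqrtr // ler_wpM2l.
have x0 : 0 <= C * B * T `^ ((1 + eps) / 2) * h `^ (eps / 2).
  by apply: mulr_ge0; [apply: mulr_ge0|exact: powR_ge0].
by rewrite sqrtrM // sqrtr_sqr (ger0_norm x0) !mulrA.
Qed.

End error_control.
End partition_sums.

Section sewing_limits.
Context {R : realType} (T : R) (H : monotone_family R) (L : operator_family H T).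
Variables (S : propagator L) (m gamma : R).
Context {d : measure_display} {Omega : measurableType d}.
Variables (P : probability Omega R) (Ft : R -> set (set Omega)).
Variable A : R -> R -> Omega -> H gamma.
Hypotheses (T0 : 0 < T) (m2 : 2 <= m) (uF : usual_filtration P T Ft).
Hypothesis adA : forall s t, Delta2 T (s, t) -> measurable_wrt (Ft t) (A s t).
Local Notation E := (H gamma).
Implicit Type Y : R -> Omega -> E.

Let m1 : 1 <= m. Proof. by apply: le_trans m2; rewrite ler1n. Qed.

Lemma measurable_sewing_remainder Y N p t :
  (forall t, 0 <= t <= T -> measurable_wrt (Ft t) (Y t)) ->
  0 <= p 0%N -> p N = t -> t <= T -> (forall i, (i < N)%N -> p i <= p i.+1) ->
  measurable_fun setT
    ((fun w => delta1 S Y (p 0%N) t w - riemann_sum S A N p t w) : Omega -> borel E).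
Proof.
move=> adY p0 pN tT pp; have pm := nondecreasing_points pp.
have p0t : p 0%N <= t by rewrite -pN; apply: pm; rewrite leqnn.
have tT' : 0 <= t <= T by rewrite tT (le_trans p0).
have [e he] := separable_dense_sequence H gamma.
apply: (measurable_vecB he); apply: (measurable_wrt_sub uF tT').
  have D2 : Delta2 T (p 0%N, t) by split.
  by apply: (measurable_delta1 S uF D2) => r; exact: adY.
by apply: (measurable_wrt_riemann_sum S uF adA) => //; rewrite pN.
Qed.

Lemma sewing_limit_of_error Y (K a : R) : 0 <= K -> 0 < a ->
  (forall t, 0 <= t <= T -> measurable_wrt (Ft t) (Y t)) ->
  (forall N p t h, 0 <= p 0%N -> p N = t -> t <= T -> 0 <= h ->
    (forall i, (i < N)%N -> p i <= p i.+1 /\ p i.+1 - p i <= h) ->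
    Lbound P m (fun w => delta1 S Y (p 0%N) t w - riemann_sum S A N p t w) (K * h `^ a)) ->
  sewing_limit S P m A Y.
Proof.
move=> K0 a0 adY hY s t [/= s0 st tT] e e0.
have K1 : 0 < K + 1 by lra.
pose x := e / 2 / (K + 1).
have x0 : 0 < x by rewrite !divr_gt0.
exists (x `^ a^-1); first exact: powR_gt0.
move=> pi hpi /ltW hm.
have ps := points_last hpi.
have pp i : (i < size pi)%N -> points s pi i <= points s pi i.+1 /\
    points s pi i.+1 - points s pi i <= x `^ a^-1.
  move=> ipi; split; first exact/ltW/(points_lt hpi).
  exact: le_trans (points_mesh s ipi) hm.
have := hY (size pi) (points s pi) t _ s0 ps tT (powR_ge0 _ _) pp.
rewrite -powRrM mulVf ?gt_eqF // powRr1 ?(ltW x0) // => hL.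
have eq : delta1 S Y s t \- partition_sum S A s t pi =
    (fun w => delta1 S Y (points s pi 0%N) t w - riemann_sum S A (size pi) (points s pi) t w).
  by apply/funext => w /=; rewrite partition_sumE.
rewrite eq; apply: (@le_lt_trans _ _ (e / 2)%:E); last by rewrite lte_fin; lra.
apply/(Lmnorm_LboundP P m1).
- by rewrite divr_ge0 // ltW.
- by case: hL.
apply: (Lbound_le m1 _ hL); rewrite /x mulrA ler_pdivrMr // mulrC ler_wpM2l //; last by lra.
by rewrite divr_ge0 // ltW.
Qed.

Lemma sewing_limit_grid Y s t : (forall t, 0 <= t <= T -> measurable_wrt (Ft t) (Y t)) ->
  sewing_limit S P m A Y -> 0 <= s -> s < t -> t <= T -> forall e, 0 < e ->
  exists n0, forall n, (n0 <= n)%N ->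
    Lbound P m (fun w => delta1 S Y s t w - riemann_sum S A (2 ^ n) (local_grid n s t) t w) e.
Proof.
move=> adY hY s0 st tT e e0.
have D2 : Delta2 T (s, t) by split => //=; exact: ltW.
have [delta delta0 hd] := hY s t D2 e e0.
have h2 : 0 <= (2^-1 : R) < 1 by lra.
have [n0 hn0] := ex_geometric_le (t - s) h2 (divr_gt0 delta0 (ltr0n R 2)).
exists n0 => n n0n.
have hm : mesh s (local_partition n s t) < delta.
  apply: le_lt_trans (local_partition_mesh n (ltW st)) _.
  apply: (@le_lt_trans _ _ (delta / 2)); last by lra.
  apply: le_trans hn0; rewrite -exprVn ler_wpM2l ?subr_ge0 ?(ltW st) //.
  by apply: ler_wiXn2l => //; lra.
have := hd _ (local_partitionP n st) hm; move/ltW.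
have eq : delta1 S Y s t \- partition_sum S A s t (local_partition n s t) =
    (fun w => delta1 S Y s t w - riemann_sum S A (2 ^ n) (local_grid n s t) t w).
  apply/funext => w /=; rewrite partition_sumE size_mkseq; congr (_ - _).
  by apply: eq_bigr => i _; rewrite !points_local_partition // ltnW.
rewrite eq => hL; apply/(Lmnorm_LboundP P m1); [exact: ltW| |by []].
have lg i : local_grid n s t i <= local_grid n s t i.+1.
  by rewrite -subr_ge0 local_grid_step divr_ge0 ?subr_ge0 ?(ltW st) // exprn_ge0.
have := @measurable_sewing_remainder Y (2 ^ n) (local_grid n s t) t adY.
by rewrite local_grid0 local_grid_last; exact.
Qed.

Lemma sewing_delta1_unique Y Y' s t :
  (forall t, 0 <= t <= T -> measurable_wrt (Ft t) (Y t)) ->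
  (forall t, 0 <= t <= T -> measurable_wrt (Ft t) (Y' t)) ->
  sewing_limit S P m A Y -> sewing_limit S P m A Y' -> 0 <= s -> s < t -> t <= T ->
  {ae P, forall w, delta1 S Y s t w = delta1 S Y' s t w}.
Proof.
move=> adY adY' hY hY' s0 st tT; have [e he] := separable_dense_sequence H gamma.
apply: (Lbound_ae_eq m1) => del del0.
have del20 : 0 < del / 2 by lra.
have [n hn] := sewing_limit_grid adY hY s0 st tT del20.
have [n' hn'] := sewing_limit_grid adY' hY' s0 st tT del20.
have := LboundB m1 he (hn _ (leq_maxl n n')) (hn' _ (leq_maxr n n')).
rewrite [X in Lbound _ _ _ X](_ : _ = del); last by lra.
congr (Lbound _ _ _ _); apply/funext => w.
by rewrite opprB addrA subrK.
Qed.

Lemma sewing_unique alpha Y Y' t : is_sewing S P Ft alpha m A Y ->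
  is_sewing S P Ft alpha m A Y' -> 0 <= t <= T -> {ae P, forall w, Y' t w = Y t w}.
Proof.
move=> [CY Y0 hY] [CY' Y'0 hY'] /andP[t0 tT].
move: t0; rewrite le_eqVlt => /predU1P[<-|t0].
  by apply: filterS2 Y0 Y'0 => w -> ->.
have := sewing_delta1_unique (Chat_adapted CY) (Chat_adapted CY') hY hY' (lexx 0) t0 tT.
apply: filterS3 Y0 Y'0 => w Yw Y'w.
by rewrite /delta1 Yw Y'w linear0 !subr0.
Qed.

End sewing_limits.

(** * The remainder in smoother spaces *)

Section singular_sums.
Context {R : realType}.

Lemma singular_sum (a b : R) : 0 <= a -> a < b -> 1 < b ->
  exists C rho, [/\ 0 <= C, 0 <= rho < 1 & forall n,
    (2 `^ (a - b)) ^+ n * \sum_(j < 2 ^ n) (j%:R + 2^-1) `^ (- a) <= C * rho ^+ n].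
Proof.
move=> a0 ab b1; set x := 2 `^ (a - b).
have lt1 (r : R) : r < 0 -> 2 `^ r < 1.
  move=> r0; have : 1 `^ (- r) < 2 `^ (- r) :> R by apply: gt0_ltr_powR; rewrite ?nnegrE; lra.
  by rewrite powR1 powRN -[_^-1]div1r ltr_pdivlMr ?mul1r // powR_gt0.
have x0 : 0 < x by rewrite powR_gt0.
have x1 : x < 1 by apply: lt1; lra.
have y0 : 0 < 2 `^ (1 - b) :> R by rewrite powR_gt0.
have y1 : 2 `^ (1 - b) < 1 :> R by apply: lt1; lra.
pose r0 := Num.max x (2 `^ (1 - b)).
have r01 : 0 < r0 < 1 by rewrite lt_max x0 gt_max x1.
have xr : x <= r0 by rewrite le_max lexx.
have yr : 2 `^ (1 - b) <= r0 by rewrite le_max lexx orbT.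
pose rho := (1 + r0) / 2.
have rr : r0 < rho by rewrite /rho; lra.
have rho1 : 0 <= rho < 1 by rewrite /rho; lra.
pose C := Num.max (2 `^ a) (rho - r0)^-1.
have C0 : 0 <= C by rewrite le_max powR_ge0.
have C1 : r0 * C + 1 <= C * rho.
  have : (rho - r0) * (rho - r0)^-1 <= (rho - r0) * C.
    by rewrite ler_wpM2l ?subr_ge0 ?(ltW rr) // le_max lexx orbT.
  by rewrite mulfV ?subr_eq0 ?gt_eqF //; lra.
exists C, rho; split => // n; elim: n => [|n ih].
  rewrite !expr0 mul1r mulr1 big_ord1 add0r powRN -powR_invl // invrK.
  by rewrite le_max lexx.
have sE : \sum_(j < 2 ^ n.+1) (j%:R + 2^-1 : R) `^ (- a) <=
    \sum_(j < 2 ^ n) (j%:R + 2^-1 : R) `^ (- a) + (2 `^ (1 - a)) ^+ n.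
  rewrite -!(big_mkord xpredT (fun j => (j%:R + 2^-1 : R) `^ (- a))).
  rewrite (@big_cat_nat _ _ _ (2 ^ n)%N) ?leq_exp2l //=.
  rewrite lerD2l (@le_trans _ _ (\sum_(2 ^ n <= j < 2 ^ n.+1) (2 ^+ n : R) `^ (- a))) //.
    rewrite !big_nat; apply: ler_sum => j /andP[nj _].
    rewrite !powRN lef_pV2 ?posrE ?powR_gt0 ?exprn_gt0 //.
      apply: powR_le => //; apply: (@le_trans _ _ j%:R); last by lra.
      by rewrite -natrX ler_nat.
  rewrite sumr_const_nat expnS mul2n -addnn addnK -[leLHS]mulr_natr natrX.
  rewrite -!powR_mulrn ?powR_ge0 // -!powRrM -powRD; last by rewrite pnatr_eq0 implybT.
  rewrite le_eqVlt; apply/orP; left; apply/eqP; congr (_ `^ _); ring.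
apply: (@le_trans _ _ (x * (C * rho ^+ n) + x * (x * 2 `^ (1 - a)) ^+ n)).
  rewrite exprS [(x * _) ^+ n]exprMn -mulrA -mulrDr ler_wpM2l ?(ltW x0) //.
  apply: le_trans (_ : x ^+ n * (_ + (2 `^ (1 - a)) ^+ n) <= _).
    by rewrite ler_wpM2l ?exprn_ge0 ?(ltW x0) //; exact: sE.
  by rewrite mulrDr lerD2r.
have -> : x * 2 `^ (1 - a) = 2 `^ (1 - b).
  rewrite -powRD; last by rewrite pnatr_eq0 implybT.
  by congr (_ `^ _); ring.
have rn : (2 `^ (1 - b)) ^+ n <= rho ^+ n.
  by apply: lerXn2r; rewrite ?nnegrE ?(ltW y0) //; lra.
have rn0 : 0 <= rho ^+ n by rewrite exprn_ge0 //; lra.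
apply: (@le_trans _ _ (r0 * C * rho ^+ n + rho ^+ n)).
  apply: lerD.
    by rewrite mulrA ler_wpM2r // ler_wpM2r.
  by apply: le_trans rn; rewrite ler_piMl ?exprn_ge0 // ltW.
have -> : r0 * C * rho ^+ n + rho ^+ n = (r0 * C + 1) * rho ^+ n by ring.
by rewrite exprS mulrA ler_wpM2r.
Qed.

Lemma local_grid_mid_dist n (s t : R) i :
  t - local_grid n.+1 s t i.*2.+1 = (t - s) / 2 ^+ n * (2 ^+ n - i%:R - 2^-1).
Proof.
rewrite /local_grid -natr1 -mul2n natrM exprS; field.
by rewrite expf_neq0.
Qed.

Lemma singular_grid_sum (a b : R) : 0 <= a -> a < b -> 1 < b ->
  exists C rho, [/\ 0 <= C, 0 <= rho < 1 & forall s t n, s < t ->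
    \sum_(i < 2 ^ n) ((t - s) / 2 ^+ n) `^ b * (t - local_grid n.+1 s t i.*2.+1) `^ (- a)
      <= C * (t - s) `^ (b - a) * rho ^+ n].
Proof.
move=> a0 ab b1; have [C [rho [C0 rho1 hC]]] := singular_sum a0 ab b1.
exists C, rho; split => // s t n st.
have D0 : 0 < t - s by rewrite subr_gt0.
set h := (t - s) / 2 ^+ n.
have h0 : 0 < h by rewrite divr_gt0 // exprn_gt0.
have -> : \sum_(i < 2 ^ n) h `^ b * (t - local_grid n.+1 s t i.*2.+1) `^ (- a) =
    h `^ (b - a) * \sum_(j < 2 ^ n) (j%:R + 2^-1) `^ (- a).
  rewrite mulr_sumr (reindex_inj rev_ord_inj) /=; apply: eq_bigr => i _.
  have iE : (2 ^ n - i.+1)%:R = 2 ^+ n - i%:R - 1 :> R.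
    by rewrite natrB // natrX -[i.+1%:R]natr1 opprD addrA.
  rewrite local_grid_mid_dist -/h iE.
  have -> : 2 ^+ n - (2 ^+ n - i%:R - 1) - 2^-1 = i%:R + 2^-1 :> R by lra.
  rewrite powRM ?(ltW h0) ?addr_ge0 // mulrA -powRD //.
  by rewrite (gt_eqF h0) implybT.
have -> : h `^ (b - a) = (t - s) `^ (b - a) * (2 `^ (a - b)) ^+ n.
  rewrite powRM ?(ltW D0) ?invr_ge0 ?exprn_ge0 //; congr (_ * _).
  by rewrite -exprVn powR_exprn // -[a - b]opprB powRN powR_invl.
by rewrite -mulrA [C * _]mulrC -[leRHS]mulrA ler_wpM2l ?powR_ge0.
Qed.

End singular_sums.

Section sharp_bound.
Context {R : realType} (T : R) (H : monotone_family R) (L : operator_family H T).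
Variables (S : propagator L) (m gamma z1 z2 : R).
Hypotheses (T0 : 0 < T) (m2 : 2 <= m) (z1b : 2^-1 < z1 <= 1) (z2b : 1 < z2).

Let m1 : 1 <= m. Proof. by apply: le_trans m2; rewrite ler1n. Qed.
Let mge0 : 0 <= m. Proof. exact: le_trans ler01 m1. Qed.

Local Notation theta eta := (Num.max (eta + z1 - z2) 0).

Lemma ex_local_grid_rate (eta C : R) : 0 <= eta < z2 -> 0 < C ->
  exists B rho, [/\ 0 <= B, 0 <= rho < 1 & forall K1 K2 s t n, 0 < K1 -> 0 < K2 -> s < t ->
    2 * m * (\sum_(i < 2 ^ n) increment_drift gamma z2 K2 (gamma + eta) C t
      (local_grid n s t i) (local_grid n.+1 s t i.*2.+1) (local_grid n s t i.+1)) +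
    Num.sqrt (3 * smoothness_cst m * \sum_(i < 2 ^ n)
      increment_size gamma z1 z2 K1 (gamma + eta) C t
        (local_grid n s t i) (local_grid n.+1 s t i.*2.+1) (local_grid n s t i.+1) ^+ 2)
    <= B * (K1 * (t - s) `^ (z1 - theta eta) + K2 * (t - s) `^ (z2 - eta)) * rho ^+ n].
Proof.
move=> /andP[eta0 etaz2] C0; have /andP[z12 z11] := z1b; have z21 := z2b.
set th := theta eta.
have th0 : 0 <= th by rewrite le_max lexx orbT.
have thz1 : th < z1 by rewrite gt_max; apply/andP; split; lra.
have [Ca [ra [Ca0 /andP[ra0 ra1] ha]]] := singular_grid_sum eta0 etaz2 z2b.
have [||| Cb [rb [Cb0 /andP[rb0 rb1] hb]]] := @singular_grid_sum _ (2 * th) (2 * z1); [lra..|].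
pose Cm := 3 * smoothness_cst m.
have Cm0 : 0 <= Cm by rewrite mulr_ge0 //; exact: le_trans ler01 (smoothness_cst_ge1 m2).
pose rho := Num.max ra (Num.sqrt rb).
have rar : ra <= rho by rewrite le_max lexx.
have rbr : Num.sqrt rb <= rho by rewrite le_max lexx orbT.
pose Ba := 2 * m * (C * Ca).
pose Bb := Num.sqrt Cm * (C * Num.sqrt Cb).
have Ba0 : 0 <= Ba by rewrite /Ba; do ![apply: mulr_ge0 => //]; exact: ltW.
have Bb0 : 0 <= Bb by rewrite /Bb; do ![apply: mulr_ge0 => //]; rewrite ?sqrtr_ge0 // ltW.
have rho0 : 0 <= rho by exact: le_trans rar.
exists (Ba + Bb), rho; split.
- exact: addr_ge0.
- rewrite rho0 gt_max ra1 /= -sqrtr1 ltr_sqrt //.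
move=> K1 K2 s t n K10 K20 st.
pose p := local_grid n s t; pose r i := local_grid n.+1 s t i.*2.+1.
have D0 : 0 < t - s by rewrite subr_gt0.
set h := (t - s) / 2 ^+ n.
have h0 : 0 < h by rewrite divr_gt0 // exprn_gt0.
have tr i : (i < 2 ^ n)%N -> 0 < t - r i.
  move=> ni; rewrite /r local_grid_mid_dist mulr_gt0 // -addrA -opprD subr_gt0.
  have : i.+1%:R <= (2 ^ n)%:R :> R by rewrite ler_nat.
  rewrite natrX -[i.+1%:R]natr1; lra.
have pp i : p i.+1 - p i = h by exact: local_grid_step.
have pr i : 0 <= p i.+1 - r i <= h.
  have : p i.+1 - r i = h / 2.
    rewrite /p /r /local_grid -mul2n -[i.+1%:R]natr1 -[(2 * i).+1%:R]natr1 natrM exprS /h; field.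
    by rewrite expf_neq0.
  move=> ->; lra.
have drift_sum : \sum_(i < 2 ^ n)
      increment_drift gamma z2 K2 (gamma + eta) C t (p i) (r i) (p i.+1) <=
    C * Ca * (K2 * (t - s) `^ (z2 - eta)) * rho ^+ n.
  apply: (@le_trans _ _ (\sum_(i < 2 ^ n) C * K2 * (h `^ z2 * (t - r i) `^ (- eta)))).
    apply: ler_sum => i _; rewrite /increment_drift pp.
    have -> : gamma - (gamma + eta) = - eta by lra.
    have /andP[pr1 pr2] := pr i.
    have x0 : 0 <= (t - r i) `^ (- eta) by exact: powR_ge0.
    have -> : C * K2 * (h `^ z2 * (t - r i) `^ (- eta)) =
      C * (t - r i) `^ (- eta) * (K2 * h `^ z2) by ring.
    rewrite -[h `^ z2]mulr_powRB1 ?(ltW h0) //; last by lra.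
    rewrite ler_wpM2l ?mulr_ge0 ?(ltW C0) // -mulrA ler_wpM2l ?(ltW K20) //.
    by apply: ler_wpM2l; [exact: ltW|apply: powR_le => //; lra].
  rewrite -mulr_sumr; apply: le_trans (ler_wpM2l _ (ha s t n st)) _.
    by rewrite mulr_ge0 ?(ltW C0) ?(ltW K20).
  have -> : C * K2 * (Ca * (t - s) `^ (z2 - eta) * ra ^+ n) =
    C * Ca * (K2 * (t - s) `^ (z2 - eta)) * ra ^+ n by ring.
  apply: ler_wpM2l; last exact: lerXn2r.
  by do ![apply: mulr_ge0 => //]; rewrite ?powR_ge0 ?(ltW C0) ?(ltW K20).
have size_sum : \sum_(i < 2 ^ n)
      increment_size gamma z1 z2 K1 (gamma + eta) C t (p i) (r i) (p i.+1) ^+ 2 <=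
    (C * Num.sqrt Cb * (K1 * (t - s) `^ (z1 - th)) * rho ^+ n) ^+ 2.
  apply: (@le_trans _ _ (\sum_(i < 2 ^ n)
      (C * K1) ^+ 2 * (h `^ (2 * z1) * (t - r i) `^ (- (2 * th))))).
    apply: ler_sum => i _.
    have -> : (C * K1) ^+ 2 * (h `^ (2 * z1) * (t - r i) `^ (- (2 * th))) =
       (C * (t - r i) `^ (- th) * (K1 * h `^ z1)) ^+ 2.
      have -> : - (2 * th) = 2 * (- th) by lra.
      rewrite -!powR_sqr ?(ltW h0) ?(ltW (tr _ _)) //; ring.
    have -> : increment_size gamma z1 z2 K1 (gamma + eta) C t (p i) (r i) (p i.+1) =
       C * (t - r i) `^ (- th) * (K1 * (h `^ 2^-1 * (p i.+1 - r i) `^ (z1 - 2^-1))).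
      rewrite /increment_size pp; have -> : gamma + eta - (gamma + z2 - z1) = eta + z1 - z2 by lra.
      by rewrite -(mulrA K1).
    have /andP[pr1 pr2] := pr i.
    apply: lerXn2r; rewrite ?nnegrE.
    - by do ![apply: mulr_ge0 => //]; rewrite ?powR_ge0 ?(ltW C0) ?(ltW K10).
    - by do ![apply: mulr_ge0 => //]; rewrite ?powR_ge0 ?(ltW C0) ?(ltW K10).
    rewrite ler_wpM2l ?mulr_ge0 ?powR_ge0 ?(ltW C0) // ler_wpM2l ?(ltW K10) //.
    have -> : h `^ z1 = h `^ 2^-1 * h `^ (z1 - 2^-1).
      by rewrite -powR_addr ?(ltW h0) //; [congr (_ `^ _)|]; lra.
    by rewrite ler_wpM2l ?powR_ge0 //; apply: powR_le => //; lra.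
  rewrite -mulr_sumr; apply: le_trans (ler_wpM2l _ (hb s t n st)) _; first exact: sqr_ge0.
  have -> : 2 * z1 - 2 * th = 2 * (z1 - th) by lra.
  rewrite -powR_sqr ?(ltW D0) //.
  have -> : rb ^+ n = (Num.sqrt rb ^+ n) ^+ 2 by rewrite exprAC sqr_sqrtr.
  rewrite -[X in _ * (X * _ * _) <= _](sqr_sqrtr Cb0).
  have -> : (C * K1) ^+ 2 *
      (Num.sqrt Cb ^+ 2 * (t - s) `^ (z1 - th) ^+ 2 * (Num.sqrt rb ^+ n) ^+ 2) =
    (C * Num.sqrt Cb * (K1 * (t - s) `^ (z1 - th)) * Num.sqrt rb ^+ n) ^+ 2 by ring.
  have x0 : 0 <= C * Num.sqrt Cb * (K1 * (t - s) `^ (z1 - th)).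
    by do ![apply: mulr_ge0 => //]; rewrite ?powR_ge0 ?sqrtr_ge0 ?(ltW C0) ?(ltW K10).
  apply: lerXn2r; rewrite ?nnegrE.
  - by apply: mulr_ge0 => //; apply: exprn_ge0; exact: sqrtr_ge0.
  - by apply: mulr_ge0 => //; exact: exprn_ge0.
  by rewrite ler_wpM2l //; apply: lerXn2r; rewrite ?nnegrE ?sqrtr_ge0.
set k1 := K1 * (t - s) `^ (z1 - th) in size_sum *.
set k2 := K2 * (t - s) `^ (z2 - eta) in drift_sum *.
have k10 : 0 <= k1 by rewrite mulr_ge0 ?powR_ge0 // ltW.
have k20 : 0 <= k2 by rewrite mulr_ge0 ?powR_ge0 // ltW.
have rn0 : 0 <= rho ^+ n by rewrite exprn_ge0.
apply: (@le_trans _ _ (Ba * k2 * rho ^+ n + Bb * k1 * rho ^+ n)).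
  apply: lerD.
    rewrite /Ba -!(mulrA (2 * m)) ler_wpM2l //; exact: mulr_ge0.
  have x0 : 0 <= C * Num.sqrt Cb * k1 * rho ^+ n.
    by do ![apply: mulr_ge0 => //]; rewrite ?sqrtr_ge0 ?(ltW C0).
  apply: (@le_trans _ _ (Num.sqrt (Cm * (C * Num.sqrt Cb * k1 * rho ^+ n) ^+ 2))).
    by rewrite ler_wsqrtr // ler_wpM2l.
  by rewrite sqrtrM // sqrtr_sqr (ger0_norm x0) /Bb !mulrA.
rewrite -mulrDl ler_wpM2r //.
have : 0 <= Ba * k1 + Bb * k2 by rewrite addr_ge0 // mulr_ge0.
lra.
Qed.

End sharp_bound.

Section sewing_remainder.
Context {R : realType} (T : R) (H : monotone_family R) (L : operator_family H T).
Variables (S : propagator L) (m gamma z1 z2 : R).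
Hypotheses (T0 : 0 < T) (m2 : 2 <= m) (z1b : 2^-1 < z1 <= 1) (z2b : 1 < z2).
Local Notation E := (H gamma).

Let m1 : 1 <= m. Proof. by apply: le_trans m2; rewrite ler1n. Qed.

Lemma riemann_local_grid_refine {d : measure_display} {Omega : measurableType d}
    (A : R -> R -> Omega -> E) n s t w :
  riemann_sum S A (2 ^ n.+1) (local_grid n.+1 s t) t w =
  refined_sum S A (2 ^ n) (local_grid n s t) (fun i => local_grid n.+1 s t i.*2.+1) t w.
Proof.
rewrite /riemann_sum /refined_sum expn2S.
rewrite (sum_double (fun j => S gamma (local_grid n.+1 s t j.+1) t
  (A (local_grid n.+1 s t j) (local_grid n.+1 s t j.+1) w))).
by apply: eq_bigr => i _; rewrite -doubleS !local_grid_double.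
Qed.

Lemma sewing_remainder_bound (eta : R) : 0 <= eta < z2 ->
  exists C : R, forall (d : measure_display) (Omega : measurableType d)
    (P : probability Omega R) (Ft : R -> set (set Omega))
    (A : R -> R -> Omega -> E) (Lambda : R -> R -> R -> Omega -> E) (K1 K2 : R),
  usual_filtration P T Ft ->
  (forall s t, Delta2 T (s, t) -> measurable_wrt (Ft t) (A s t)) ->
  0 < K1 -> 0 < K2 ->
  (forall s r t, Delta3 T (s, r, t) ->
    [/\ measurable_wrt measurable (Lambda s r t),
        {ae P, forall w, delta2 S A s r t w = S gamma r t (Lambda s r t w)},
        (Lmnorm P m (gamma + z2 - z1)%R (Lambda s r t) <=
          (K1 * (t - s) `^ 2^-1 * (t - r) `^ (z1 - 2^-1))%:E)%E &
        exists2 Z, condexp P (Ft s) (Lambda s r t) Z &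
          (Lmnorm P m gamma Z <=
            (K2 * (t - s) * (t - r) `^ (z2 - 1))%:E)%E]) ->
  forall Y : R -> Omega -> E,
  (forall t, 0 <= t <= T -> measurable_wrt (Ft t) (Y t)) ->
  sewing_limit S P m A Y ->
  forall s t, Delta2 T (s, t) ->
    (Lmnorm P m (gamma + eta)%R (delta1 S Y s t \- A s t)%R <=
      (C * (K1 * (t - s) `^ (z1 - Num.max (eta + z1 - z2) 0)
            + K2 * (t - s) `^ (z2 - eta)))%:E)%E.
Proof.
move=> etab; have /andP[eta0 etaz2] := etab.
have gg2 : gamma <= gamma + eta by rewrite lerDl.
have [Cs hC] := ex_smoothing_cst S (gamma_le_shift gamma z1b z2b) gg2.
have [Cs0 _] := hC.
have [B [rho [B0 rho01 hB]]] := ex_local_grid_rate gamma m2 z1b z2b etab Cs0.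
have /andP[rho0 rho1] := rho01.
exists (B / (1 - rho)) => d Omega P Ft A Lambda K1 K2 uF adA K10 K20 hLambda Y adY hY s t.
move=> [/= s0 st tT].
set k := K1 * _ + K2 * _.
have k0 : 0 <= k by rewrite addr_ge0 // mulr_ge0 ?powR_ge0 // ltW.
have c0 : 0 <= B / (1 - rho) * k by rewrite mulr_ge0 // divr_ge0 // subr_ge0 ltW.
move: st; rewrite le_eqVlt => /predU1P[st|st].
  have tT' : 0 <= t <= T by rewrite tT -st s0.
  apply: (@Lbound_Lmnorm _ _ _ P m m1 H gamma (gamma + eta) _ (fun=> 0) _ gg2); last first.
    exact: Lbound_cst0.
  apply: filterS (A_diag0 m2 uF adA z1b z2b K10 K20 hLambda tT') => w.
  by rewrite /= st /delta1 prop_id // subrr linear0 => ->; rewrite subr0.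
have [e he] := separable_dense_sequence H gamma.
have [e' he'] := separable_dense_sequence H (gamma + eta).
have t0 : 0 <= t by apply: le_trans s0 (ltW st).
have tT' : 0 <= t <= T by rewrite t0.
have D0 : 0 < t - s by rewrite subr_gt0.
pose p n := local_grid n s t; pose r n i := local_grid n.+1 s t i.*2.+1.
have h0 n : 0 < (t - s) / 2 ^+ n by rewrite divr_gt0 // exprn_gt0.
have pS n i : p n i < p n i.+1 by rewrite -subr_gt0 local_grid_step.
have pm n : {homo p n : i j / (i <= j)%N >-> i <= j}.
  by apply: homo_leq => [i|i j k'|i]; [exact: lexx|exact: le_trans|exact: ltW].
have pmS n : {homo p n : i j / (i < j)%N >-> i < j}.
  by apply: homo_ltn => [i j k'|i]; [exact: lt_trans|exact: pS].
have plast n : p n (2 ^ n)%N = t by exact: local_grid_last.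
have p0 n : p n 0%N = s by exact: local_grid0.
have pr n i : p n i < r n i /\ r n i < p n i.+1.
  rewrite /p -(local_grid_double n s t i) -(local_grid_double n s t i.+1) doubleS.
  by split; exact: (pS n.+1).
have Zex n : exists Z : Omega -> H (gamma + eta),
    {ae P, forall w, emb H gamma (gamma + eta) (Z w) =
       riemann_sum S A (2 ^ n) (p n) t w - riemann_sum S A (2 ^ n.+1) (p n.+1) t w} /\
    Lbound P m Z (B * k * rho ^+ n).
  have [|||||| Z [ZE LZ _]] := refinement m2 z1b z2b uF adA K10 K20 hLambda gg2 hC
     (N := (2 ^ n)%N) (p := p n) (r := r n) (t := t).
  - by rewrite p0.
  - by [].
  - by move=> i _; have [/ltW h1 /ltW h2] := pr n i.
  - by rewrite plast.
  - move=> i ni; left; have [_ h2] := pr n i; apply: lt_le_trans h2 _.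
    by rewrite -(plast n); exact: pm.
  - by move=> i ni; left; rewrite -(plast n); exact: pmS.
  exists Z; split; last exact: (Lbound_le m1 (hB K1 K2 s t n K10 K20 st) LZ).
  by apply: filterS ZE => w ->; rewrite riemann_local_grid_refine.
have /choice[Z hZ] := Zex.
pose X n w := - (\sum_(i < n) Z i w).
have mZ n : measurable_fun setT (Z n : Omega -> borel (H (gamma + eta))).
  by have [_ []] := hZ n.
have mX n : measurable_fun setT (X n : Omega -> borel (H (gamma + eta))).
  by apply: measurable_vecN; apply: (measurable_vec_sum he') => i; exact: mZ.
have XS n : Lbound P m (fun w => X n.+1 w - X n w) (B * k * rho ^+ n).
  have [_ /(LboundN m1)] := hZ n; congr (Lbound _ _ _ _); apply/funext => w.
  by rewrite /X big_ord_recr /= opprD opprK [RHS]addrAC addNr add0r.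
have Bk0 : 0 <= B * k by rewrite mulr_ge0.
have [Xcvg XL] := Lbound_series m1 he' mX Bk0 rho01 XS.
have XE n : {ae P, forall w, emb H gamma (gamma + eta) (X n w) =
    riemann_sum S A (2 ^ n) (p n) t w - A s t w}.
  have : {ae P, forall w i, emb H gamma (gamma + eta) (Z i w) =
       riemann_sum S A (2 ^ i) (p i) t w - riemann_sum S A (2 ^ i.+1) (p i.+1) t w}.
    by apply: ae_foralln => i; have [] := hZ i.
  apply: filterS => w hw; rewrite /X linearN linear_sum /=.
  rewrite (eq_bigr (fun i : 'I_n => riemann_sum S A (2 ^ i) (p i) t w -
     riemann_sum S A (2 ^ i.+1) (p i.+1) t w)) => [|i _]; last exact: hw.
  rewrite -sumrN (eq_bigr (fun i : 'I_n => riemann_sum S A (2 ^ i.+1) (p i.+1) t w -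
     riemann_sum S A (2 ^ i) (p i) t w)) => [|i _]; last by rewrite opprB.
  rewrite -(big_mkord xpredT (fun i => riemann_sum S A (2 ^ i.+1) (p i.+1) t w -
     riemann_sum S A (2 ^ i) (p i) t w)) telescope_sumr //; congr (_ - _).
  rewrite /riemann_sum expn0 big_ord1 p0 -[1%N](expn0 2) plast.
  by rewrite prop_id.
have [kf kf0 hkf] := linear_continuous_bound (emb_continuous (m := H) gg2).
apply: (@Lbound_Lmnorm _ _ _ P m m1 H gamma (gamma + eta) _ (plim X) _ gg2); last first.
  have := XL 0%N; rewrite expr0 mulr1.
  have -> : B / (1 - rho) * k = B * k / (1 - rho) by ring.
  congr (Lbound _ _ _ _); apply/funext => w.
  by rewrite /X big_ord0 oppr0 subr0.
have mplim : measurable_fun setT (plim X : Omega -> borel (H (gamma + eta))).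
  exact: (measurable_plim he').
apply: (Lbound_ae_eq m1) => del del0.
have del20 : 0 < del / 2 by lra.
have [n1 hn1] := ex_geometric_le (kf * (B * k / (1 - rho))) rho01 del20.
have [n0 hn0] := sewing_limit_grid m2 uF adA adY hY s0 st tT del20.
pose n := maxn n0 n1.
have L1 := hn0 n (leq_maxl _ _).
have L2 := Lbound_map m1 (emb_continuous (m := H) gg2) (ltW kf0) hkf (XL n).
have := LboundB m1 he L1 L2.
move/(Lbound_le m1 (c' := del)) => /(_ _)/Lbound_ae; apply => //.
- have mE (U V : Omega -> E) : measurable_wrt (Ft t) U -> measurable_wrt (Ft t) V ->
      measurable_fun setT ((fun w => U w - V w) : Omega -> borel E).
    by move=> mU mV; apply: (measurable_vecB he); apply: (measurable_wrt_sub uF tT').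
  apply: (measurable_vecB he).
    apply: mE; last by apply: adA; split => //=; exact: ltW.
    by apply: (measurable_delta1 S uF) => [|u uT]; [split => //=; exact: ltW|exact: adY].
  apply: (measurable_borel_comp (f := emb H gamma (gamma + eta))) => //.
  exact: emb_continuous.
- apply: filterS (XE n) => w Xw; rewrite /= linearB /= Xw.
  rewrite opprB addrA; congr (_ - _).
  by rewrite addrA subrK.
- have : kf * (B * k * rho ^+ n / (1 - rho)) <= del / 2; last by lra.
  apply: le_trans hn1.
  have -> : kf * (B * k * rho ^+ n / (1 - rho)) = kf * (B * k / (1 - rho)) * rho ^+ n by ring.
  apply: ler_wpM2l; first by rewrite mulr_ge0 ?(ltW kf0) // divr_ge0 // subr_ge0 ltW.
  by apply: ler_wiXn2l; [exact: rho0|exact: ltW|exact: leq_maxr].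
Qed.

End sewing_remainder.

(** * Regularity of the sewing process *)

Section joint_measurability.
Context {R : realType} (T : R) (H : monotone_family R) (L : operator_family H T).
Variables (S : propagator L) (m gamma : R).
Hypotheses (T0 : 0 < T).
Local Notation E := (H gamma).

Lemma prop_joint_continuous g (p q : R -> R) : continuous p -> continuous q ->
  (forall t, Delta2 T (p t, q t)) ->
  continuous (fun z : R^o * H g => S g (p z.1) (q z.1) z.2).
Proof.
move=> cp cq pq [t x]; have [C C0 hC] := propagator_bound S g.
apply/cvgrPdist_lt => e e0.
have e20 : 0 < e / 2 by lra.
have e2C0 : 0 < e / 2 / C by rewrite divr_gt0.
have /subspace_continuousP/(_ _ (pq t)) := @prop_continuous _ _ _ _ S g x.
move=> /cvgrPdist_lt/(_ _ e20) hS.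
have cpq : (fun t' => (p t', q t')) t' @[t' --> t] --> (p t, q t).
  exact: (@cvg_pair _ _ _ (nbhs t) (nbhs (p t)) (nbhs (q t)) _ _ _ p q (cp t) (cq t)).
have hS' : \forall t' \near nbhs t, Delta2 T (p t', q t') ->
    `|S g (p t) (q t) x - S g (p t') (q t') x| < e / 2 := cpq _ hS.
have ht : \forall z \near nbhs ((t, x) : R^o * H g),
    `|S g (p t) (q t) x - S g (p z.1) (q z.1) x| < e / 2.
  have : \forall t' \near nbhs t, `|S g (p t) (q t) x - S g (p t') (q t') x| < e / 2.
    by apply: filterS hS' => t' /= h; exact: (h (pq t')).
  move=> h; exact: (cvg_fst (F := nbhs (t : R^o)) (G := nbhs x) h).
have hx : \forall z \near nbhs ((t, x) : R^o * H g), `|x - z.2| < e / 2 / C.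
  have : \forall x' \near nbhs x, `|x - x'| < e / 2 / C.
    by have /cvgrPdist_lt := @cvg_id _ (nbhs x); apply.
  move=> h; exact: (cvg_snd (F := nbhs (t : R^o)) (G := nbhs x) h).
apply: filterS2 ht hx => -[t' x'] /= ht hx.
rewrite (_ : _ - _ = (S g (p t) (q t) x - S g (p t') (q t') x) + S g (p t') (q t') (x - x')).
  apply: le_lt_trans (ler_normD _ _) _; rewrite [ltRHS](_ : e = e / 2 + e / 2); last by lra.
  apply: ltrD => //; apply: le_lt_trans (hC _ _ _ (pq t')) _.
  by rewrite mulrC -ltr_pdivlMr.
by rewrite linearB /= addrA subrK.
Qed.

Lemma nonexpansive_continuous (f : R -> R) :
  (forall x y, x <= y -> 0 <= f y - f x <= y - x) -> continuous f.
Proof.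
move=> hf x; apply/cvgrPdist_lt => e e0; near=> y.
apply: (@le_lt_trans _ _ `|x - y|).
  have [xy|/ltW yx] := leP x y.
    have /andP[h1 h2] := hf x y xy.
    by rewrite distrC ger0_norm // distrC ger0_norm // subr_ge0.
  have /andP[h1 h2] := hf y x yx.
  by rewrite ger0_norm // ger0_norm // subr_ge0.
near: y; have /cvgrPdist_lt := @cvg_id _ (nbhs x); exact.
Unshelve. all: by end_near. Qed.

Lemma continuous_clamp (s t : R) : continuous (clamp s t).
Proof.
apply: nonexpansive_continuous => x y xy.
by rewrite subr_ge0 clamp_homo // clamp_contract.
Qed.

Lemma continuous_clamp_top (s y : R) : continuous (fun t => clamp s t y).
Proof.
apply: nonexpansive_continuous => x x' xx'.
rewrite /clamp [Num.min _ x']minC [Num.min _ x]minC /Order.min.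
by do ! case: ifPn => //; rewrite -?leNgt => *; apply/andP; split; lra.
Qed.

Lemma measurable_Delta2 : measurable (Delta2 T : set (measurableTypeR R * measurableTypeR R)).
Proof.
have mf : measurable_fun setT (fst : measurableTypeR R * measurableTypeR R -> R).
  exact: measurable_fst.
have ms : measurable_fun setT (snd : measurableTypeR R * measurableTypeR R -> R).
  exact: measurable_snd.
have mc (c : R) : measurable_fun setT ((fun=> c) : measurableTypeR R * measurableTypeR R -> R).
  exact: measurable_cst.
rewrite (_ : Delta2 T = (setT `&` [set z | 0 <= z.1]) `&` ((setT `&` [set z | z.1 <= z.2]) `&`
  (setT `&` [set z | z.2 <= T]))).
  by apply: measurableI; [|apply: measurableI]; apply: measurable_fun_le => //; exact: mc.
by apply/seteqP; split => z /= => [[]|[[_ h1] [[_ h2] [_ h3]]]].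
Qed.

Section process_measurability.
Context {d : measure_display} {Omega : measurableType d}.
Variable A : R -> R -> Omega -> E.
Hypothesis mA : measurable_fun (Delta2 T `*` setT)
  ((fun z => A z.1.1 z.1.2 z.2) :
     measurableTypeR R * measurableTypeR R * Omega -> borel E).

Lemma measurable_A_comp (p q : R -> R) : continuous p -> continuous q ->
  (forall t, Delta2 T (p t, q t)) ->
  measurable_fun setT
    ((fun z => A (p z.1) (q z.1) z.2) : measurableTypeR R * Omega -> borel E).
Proof.
move=> cp cq pq.
have mDT : measurable (Delta2 T `*` [set: Omega] :
    set (measurableTypeR R * measurableTypeR R * Omega)).
  by apply: measurableX => //; exact: measurable_Delta2.
have mfst (f : R -> R) : continuous f ->
    measurable_fun setT ((fun z => f z.1) : measurableTypeR R * Omega -> measurableTypeR R).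
  move=> cf; apply: (measurableT_comp (f := f)); last exact: measurable_fst.
  exact: continuous_measurable_fun.
apply: (@measurable_comp _ _ _ (measurableTypeR R * Omega)%type
  (measurableTypeR R * measurableTypeR R * Omega)%type (borel E) (Delta2 T `*` setT)
  (fun z => A z.1.1 z.1.2 z.2) setT (fun z => ((p z.1, q z.1), z.2))) => //.
  by move=> _ [z _ <-]; split => //=; exact: pq.
apply: measurable_fun_pair; last exact: measurable_snd.
by apply: measurable_fun_pair; exact: mfst.
Qed.

Lemma measurable_sewing_process :
  measurable_fun (`[0, T] `*` setT)
    ((fun z => sewing_process S A z.1 z.2) : measurableTypeR R * Omega -> borel E).
Proof.
have [e he] := separable_dense_sequence H gamma.
have [e1 he1] := @dense_sequence_real R.
pose q t : R := clamp 0 T t.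
have cq : continuous q by exact: continuous_clamp.
have q0 t : 0 <= q t by rewrite clamp_ge // ltW.
have qT t : q t <= T by exact: clamp_le.
pose p n i t : R := grid_trace T n 0 (q t) i.
have cp n i : continuous (p n i).
  by move=> t; apply: continuous_comp; [exact: cq|exact: continuous_clamp_top].
have p0 n i t : 0 <= p n i t by rewrite clamp_ge.
have pq n i t : p n i t <= q t by exact: clamp_le.
pose X n (z : measurableTypeR R * Omega) :=
  riemann_sum S A (2 ^ n) (grid_trace T n 0 (q z.1)) (q z.1) z.2.
have mX n : measurable_fun setT (X n : _ -> borel E).
  apply: (measurable_vec_sum he) => i.
  have D2 t : Delta2 T (p n i.+1 t, q t) by split; [exact: p0|exact: pq|exact: qT].
  have D2' t : Delta2 T (p n i t, p n i.+1 t).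
    by split => /=; [exact: p0|exact: grid_trace_le|exact: le_trans (pq _ _ _) (qT t)].
  apply: (measurable_borel_comp2 he1 he (X := fun z => z.1)
    (f := fun z : R^o * E => S gamma (p n i.+1 z.1) (q z.1) z.2)).
  - exact: prop_joint_continuous.
  - by apply/measurable_borelR; exact: measurable_fst.
  - exact: (measurable_A_comp (@cp n i) (@cp n i.+1) D2').
apply: (@eq_measurable_fun _ _ (measurableTypeR R * Omega)%type (borel E)
  (`[0, T] `*` setT) (plim X)).
  move=> [t w]; rewrite inE /= in_itv /= => -[/andP[t0 tT] _].
  by rewrite /sewing_process /sewn -{2 3}(clamp_mid t0 tT).
apply: (measurable_funS (E := setT)) => //.
exact: (measurable_plim he).
Qed.

End process_measurability.
End joint_measurability.

Lemma cvg_ereal0 (R : realType) (I : Type) (F : set_system I) (f : I -> \bar R) :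
  Filter F -> (forall e : R, 0 < e -> \forall x \near F, (0 <= f x <= e%:E)%E) ->
  f x @[x --> F] --> 0%E.
Proof.
move=> FF hf; apply/fine_cvgP; split.
  apply: filterS (hf 1 ltr01) => x /andP[h0 h1].
  by rewrite ge0_fin_numE // (le_lt_trans h1) // ltry.
apply/cvgrPdist_le => e e0; apply: filterS (hf e e0) => x /andP[h0 h1].
rewrite /= sub0r normrN ger0_norm ?fine_ge0 //.
by rewrite -lee_fin fineK // ge0_fin_numE // (le_lt_trans h1) // ltry.
Qed.

Section sewing_space.
Context {R : realType} (T : R) (H : monotone_family R) (L : operator_family H T).
Variables (S : propagator L) (m gamma : R).
Context {d : measure_display} {Omega : measurableType d}.
Variables (P : probability Omega R) (Ft : R -> set (set Omega)).
Hypotheses (T0 : 0 < T) (m2 : 2 <= m) (uF : usual_filtration P T Ft).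
Local Notation E := (H gamma).

Let m1 : 1 <= m. Proof. by apply: le_trans m2; rewrite ler1n. Qed.

Lemma Lmnorm_ge0 g g' (X : Omega -> H g) : (0 <= Lmnorm P m g' X)%E.
Proof. exact: Lnorm_ge0. Qed.

Lemma Lbound_prop_continuous r t (xi : Omega -> E) c : 0 <= r -> r <= t -> t <= T ->
  Lbound P m xi c -> forall e, 0 < e -> exists2 del, 0 < del &
    forall t', r <= t' -> t' <= T -> `|t - t'| < del ->
      Lbound P m (fun w => S gamma r t' (xi w) - S gamma r t (xi w)) e.
Proof.
move=> r0 rt tT hxi e e0; have [e_ he] := separable_dense_sequence H gamma.
have [C C0 hC] := propagator_bound S gamma.
apply: contrapT => hn.
have hex n : exists t', [/\ r <= t', t' <= T, `|t - t'| < n.+1%:R^-1 &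
    ~ Lbound P m (fun w => S gamma r t' (xi w) - S gamma r t (xi w)) e].
  apply: contrapT => hn'; apply: hn; exists n.+1%:R^-1 => // t' rt' t'T tt'.
  by apply: contrapT => hL; apply: hn'; exists t'.
have /choice[u hu] := hex.
have D2 t' : r <= t' -> t' <= T -> Delta2 T (r, t') by move=> *; split.
have mS t' : r <= t' -> t' <= T ->
    measurable_fun setT ((fun w => S gamma r t' (xi w)) : Omega -> borel E).
  move=> rt' t'T; apply: (measurable_borel_comp (f := S gamma r t')).
    by apply: prop_bounded; exact: D2.
  by case: hxi.
have cu : u n @[n --> \oo] --> t.
  apply/cvgrPdist_lt => k k0; have [N hN] := ex_natSinv_lt k0.
  exists N => // n /= Nn; have [_ _ h _] := hu n.
  apply: lt_le_trans h _; apply: le_trans (ltW hN).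
  by rewrite lef_pV2 ?posrE // ler_nat.
have [] := @Lbound_lim_dominated _ _ _ P m m1 E e_ he (fun n w => S gamma r (u n) (xi w))
  (fun w => S gamma r t (xi w)) xi (C + C) c _ _ _ _ _ hxi e e0.
- by move=> n; have [h1 h2 _ _] := hu n; exact: mS.
- exact: mS.
- move=> w; have /subspace_continuousP/(_ _ (D2 _ rt tT)) :=
    @prop_continuous _ _ _ _ S gamma (xi w).
  move=> hcv; apply/cvgrPdist_lt => k k0.
  move/cvgrPdist_lt: hcv => /(_ _ k0) hS.
  have cru : (fun n => (r, u n)) n @[n --> \oo] --> (r, t).
    exact: (@cvg_pair _ _ _ \oo (nbhs r) (nbhs t) _ _ _ (fun=> r) u (cvg_cst r) cu).
  have hS' : \forall n \near \oo, Delta2 T (r, u n) ->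
    `|S gamma r t (xi w) - S gamma r (u n) (xi w)| < k := cru _ hS.
  by apply: filterS hS' => n; apply; have [h1 h2 _ _] := hu n; exact: D2.
- by rewrite addr_ge0 // ltW.
- move=> n w; have [h1 h2 _ _] := hu n.
  apply: le_trans (ler_normB _ _) _; rewrite mulrDl lerD // hC //; exact: D2.
move=> N _ /(_ N (leqnn N)) hL; have [_ _ _] := hu N; exact.
Qed.

Section Chat_space_of_bound.
Variables (alpha M : R) (Y : R -> Omega -> E).
Hypotheses (alpha0 : 0 < alpha) (M0 : 0 <= M).
Hypothesis mY : measurable_fun (`[0, T] `*` setT)
  ((fun z => Y z.1 z.2) : measurableTypeR R * Omega -> borel E).
Hypothesis adY : forall t, 0 <= t <= T -> measurable_wrt (Ft t) (Y t).
Hypothesis Y0 : {ae P, forall w, Y 0 w = 0}.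
Hypothesis LY : forall s t, 0 <= s -> s <= t -> t <= T ->
  Lbound P m (delta1 S Y s t) (M * (t - s) `^ alpha).

Let measurable_Y t : 0 <= t <= T -> measurable_fun setT (Y t : Omega -> borel E).
Proof. by move=> tT; apply: (measurable_wrt_sub uF tT); exact: adY. Qed.

Lemma Lbound_process t : 0 <= t <= T -> Lbound P m (Y t) (M * t `^ alpha).
Proof.
move=> tT; have /andP[t0 tT'] := tT; have := LY (lexx 0) t0 tT'; rewrite subr0 => hL.
apply: (Lbound_ae m1 (measurable_Y tT) _ hL); apply: filterS Y0 => w Yw.
by rewrite /delta1 Yw linear0 subr0.
Qed.

Lemma Lbound_process_continuous t : 0 <= t <= T -> forall e, 0 < e ->
  exists2 del, 0 < del & forall t', 0 <= t' <= T -> `|t - t'| < del ->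
    Lbound P m (Y t' \- Y t) e.
Proof.
move=> tT e e0; have /andP[t0 tT'] := tT; have [e_ he] := separable_dense_sequence H gamma.
have M1 : 0 < M + 1 by have := M0; lra.
pose del := (e / 4 / (M + 1)) `^ alpha^-1.
have del0 : 0 < del by rewrite powR_gt0 // !divr_gt0.
pose del2 := del / 2.
have small x : 0 <= x -> x <= del -> M * x `^ alpha <= e / 4.
  move=> x0 xd; apply: (@le_trans _ _ (M * del `^ alpha)).
    by rewrite ler_wpM2l // powR_le // ltW.
  rewrite -powRrM mulVf ?gt_eqF // powRr1; last by rewrite !divr_ge0 // ltW.
  rewrite mulrA ler_pdivrMr // mulrC ler_wpM2l //; last by lra.
  by rewrite divr_ge0 // ltW.
pose r := Num.max 0 (t - del2).
have r0 : 0 <= r by rewrite le_max lexx.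
have rt : r <= t by rewrite ge_max t0 /=; rewrite /del2; lra.
have rd : t - del2 <= r by rewrite le_max lexx orbT.
have rT' : 0 <= r <= T by rewrite r0 (le_trans rt).
have e40 : 0 < e / 4 by lra.
have [k k0 hk] := Lbound_prop_continuous r0 rt tT' (Lbound_process rT') e40.
exists (Num.min k del2); first by rewrite lt_min k0 divr_gt0.
move=> t' tT1; rewrite lt_min => /andP[tk td].
have /andP[t'0 t'T] := tT1.
have /andP[td1 td2] : - del2 < t - t' < del2 by rewrite -ltr_norml.
have rt' : r <= t' by rewrite ge_max t'0 /=; lra.
have L1 := LY r0 rt' t'T; have L2 := LY r0 rt tT'; have L3 := hk t' rt' t'T tk.
have := LboundD m1 he (LboundB m1 he L1 L2) L3.
move=> hL; apply: (Lbound_ae m1 _ _ (Lbound_le m1 _ hL)).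
- by apply: (measurable_vecB he); exact: measurable_Y.
- apply: nearW => w /=; rewrite /delta1.
  by rewrite opprB [LHS]addrAC !addrA subrK subrK.
- have := small (t' - r) _ _; have := small (t - r) _ _; rewrite /del2 in rd td1 *.
  move=> h1 h2.
  have {h1} : M * (t - r) `^ alpha <= e / 4 by apply: h1; lra.
  have {h2} : M * (t' - r) `^ alpha <= e / 4 by apply: h2; lra.
  lra.
Qed.

Lemma Chat_space_of_bound : Chat_space S P Ft alpha m Y.
Proof.
split => //.
- move=> t tT; apply: (@le_lt_trans _ _ (M * t `^ alpha)%:E); last by rewrite ltry.
  have hL := Lbound_process tT.
  apply/(Lmnorm_LboundP P m1) => //; [by case: hL|exact: measurable_Y].
- move=> t tT; apply: cvg_ereal0 => e e0.
  have [del del0 hd] := Lbound_process_continuous tT e0.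
  have ht : \forall t' \near nbhs t, `|t - t'| < del.
    by have /cvgrPdist_lt := @cvg_id _ (nbhs t); apply.
  rewrite near_withinE; apply: filterS ht => t' tt' /= tT1; rewrite Lmnorm_ge0 /=.
  apply/(Lmnorm_LboundP P m1); first exact: ltW.
    have [e_ he] := separable_dense_sequence H gamma.
    by apply: (measurable_vecB he); exact: measurable_Y.
  exact: hd.
- apply: (@le_lt_trans _ _ M%:E); last by rewrite ltry.
  apply: ge_ereal_sup => _ [[s t] [[/= s0 st tT] st'] <-] /=.
  have x0 : 0 < (t - s) `^ alpha by rewrite powR_gt0 // subr_gt0.
  rewrite lee_pdivrMr // -EFinM.
  apply/(Lmnorm_LboundP P m1); [exact: mulr_ge0 (ltW x0)| |exact: LY].
  by case: (LY s0 st tT).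
Qed.

End Chat_space_of_bound.

Lemma C2_Lbound alpha (A : R -> R -> Omega -> E) : 0 < alpha ->
  C2_space T P Ft alpha m A -> (forall u, 0 <= u <= T -> {ae P, forall w, A u u w = 0}) ->
  exists2 M, 0 <= M & forall s t, 0 <= s -> s <= t -> t <= T ->
    Lbound P m (A s t) (M * (t - s) `^ alpha).
Proof.
move=> alpha0 CA A0.
have mA s t : Delta2 T (s, t) -> measurable_fun setT (A s t : Omega -> borel E).
  move=> D2; have [/= s0 st tT] := D2.
  apply: (measurable_wrt_sub (t := t) uF); first by rewrite tT (le_trans s0).
  exact: (C2_adapted CA).
have h := C2_holder CA.
have hx s t : Delta2 T (s, t) -> s < t ->
    (Lmnorm P m gamma (A s t) * ((t - s) `^ alpha)^-1%:E <= holder_norm T P alpha m A)%E.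
  by move=> D2 st; apply: ereal_sup_ubound; exists (s, t).
have D0T : Delta2 T (0, T) by split => //=; exact: ltW.
have hn0 : (0 <= holder_norm T P alpha m A)%E.
  apply: le_trans (hx _ _ D0T T0); apply: mule_ge0; first exact: Lmnorm_ge0.
  by rewrite lee_fin invr_ge0 powR_ge0.
exists (fine (holder_norm T P alpha m A)); first exact: fine_ge0.
move=> s t s0 st tT; have D2 : Delta2 T (s, t) by split.
have M0 : 0 <= fine (holder_norm T P alpha m A) by exact: fine_ge0.
move: st D2; rewrite le_eqVlt => /predU1P[<-|st] D2.
  rewrite subrr powR0 ?gt_eqF // mulr0.
  have uT : 0 <= s <= T by rewrite s0; case: D2.
  apply: (Lbound_ae m1 (mA _ _ D2) _ (Lbound_cst0 P m1 _ (lexx 0))).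
  by apply: filterS (A0 s uT) => w ->.
apply/(Lmnorm_LboundP P m1); [exact: mulr_ge0 (powR_ge0 _ _)|exact: mA|].
have x0 : 0 < (t - s) `^ alpha by rewrite powR_gt0 // subr_gt0.
rewrite EFinM -lee_pdivrMr // fineK; first exact: hx.
by rewrite ge0_fin_numE.
Qed.

End sewing_space.

Lemma choice_on (I J : Type) (D : I -> bool) (Q : I -> J -> Prop) (y0 : J) :
  (forall x, D x -> exists y, Q x y) -> exists f, forall x, D x -> Q x (f x).
Proof.
move=> h; have /choice[f hf] : forall x, exists y, D x -> Q x y.
  move=> x; have [Dx|nDx] := boolP (D x); first by have [y hy] := h x Dx; exists y.
  by exists y0 => Dx; case/negP: nDx.
by exists f.
Qed.

Theorem lemma3p3 (R : realType) (T : R) (H : monotone_family R)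
    (L : operator_family H T) (S : propagator L)
    (alpha m gamma z1 z2 : R) :
  0 < T ->
  3^-1 < alpha <= 2^-1 -> 2 <= m -> 2^-1 < z1 <= 1 -> 1 < z2 ->
  exists C : R -> R,
  forall (d : measure_display) (Omega : measurableType d)
    (P : probability Omega R) (Ft : R -> set (set Omega))
    (A : R -> R -> Omega -> H gamma) (Lambda : R -> R -> R -> Omega -> H gamma)
    (K1 K2 : R),
  usual_filtration P T Ft ->
  C2_space T P Ft alpha m A ->
  0 < K1 -> 0 < K2 ->
  (forall s r t, Delta3 T (s, r, t) ->
    [/\ measurable_wrt measurable (Lambda s r t),
        {ae P, forall w, delta2 S A s r t w = S gamma r t (Lambda s r t w)},
        (Lmnorm P m (gamma + z2 - z1)%R (Lambda s r t) <=
          (K1 * (t - s) `^ 2^-1 * (t - r) `^ (z1 - 2^-1))%:E)%E &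
        exists2 Z, condexp P (Ft s) (Lambda s r t) Z &
          (Lmnorm P m gamma Z <=
            (K2 * (t - s) * (t - r) `^ (z2 - 1))%:E)%E]) ->
  exists cA : R -> Omega -> H gamma,
    [/\ is_sewing S P Ft alpha m A cA,
        (forall cA', is_sewing S P Ft alpha m A cA' ->
          forall t, 0 <= t <= T -> {ae P, forall w, cA' t w = cA t w}) &
        (forall eta, 0 <= eta < z2 -> forall s t, Delta2 T (s, t) ->
          (Lmnorm P m (gamma + eta)%R (delta1 S cA s t \- A s t)%R <=
            (C eta * (K1 * (t - s) `^ (z1 - Num.max (eta + z1 - z2) 0)
                      + K2 * (t - s) `^ (z2 - eta)))%:E)%E)].
Proof.
move=> T0 /andP[alpha3 alpha2] m2 z1b z2b.
have m1 : 1 <= m by apply: le_trans m2; rewrite ler1n.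
have alpha0 : 0 < alpha by lra.
have [C hC] := choice_on 0 (sewing_remainder_bound S gamma m2 z1b z2b).
exists C => d Omega P Ft A Lambda K1 K2 uF CA K10 K20 hLambda.
have adA := C2_adapted CA.
have A0 := A_diag0 m2 uF adA z1b z2b K10 K20 hLambda.
have [B [eps [B0 eps0 rc]]] := ex_refinement_control m2 uF adA z1b z2b K10 K20 hLambda.
have [B' [B'0 LY cY]] := sewing_process_error T0 m2 uF adA A0 B0 eps0 rc.
have adY := sewing_process_adapted S T0 uF adA.
have Y0 := sewing_process0 T0 m2 uF adA A0 B0 eps0 rc.
have limY : sewing_limit S P m A (sewing_process S A).
  have [K K0 hK] := partition_error T0 m2 uF adA B'0 eps0 adY LY cY.
  by apply: (sewing_limit_of_error m2 K0 _ _ hK); [exact: divr_gt0|exact: adY].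
have [M M0 LA] := C2_Lbound T0 m2 uF alpha0 CA A0.
have sY : is_sewing S P Ft alpha m A (sewing_process S A).
  split => //; pose M' := M + B' * T `^ (2^-1 + eps - alpha).
  have M'0 : 0 <= M' by rewrite addr_ge0 // mulr_ge0 // powR_ge0.
  apply: (Chat_space_of_bound m2 uF alpha0 M'0 _ adY Y0).
    exact: (measurable_sewing_process S T0 (C2_measurable CA)).
  move=> s t s0 st tT; have [e he] := separable_dense_sequence H gamma.
  have D2 : Delta2 T (s, t) by split.
  have := LboundB m1 he (LA s t s0 st tT) (LY s t s0 st tT).
  rewrite (_ : (fun w => _ - _) = delta1 S (sewing_process S A) s t); last first.
    by apply/funext => w; rewrite opprB addrC subrK.
  apply: (Lbound_le m1); rewrite /M' mulrDl lerD2l -mulrA ler_wpM2l //.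
  have -> : 2^-1 + eps = (2^-1 + eps - alpha) + alpha by lra.
  rewrite powR_addr ?subr_ge0 //; last by lra.
  rewrite addrK ler_wpM2r ?powR_ge0 //; apply: powR_le; lra.
exists (sewing_process S A); split => //.
- by move=> cA' hcA' t tT; exact: sewing_unique m2 uF adA _ _ _ _ sY hcA' tT.
- move=> eta eta02 s t D2.
  exact: (hC eta eta02 d Omega P Ft A Lambda K1 K2 uF adA K10 K20 hLambda _ adY limY s t D2).
Qed.
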